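(* Let $\ell\in(0,\delta)$. There exists a $K_0$ such that for all $K>K_0$ there exists $q^\ell\in C^2(\mathbb{R})\cap \mathcal{A}^\ell_K$ (so $\mathcal{E}^\ell(q^\ell)=K$) which minimizes $T$ over $\mathcal{A}^\ell_K$. Furthermore, $q^\ell$ solves, for all $x\in\mathbb{R}$, the Euler–Lagrange equation $$c^2(q^\ell)''(x)=\int_\ell^\delta\bigl[\bar f(q^\ell(x+\xi)-q^\ell(x),\xi)-\bar f(q^\ell(x)-q^\ell(x-\xi),\xi)\bigr]\,d\xi,$$ where $c^2>0$ is the inverse of the Lagrange multiplier $\lambda$, i.e. of the number $\lambda$ such that for all $\zeta\in H$ $$\int_{\mathbb{R}}(q^\ell)'\zeta'\,dz=\lambda\int_{\mathbb{R}}\int_\ell^\delta \bar f\bigl(q^\ell(z+\xi)-q^\ell(z),\xi\bigr)\bigl(\zeta(z+\xi)-\zeta(z)\bigr)\,d\xi\,dz .$$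
   Context: Fix $\delta>0$. Let $V:\mathbb{R}\to\mathbb{R}$ be $C^2$, and let $I$ be one of the half-lines $(-\infty,0]$, $[0,\infty)$. Assume: (H1) On $I$, $V$ is non-increasing (if $I=(-\infty,0]$), respectively non-decreasing (if $I=[0,\infty)$), convex, and superquadratic, meaning that $V(x)/x^2$ is a strictly increasing function of $|x|$ for $x\in I\setminus\{0\}$. Moreover $V(0)=V'(0)=0$, $V''(0)>0$, and $V''(x)\le V''(0)+c_1|x|^{\gamma_1}+c_2|x|^{\gamma_2}$ for $x\in\mathbb{R}$, where $c_1,c_2\ge 1$ and $0<\gamma_1\le\gamma_2$. (H2) $k:\mathbb{R}\to\mathbb{R}$ is even, $m:\mathbb{R}\to\mathbb{R}$ is odd, both $m$ and $k$ vanish only at $0$ and are non-decreasing on $[0,\infty)$, and $\int_0^\delta \frac{\xi^2 k(\xi)}{m(\xi)^{\gamma_2+2}}\,d\xi<\infty$, $\int_0^\delta \frac{k(\xi)}{m(\xi)}\,d\xi<\infty$. Symmetrization: $\bar V(x)=V(x)$ for $x\in I$, $\bar V(x)=V(-x)$ for $-x\in I$; $\bar W(\eta,\xi)=\bar V\left(\frac{\eta}{m(\xi)}\right)k(\xi)$ and $\bar f(\eta,\xi)=\partial_\eta\bar W(\eta,\xi)=\bar V'\left(\frac{\eta}{m(\xi)}\right)\frac{k(\xi)}{m(\xi)}$. $H=\{q\in W^{1,2}_{\mathrm{loc}}(\mathbb{R}):\ \|q'\|_{L^2(\mathbb{R})}<\infty,\ q(0)=0\}$, $T(q)=\frac12\int_{\mathbb{R}}q'(z)^2\,dz$,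 $U(q;z)=\int_\ell^\delta \bar W(q(z+\xi)-q(z),\xi)\,d\xi$, $\mathcal{E}^\ell(q)=\int_{\mathbb{R}}U(q;z)\,dz$, and $\mathcal{A}^\ell_K=\{q\in H:\ U(q;\cdot)\in L^1(\mathbb{R}),\ \mathcal{E}^\ell(q)=K\}$. *)

(* Defs.v *)
From HB Require Import structures.
From mathcomp Require Import all_boot all_order all_algebra.
From mathcomp Require Import all_classical all_reals all_analysis.

Set Implicit Arguments.
Unset Strict Implicit.
Unset Printing Implicit Defensive.

Import Order.TTheory GRing.Theory Num.Theory.
Import numFieldNormedType.Exports.

Local Open Scope ring_scope.
Local Open Scope classical_set_scope.

(* In ring_scope the library's notation is the formal derivative of {poly R}. *)
Local Notation "f ^` ()" := (derive1 f) : ring_scope.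

Definition C2 (R : realType) (f : R -> R) : Prop :=
  [/\ forall x, derivable f x 1,
      forall x, derivable f^`() x 1
    & continuous f^`()^`()].

Section sobolev.
Context {R : realType}.
Implicit Types q p phi : R -> R.
Local Notation mu := (@lebesgue_measure R).

Definition test_function phi : Prop :=
  (forall n x, derivable phi^`(n) x 1) /\
  compact (closure [set x | phi x != 0]).

Definition is_weak_derivative q p : Prop :=
  [/\ locally_integrable [set: R] q,
      locally_integrable [set: R] p
    & forall phi, test_function phi ->
        (\int[mu]_x (q x * phi^`() x)%:E = - \int[mu]_x (p x * phi x)%:E)%E].

Definition L2_loc q : Prop :=
  forall B : set R, compact B -> q \_ B \in Lfun mu 2%:E.

Definition W12_loc q : Prop :=
  L2_loc q /\ exists2 p, is_weak_derivative q p & L2_loc p.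

(* Weak derivatives are unique up to null sets; this picks one of them.  Only
   its integrals and L^2 membership are ever used, and these do not depend on
   the choice.  Junk value 0 if there is no weak derivative. *)
Definition weak_deriv q : R -> R := xget (cst 0) [set p | is_weak_derivative q p].

(* A class in W^{1,2}_loc(R) is represented by its unique continuous
   representative, the one that gives a meaning to the condition q(0) = 0 and
   to the pointwise expressions q(z + xi) - q(z). *)
Definition H : set (R -> R) :=
  [set q | [/\ continuous q, W12_loc q, weak_deriv q \in Lfun mu 2%:E & q 0 = 0]].

Definition T q : \bar R := ((2^-1)%:E * \int[mu]_z ((weak_deriv q z) ^+ 2)%:E)%E.

End sobolev.

Record H1 (R : realType) (I : set R) (V : R -> R) (c1 c2 gamma1 gamma2 : R)
    : Prop := {
  H1_monotone :
    (I = `]-oo, 0] /\ {in I &, {homo V : x y /~ x <= y}}) \/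
    (I = `[0, +oo[ /\ {in I &, {homo V : x y / x <= y}});
  H1_convex : @convex_function R R^o I V;
  H1_superquadratic : forall x y, x \in I -> y \in I -> x != 0 -> y != 0 ->
    `|x| < `|y| -> V x / x ^+ 2 < V y / y ^+ 2;
  H1_V0 : V 0 = 0;
  H1_dV0 : V^`() 0 = 0;
  H1_ddV0 : 0 < V^`()^`() 0;
  H1_c1 : 1 <= c1;
  H1_c2 : 1 <= c2;
  H1_gamma1 : 0 < gamma1;
  H1_gamma2 : gamma1 <= gamma2;
  H1_growth : forall x, V^`()^`() x <=
    V^`()^`() 0 + c1 * `|x| `^ gamma1 + c2 * `|x| `^ gamma2
}.

Record H2 (R : realType) (k m : R -> R) (delta gamma2 : R) : Prop := {
  H2_k_even : forall x, k (- x) = k x;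
  H2_m_odd : forall x, m (- x) = - m x;
  H2_k_zero : forall x, k x = 0 <-> x = 0;
  H2_m_zero : forall x, m x = 0 <-> x = 0;
  H2_k_nondecreasing : {in `[0, +oo[ &, {homo k : x y / x <= y}};
  H2_m_nondecreasing : {in `[0, +oo[ &, {homo m : x y / x <= y}};
  H2_int1 : (\int[@lebesgue_measure R]_(xi in `]0%R, delta])
    (xi ^+ 2 * k xi / m xi `^ (gamma2 + 2))%:E < +oo)%E;
  H2_int2 : (\int[@lebesgue_measure R]_(xi in `]0%R, delta])
    (k xi / m xi)%:E < +oo)%E
}.

Section energy.
Context {R : realType}.
Variables (I : set R) (V k m : R -> R) (l delta : R).
Implicit Types q : R -> R.
Local Notation mu := (@lebesgue_measure R).

Definition Vbar (x : R) : R := if x \in I then V x else V (- x).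

Definition Wbar (eta xi : R) : R := Vbar (eta / m xi) * k xi.

Definition fbar (eta xi : R) : R := (fun e => Wbar e xi)^`() eta.

Definition U q (z : R) : \bar R :=
  (\int[mu]_(xi in `[l, delta]) (Wbar (q (z + xi) - q z) xi)%:E)%E.

Definition energy q : \bar R := (\int[mu]_z U q z)%E.

Definition A (K : R) : set (R -> R) :=
  [set q | [/\ H q, mu.-integrable [set: R] (U q) & energy q = K%:E]].

Definition is_multiplier q (lambda : R) : Prop :=
  forall zeta, H zeta ->
    (\int[mu]_z (weak_deriv q z * weak_deriv zeta z)%:E =
     lambda%:E * \int[mu]_z \int[mu]_(xi in `[l, delta])
       (fbar (q (z + xi) - q z) xi * (zeta (z + xi) - zeta z))%:E)%E.

(* An equality of extended reals whose left-hand side is finite, so that it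
   also says that the integral on the right is a finite number. *)
Definition euler_lagrange q (csq : R) : Prop :=
  forall x, ((csq * q^`()^`() x)%:E =
    \int[mu]_(xi in `[l, delta])
      (fbar (q (x + xi) - q x) xi - fbar (q x - q (x - xi)) xi)%:E)%E.

End energy.

(* Main.v *)
Require Import Defs.
From HB Require Import structures.
From mathcomp Require Import all_boot all_order all_algebra.
From mathcomp Require Import all_classical all_reals all_analysis.
From mathcomp Require Import measurable_realfun ring lra.
Import Order.TTheory GRing.Theory Num.Theory.
Import numFieldNormedType.Exports.
Set Implicit Arguments.
Unset Strict Implicit.
Unset Printing Implicit Defensive.
Local Open Scope ring_scope.
Local Open Scope classical_set_scope.

(* Everything is expressed through u = q' in L^2(R).  The energy becomes a convex
   functional E with Lipschitz gradient dE, E u being the integral of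
   Vbar (omega * D u) * kappa over the pairs (z, xi), where D u (z, xi) is the
   integral of u over [z, z + xi], and one minimizes the squared norm of u over
   {E u >= K}.  By convexity, replacing u by the multiple of dE u with the same norm
   increases E unless u is itself that multiple; hence minimizing sequences may be
   taken uniformly bounded and Lipschitz, and a minimizer solves u = a dE u, which is
   the Euler-Lagrange equation.  Translate the sequence so that it does not vanish at
   0 and take a pointwise limit u; norm and energy both split asymptotically
   (Brezis-Lieb) into those of u and of the remainder.  Superquadraticity excludes a
   splitting of the energy, because E (t u) > t^2 E u for t > 1; it also excludes
   vanishing, because for large K some function has more energy than the infimum of
   Vbar x / x^2 allows to sequences whose strain tends to 0.  Finally E u = K, as a
   minimizer with E u > K could be scaled down.

   Weak derivatives are handled by the du Bois-Reymond lemma: a function of H is the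
   primitive of its weak derivative. *)

(** The problem on the whole line is translation invariant: a bounded sequence in L^2(R) may lose
    mass at infinity, and weak convergence does not pass through the nonlinear energy. Pointwise
    limits do, and equi-Lipschitz sequences have them; [improvement] produces such sequences because
    [elastic_gradient] gains a derivative, uniformly on balls of L^2. On a ball the strain is
    bounded, by Cauchy-Schwarz over windows of length at most [delta], so the potential is sampled
    only on a bounded interval, where its derivative is Lipschitz; as l > 0, the weights are bounded
    too. Hence every density is at most quadratic in [D u].

    The constraint is relaxed to E u >= K because improving may raise the energy. Let nstar be the
    infimum. If the limit had E u < K, scaling would give normsq u > (E u / K) nstar, while the
    remainders asymptotically need at least (1 - E u / K) nstar; the sum would exceed nstar.

    The threshold K0 is the energy of the indicator of one long interval. Multiples of that function
    reach every larger K and keep the strict inequality that excludes vanishing. *)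

Ltac nneg := solve [repeat first [done | exact: sqr_ge0 | exact: normr_ge0
  | apply: mulr_ge0 | apply: addr_ge0 | rewrite invr_ge0 | exact: ltW]].

Local Notation "f ^` ()" := (derive1 f) : ring_scope.

(** * Square-integrable functions and kernel operators *)

Section real_integrals.
Context d (T : measurableType d) (R : realType).
Variable mu : {measure set T -> \bar R}.
Implicit Types f g : T -> R.

Definition Rintegrable f := mu.-integrable [set: T] (EFin \o f).

Definition sqint f :=
  measurable_fun [set: T] f /\ Rintegrable (fun x => f x ^+ 2).

Lemma Rintegrable_measurable f : Rintegrable f -> measurable_fun [set: T] f.
Proof. by move=> /integrableP[/measurable_EFinP]. Qed.

Lemma Rintegrable_le f g : measurable_fun [set: T] f ->
  (forall x, `|f x| <= g x) -> Rintegrable g -> Rintegrable f.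
Proof.
move=> mf fg; apply: le_integrable => //; first exact/measurable_EFinP.
by move=> x _; rewrite /= lee_fin (le_trans (fg x))// ler_norm.
Qed.

Lemma RintegrableD f g : Rintegrable f -> Rintegrable g ->
  Rintegrable (fun x => f x + g x).
Proof. exact: integrableD. Qed.

Lemma RintegrableB f g : Rintegrable f -> Rintegrable g ->
  Rintegrable (fun x => f x - g x).
Proof. exact: integrableB. Qed.

Lemma RintegrableZ (c : R) f : Rintegrable f -> Rintegrable (fun x => c * f x).
Proof. exact: integrableZl. Qed.

Lemma Rintegrable_norm f : Rintegrable f -> Rintegrable (fun x => `|f x|).
Proof. exact: integrable_norm. Qed.

Lemma integral_EFin f : Rintegrable f ->
  (\int[mu]_x (f x)%:E)%E = (\int[mu]_x f x)%:E.
Proof. by move=> fi; rewrite /Rintegral fineK//; exact: integrable_fin_num. Qed.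

Lemma ge0_Rintegrable f : measurable_fun [set: T] f -> (forall x, 0 <= f x) ->
  (\int[mu]_x (f x)%:E < +oo)%E -> Rintegrable f.
Proof.
move=> mf f0 fi; apply/integrableP; split; first exact/measurable_EFinP.
by under eq_integral do rewrite /= ger0_norm//.
Qed.

Lemma integral_lee_fin f (c : R) : (forall x, 0 <= f x) ->
  (\int[mu]_x (f x)%:E <= c%:E)%E -> \int[mu]_x f x <= c.
Proof.
move=> f0 fc; rewrite /Rintegral -lee_fin fineK//.
rewrite ge0_fin_numE ?integral_ge0//; last by move=> x _; rewrite lee_fin.
by rewrite (le_lt_trans fc) ?ltry.
Qed.

Lemma sqint_measurable f : sqint f -> measurable_fun [set: T] f.
Proof. by case. Qed.

Lemma sqintM f g : sqint f -> sqint g -> Rintegrable (fun x => f x * g x).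
Proof.
move=> [mf fi] [mg gi].
apply: (Rintegrable_le (g := fun x => f x ^+ 2 + g x ^+ 2)).
- exact: measurable_funM.
- move=> x; rewrite normrM -[f x ^+ 2]real_normK ?num_real//.
  rewrite -[g x ^+ 2]real_normK ?num_real//.
  by have := sqr_ge0 (`|f x| - `|g x|); have := sqr_ge0 (`|f x| + `|g x|); nra.
- exact: RintegrableD.
Qed.

Lemma sqintZ (c : R) f : sqint f -> sqint (fun x => c * f x).
Proof.
move=> [mf fi]; split; first exact: measurable_funM.
by under eq_fun do rewrite exprMn; exact: RintegrableZ.
Qed.

Lemma sqintD f g : sqint f -> sqint g -> sqint (fun x => f x + g x).
Proof.
move=> lf lg; have fg := sqintM lf lg; case: lf lg => [mf fi] [mg gi].
split; first exact: measurable_funD.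
rewrite (_ : (fun x => _) = (fun x => f x ^+ 2 + 2 * (f x * g x) + g x ^+ 2)).
  by apply: RintegrableD => //; apply: RintegrableD => //; exact: RintegrableZ.
by apply/funext => x; ring.
Qed.

Lemma sqintB f g : sqint f -> sqint g -> sqint (fun x => f x - g x).
Proof.
move=> lf lg; have := sqintD lf (sqintZ (-1) lg).
by under eq_fun do rewrite mulN1r.
Qed.

Lemma Rintegral_sqrB f g : sqint f -> sqint g ->
  \int[mu]_x (f x - g x) ^+ 2 =
  \int[mu]_x f x ^+ 2 - 2 * (\int[mu]_x (f x * g x)) + \int[mu]_x g x ^+ 2.
Proof.
move=> lf lg; have fg := sqintM lf lg; case: lf lg => [mf fi] [mg gi].
rewrite (_ : (fun x => (f x - g x) ^+ 2) =
  (fun x => (f x ^+ 2 - 2 * (f x * g x)) + g x ^+ 2)); last first.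
  by apply/funext => x; ring.
rewrite RintegralD//; last by apply: RintegrableB => //; exact: RintegrableZ.
by rewrite RintegralB//; [rewrite RintegralZl|exact: RintegrableZ].
Qed.

(* Integrating [2 t |v| k <= t^2 k + v^2 k] and optimising over t. *)
Lemma weighted_cauchy_schwarz (v k : T -> R) : measurable_fun [set: T] v ->
  (forall x, 0 <= k x) -> Rintegrable k -> Rintegrable (fun x => v x ^+ 2 * k x) ->
  Rintegrable (fun x => v x * k x) /\
  (\int[mu]_x (v x * k x)) ^+ 2 <=
    (\int[mu]_x k x) * (\int[mu]_x (v x ^+ 2 * k x)).
Proof.
move=> mv k0 ki vki; have mk := Rintegrable_measurable ki.
have vi : Rintegrable (fun x => v x * k x).
  apply: (Rintegrable_le (g := fun x => k x + v x ^+ 2 * k x)).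
  - exact: measurable_funM.
  - move=> x; rewrite normrM [`|k x|]ger0_norm//.
    rewrite -[v x ^+ 2]real_normK ?num_real//.
    by have := k0 x; have := normr_ge0 (v x); have := sqr_ge0 (`|v x| - 1); nra.
  - exact: RintegrableD.
split => //.
set A := \int[mu]_x k x; set B := \int[mu]_x (_ ^+ 2 * _); set I := \int[mu]_x _.
have A0 : 0 <= A by exact: Rintegral_ge0.
have H t : 2 * t * I <= t ^+ 2 * A + B.
  rewrite /I /A /B -!RintegralZl// -RintegralD//; last exact: RintegrableZ.
  apply: le_Rintegral => //; first exact: RintegrableZ.
    by apply: RintegrableD => //; exact: RintegrableZ.
  by move=> x _; have := k0 x; have := sqr_ge0 (v x - t); nra.
have [A_eq0|A_neq0] := eqVneq A 0.
  have [I_eq0|I_neq0] := eqVneq I 0; first by rewrite I_eq0 A_eq0 expr0n/= mul0r.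
  (* With [A = 0] the bound [H] reads [2 t I <= B] for every [t], and this [t] turns it into
     [B + 1 <= B]; so [I] must vanish. *)
  have := H ((B + 1) / (2 * I)); rewrite A_eq0.
  have -> : 2 * ((B + 1) / (2 * I)) * I = B + 1 by field.
  by lra.
have := H (I / A).
have -> : 2 * (I / A) * I = 2 * (I ^+ 2 / A) by field.
have -> : (I / A) ^+ 2 * A = I ^+ 2 / A by field.
have {A_neq0}A0 : 0 < A by rewrite lt_neqAle eq_sym A_neq0.
move=> H1; have {}H1 : I ^+ 2 / A <= B by move: H1; set J := I ^+ 2 / A; lra.
by rewrite mulrC -ler_pdivrMr.
Qed.

Lemma cvg_Rintegral (w : nat -> T -> R) f g :
  (forall n, measurable_fun [set: T] (w n)) ->
  (forall n x, `|w n x| <= g x) -> Rintegrable g ->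
  (forall x, w ^~ x @ \oo --> f x) ->
  (fun n => \int[mu]_x w n x) @ \oo --> \int[mu]_x f x.
Proof.
move=> mw wg gi wf.
have fi : Rintegrable f.
  apply: (Rintegrable_le (g := g)) => //.
    by apply: measurable_fun_cvg => //= x _; exact: wf.
  move=> x; rewrite -(cvg_lim _ (cvg_norm (wf x)))//; apply: limr_le.
    by apply/cvg_ex; eexists; exact: cvg_norm (wf x).
  by apply: nearW => n; exact: wg.
apply/fine_cvg; rewrite -integral_EFin//.
apply: (@dominated_cvg _ _ _ mu setT _ (fun n x => (w n x)%:E)
  (EFin \o f) (EFin \o g)) => //.
- by move=> n; exact/measurable_EFinP.
- by move=> x _; apply/cvg_EFin; [exact: nearW|exact: wf].
- by move=> n x _ /=; rewrite lee_fin.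
Qed.

(* Subtracting a small multiple of the bounded integrals of the squares leaves
   [(|w_n g| - e w_n^2)^+ <= g^2 / (4 e)], which is dominated. *)
Lemma cvg_Rintegral_sqintM (w : nat -> T -> R) g (M : R) :
  (forall n, sqint (w n)) -> (forall n, \int[mu]_x w n x ^+ 2 <= M) ->
  (forall x, w ^~ x @ \oo --> 0) -> sqint g ->
  (fun n => \int[mu]_x `|w n x * g x|) @ \oo --> 0.
Proof.
move=> lw wM w0 lg.
have M0 : 0 <= M by apply: le_trans (wM 0%N); apply: Rintegral_ge0 => x _; exact: sqr_ge0.
apply/cvgrPdist_lt => _/posnumP[e].
(* Chosen so that [c * M <= e / 2]; the [+ 1] keeps the denominator positive when [M = 0]. *)
pose c := e%:num / (2 * (M + 1)).
have c0 : 0 < c by rewrite divr_gt0// mulr_gt0//; lra.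
pose phi n x := Num.max (`|w n x * g x| - c * w n x ^+ 2) 0.
have mphi n : measurable_fun setT (phi n).
  apply: measurable_maxr => //; apply: measurable_funB.
    by apply: measurableT_comp => //; apply: measurable_funM; [case: (lw n)|case: lg].
  by apply: measurable_funM => //; apply: measurable_funX; case: (lw n).
have phi_le n x : `|phi n x| <= (4 * c)^-1 * g x ^+ 2.
  rewrite ger0_norm; last by rewrite le_max lexx orbT.
  rewrite ge_max; apply/andP; split; last first.
    by rewrite mulr_ge0 ?sqr_ge0// invr_ge0 mulr_ge0// ltW.
  rewrite normrM -[w n x ^+ 2]real_normK ?num_real// -[g x ^+ 2]real_normK ?num_real//.
  rewrite -subr_ge0.
  have -> : (4 * c)^-1 * `|g x| ^+ 2 - (`|w n x| * `|g x| - c * `|w n x| ^+ 2) =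
     c * (`|w n x| - `|g x| / (2 * c)) ^+ 2 by field; rewrite gt_eqF.
  by rewrite mulr_ge0 ?sqr_ge0// ltW.
have phi0 : (fun n => \int[mu]_x phi n x) @ \oo --> \int[mu]_x (fun=> 0 : R) x.
  apply: (cvg_Rintegral mphi phi_le); first by apply: RintegrableZ; case: lg.
  move=> x; apply: (@squeeze_cvgr _ _ _ _ (fun=> 0) (fun n => `|w n x * g x|)).
  - apply: nearW => n; rewrite le_max lexx orbT ge_max normr_ge0 andbT/=.
    by rewrite gerBl mulr_ge0 ?sqr_ge0// ltW.
  - exact: cvg_cst.
  - rewrite -(normr0 R) -(mul0r (g x)).
    by apply: cvg_norm; apply: cvgMl; exact: w0.
rewrite Rintegral_cst// mul0r in phi0.
move/cvgrPdist_lt : phi0 => /(_ (e%:num / 2)) [//|N _ HN].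
exists N => // n Nn; rewrite sub0r normrN ger0_norm; last exact: Rintegral_ge0.
have phii : Rintegrable (phi n).
  by apply: (Rintegrable_le (mphi n) (phi_le n)); apply: RintegrableZ; case: lg.
have wi : Rintegrable (fun x => c * w n x ^+ 2) by apply: RintegrableZ; case: (lw n).
apply: (@le_lt_trans _ _ (\int[mu]_x (phi n x + c * w n x ^+ 2))).
  apply: le_Rintegral => //.
  - exact/Rintegrable_norm/sqintM.
  - exact: RintegrableD.
  - by move=> x _; rewrite -lerBlDr le_max lexx.
rewrite RintegralD// RintegralZl//; last by case: (lw n).
have : c * \int[mu]_x w n x ^+ 2 <= e%:num / 2.
  apply: (@le_trans _ _ (c * M)); first by rewrite ler_pM2l.
  rewrite /c (_ : _ * M = (e%:num / 2) * (M / (M + 1))); last by field; lra.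
  by rewrite ler_piMr// ler_pdivrMr; lra.
have := HN n Nn; rewrite /= sub0r normrN ger0_norm; last first.
  by apply: Rintegral_ge0 => x _; rewrite le_max lexx orbT.
by lra.
Qed.

End real_integrals.

Section kernel_operators.
Context d1 d2 (T1 : measurableType d1) (T2 : measurableType d2) (R : realType).
Variables (m1 : {sigma_finite_measure set T1 -> \bar R}).
Variables (m2 : {sigma_finite_measure set T2 -> \bar R}).

(** Integrability in [y] is not at stake: the positive and the negative part have measurable
    integrals by Tonelli, and [fine], which sends infinite values to 0, is measurable. *)
Lemma measurable_Rintegral_snd (f : T1 * T2 -> R) :
  measurable_fun [set: T1 * T2] f ->
  measurable_fun [set: T1] (fun x => \int[m2]_y f (x, y)).
Proof.
move=> mf; apply: measurableT_comp; first exact: fine_measurable.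
under eq_fun do rewrite integralE.
apply: emeasurable_funB.
- rewrite (_ : (fun x : T1 => _) = fubini_F m2 (EFin \o f)^\+%E); last first.
    by apply/funext => x; apply: eq_integral => y _; rewrite !funeposE.
  apply: measurable_fun_fubini_tonelli_F => //.
  by apply: measurable_funepos; exact/measurable_EFinP.
- rewrite (_ : (fun x : T1 => _) = fubini_F m2 (EFin \o f)^\-%E); last first.
    by apply/funext => x; apply: eq_integral => y _; rewrite !funenegE.
  apply: measurable_fun_fubini_tonelli_F => //.
  by apply: measurable_funeneg; exact/measurable_EFinP.
Qed.

Lemma measurable_Rintegral_fst (f : T1 * T2 -> R) :
  measurable_fun [set: T1 * T2] f ->
  measurable_fun [set: T2] (fun y => \int[m1]_x f (x, y)).
Proof.
move=> mf; apply: measurableT_comp; first exact: fine_measurable.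
under eq_fun do rewrite integralE.
apply: emeasurable_funB.
- rewrite (_ : (fun x : T2 => _) = fubini_G m1 (EFin \o f)^\+%E); last first.
    by apply/funext => x; apply: eq_integral => y _; rewrite !funeposE.
  apply: measurable_fun_fubini_tonelli_G => //.
  by apply: measurable_funepos; exact/measurable_EFinP.
- rewrite (_ : (fun x : T2 => _) = fubini_G m1 (EFin \o f)^\-%E); last first.
    by apply/funext => x; apply: eq_integral => y _; rewrite !funenegE.
  apply: measurable_fun_fubini_tonelli_G => //.
  by apply: measurable_funeneg; exact/measurable_EFinP.
Qed.

Lemma Rintegrable12 (f : T1 * T2 -> R) (g : T1 -> R) :
  measurable_fun [set: T1 * T2] f -> (forall x, 0 <= f x) ->
  (forall x, (\int[m2]_y (f (x, y))%:E <= (g x)%:E)%E) -> Rintegrable m1 g ->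
  Rintegrable (m1 \x m2)%E f.
Proof.
move=> mf f0 fg gi; apply/integrable12ltyP; first exact/measurable_EFinP.
apply: (@le_lt_trans _ _ (\int[m1]_x (g x)%:E)%E); last first.
  by rewrite integral_EFin// ltry.
apply: ge0_le_integral => //.
- by move=> x _; apply: integral_ge0.
- apply: (@measurable_fun_fubini_tonelli_F _ _ _ _ _ m2 (fun z => `|(f z)%:E|%E)) => //.
  by apply: measurableT_comp => //; exact/measurable_EFinP.
- exact/measurable_EFinP/(Rintegrable_measurable gi).
- move=> x _; under eq_integral do rewrite /= ger0_norm//.
  exact: fg.
Qed.

Lemma Rintegrable21 (f : T1 * T2 -> R) (g : T2 -> R) :
  measurable_fun [set: T1 * T2] f -> (forall x, 0 <= f x) ->
  (forall y, (\int[m1]_x (f (x, y))%:E <= (g y)%:E)%E) -> Rintegrable m2 g ->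
  Rintegrable (m1 \x m2)%E f.
Proof.
move=> mf f0 fg gi; apply/integrable21ltyP; first exact/measurable_EFinP.
apply: (@le_lt_trans _ _ (\int[m2]_x (g x)%:E)%E); last first.
  by rewrite integral_EFin// ltry.
apply: ge0_le_integral => //.
- by move=> x _; apply: integral_ge0.
- apply: (@measurable_fun_fubini_tonelli_G _ _ _ _ _ m1 (fun z => `|(f z)%:E|%E)) => //.
  by apply: measurableT_comp => //; exact/measurable_EFinP.
- exact/measurable_EFinP/(Rintegrable_measurable gi).
- move=> x _; under eq_integral do rewrite /= ger0_norm//.
  exact: fg.
Qed.

Variables (K : T1 * T2 -> R) (a : T1 -> R).
Hypothesis mK : measurable_fun [set: T1 * T2] K.
Hypothesis K0 : forall z, 0 <= K z.
Hypothesis K1 : forall z, K z <= 1.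
Hypothesis Ka : forall x, (\int[m2]_y (K (x, y))%:E = (a x)%:E)%E.

Lemma kernel_cauchy_schwarz (v : T2 -> R) x : sqint m2 v ->
  [/\ Rintegrable m2 (fun y => v y * K (x, y)),
      Rintegrable m2 (fun y => v y ^+ 2 * K (x, y)) &
      (\int[m2]_y (v y * K (x, y))) ^+ 2 <=
        a x * \int[m2]_y (v y ^+ 2 * K (x, y))].
Proof.
move=> [mv vi].
have mKx : measurable_fun [set: T2] (fun y => K (x, y)).
  by apply: measurableT_comp => //; exact: pair1_measurable.
have Kxi : Rintegrable m2 (fun y => K (x, y)).
  by apply: ge0_Rintegrable => //; rewrite Ka ltry.
have vKi : Rintegrable m2 (fun y => v y ^+ 2 * K (x, y)).
  apply: Rintegrable_le vi; first by apply: measurable_funM => //; exact: measurable_funX.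
  move=> y; rewrite ger0_norm; first by rewrite ler_piMr ?sqr_ge0.
  by nneg.
have [vKi1] := weighted_cauchy_schwarz mv (fun y => K0 (x, y)) Kxi vKi.
by split => //; move: b; rewrite {2}/Rintegral Ka.
Qed.

(** Cauchy-Schwarz against the weight [K (x, y)] costs the factor [a x]; after Tonelli, the column
    integrals of [rho * a * K] are what [C] bounds. The weight [rho] is carried along so that the
    constant stays explicit: it becomes [quadratic_coeff]. *)
Lemma schur_test (v : T2 -> R) (rho : T1 -> R) (C : R) : sqint m2 v ->
  measurable_fun [set: T1] rho -> (forall x, 0 <= rho x) ->
  (forall y, (\int[m1]_x (rho x * a x * K (x, y))%:E <= C%:E)%E) ->
  Rintegrable m1 (fun x => rho x * (\int[m2]_y (v y * K (x, y))) ^+ 2) /\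
  \int[m1]_x (rho x * (\int[m2]_y (v y * K (x, y))) ^+ 2) <=
    C * \int[m2]_y v y ^+ 2.
Proof.
move=> lv mrho rho0 KC; have [mv vi] := lv.
have a0 x : 0 <= a x by rewrite -lee_fin -Ka; apply: integral_ge0 => y _; rewrite lee_fin.
have ma : measurable_fun [set: T1] a.
  rewrite (_ : a = fun x => \int[m2]_y K (x, y)).
    exact: measurable_Rintegral_snd.
  by apply/funext => x; rewrite /Rintegral Ka.
have mker : measurable_fun [set: T1] (fun x => \int[m2]_y (v y * K (x, y))).
  apply: (@measurable_Rintegral_snd (fun z => v z.2 * K z)).
  by apply: measurable_funM => //; exact: measurableT_comp.
have mf : measurable_fun [set: T1]
    (fun x => rho x * (\int[m2]_y (v y * K (x, y))) ^+ 2).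
  by apply: measurable_funM => //; exact: measurable_funX.
have f0 x : 0 <= rho x * (\int[m2]_y (v y * K (x, y))) ^+ 2.
  by nneg.
have mg : measurable_fun [set: T1 * T2] (fun z => rho z.1 * a z.1 * (v z.2 ^+ 2 * K z)).
  apply: measurable_funM; first by apply: measurable_funM; exact: measurableT_comp.
  by apply: measurable_funM => //; apply: measurable_funX; exact: measurableT_comp.
suff le : (\int[m1]_x (rho x * (\int[m2]_y (v y * K (x, y))) ^+ 2)%:E <=
    (C * \int[m2]_y v y ^+ 2)%:E)%E.
  split; last exact: integral_lee_fin.
  by apply: ge0_Rintegrable => //; rewrite (le_lt_trans le) ?ltry.
apply: (@le_trans _ _ (\int[m1]_x \int[m2]_y (rho x * a x * (v y ^+ 2 * K (x, y)))%:E)%E).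
  apply: ge0_le_integral => //.
  - by move=> x _; rewrite lee_fin.
  - exact/measurable_EFinP.
  - apply: (@measurable_fun_fubini_tonelli_F _ _ _ _ _ m2
      (fun z => (rho z.1 * a z.1 * (v z.2 ^+ 2 * K z))%:E)) => //.
      exact/measurable_EFinP.
    by move=> z; rewrite lee_fin; nneg.
  - move=> x _; have [vK1 vK2 vKle] := kernel_cauchy_schwarz x lv.
    rewrite integral_EFin; last exact: RintegrableZ.
    rewrite lee_fin RintegralZl// -mulrA.
    by rewrite ler_wpM2l.
rewrite (@fubini_tonelli _ _ _ _ _ m1 m2
    (fun z => (rho z.1 * a z.1 * (v z.2 ^+ 2 * K z))%:E)) /=; last 2 first.
- exact/measurable_EFinP.
- by move=> z; rewrite lee_fin; nneg.
rewrite EFinM -integral_EFin// -ge0_integralZl//=; first last.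
- by apply: le_trans (KC point); apply: integral_ge0 => x _; rewrite lee_fin; nneg.
- by move=> y _; rewrite lee_fin sqr_ge0.
- exact/measurable_EFinP/(Rintegrable_measurable vi).
apply: ge0_le_integral => //.
- by move=> y _; apply: integral_ge0 => x _; rewrite lee_fin; nneg.
- apply: (@measurable_fun_fubini_tonelli_G _ _ _ _ _ m1
      (fun z => (rho z.1 * a z.1 * (v z.2 ^+ 2 * K z))%:E)) => //.
    exact/measurable_EFinP.
  by move=> z; rewrite lee_fin; nneg.
- apply: emeasurable_funM => //.
  exact/measurable_EFinP/(Rintegrable_measurable vi).
- move=> y _.
  under eq_integral do rewrite mulrCA EFinM.
  rewrite ge0_integralZl//=.
  + by rewrite muleC lee_wpmul2r// lee_fin sqr_ge0.
  + apply/measurable_EFinP; apply: measurable_funM; first exact: measurable_funM.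
    by apply: measurableT_comp => //; exact: pair2_measurable.
  + by move=> x _; rewrite lee_fin; nneg.
  + by rewrite lee_fin sqr_ge0.
Qed.

(** This is Fubini for [h v K], which is dominated by [h^2 K + v^2 K]; each term is integrable
    because both marginals of [K] are bounded. *)
Lemma kernel_adjoint (b : T2 -> R) (C1 C2 : R) (h : T1 -> R) (v : T2 -> R) :
  (forall x, a x <= C1) ->
  (forall y, (\int[m1]_x (K (x, y))%:E = (b y)%:E)%E) -> (forall y, b y <= C2) ->
  sqint m1 h -> sqint m2 v ->
  \int[m1]_x (h x * \int[m2]_y (v y * K (x, y))) =
  \int[m2]_y (v y * \int[m1]_x (h x * K (x, y))).
Proof.
move=> aC1 Kb bC2 [mh hi] [mv vi].
have mhK : measurable_fun [set: T1 * T2] (fun z => h z.1 ^+ 2 * K z).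
  by apply: measurable_funM => //; apply: measurable_funX; exact: measurableT_comp.
have mvK : measurable_fun [set: T1 * T2] (fun z => v z.2 ^+ 2 * K z).
  by apply: measurable_funM => //; apply: measurable_funX; exact: measurableT_comp.
have hKi : Rintegrable (m1 \x m2)%E (fun z => h z.1 ^+ 2 * K z).
  apply: (Rintegrable12 (g := fun x => C1 * h x ^+ 2)) => //; last exact: RintegrableZ.
    by move=> z; nneg.
  move=> x /=; under eq_integral do rewrite EFinM.
  rewrite ge0_integralZl//=; last 3 first.
  - apply/measurable_EFinP; apply: measurableT_comp => //; exact: pair1_measurable.
  - by move=> y _; rewrite lee_fin.
  - by rewrite lee_fin sqr_ge0.
  by rewrite Ka -EFinM lee_fin mulrC ler_wpM2r ?sqr_ge0.
have vKi : Rintegrable (m1 \x m2)%E (fun z => v z.2 ^+ 2 * K z).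
  apply: (Rintegrable21 (g := fun x => C2 * v x ^+ 2)) => //; last exact: RintegrableZ.
    by move=> z; nneg.
  move=> x /=; under eq_integral do rewrite EFinM.
  rewrite ge0_integralZl//=; last 3 first.
  - apply/measurable_EFinP; apply: measurableT_comp => //; exact: pair2_measurable.
  - by move=> y _; rewrite lee_fin.
  - by rewrite lee_fin sqr_ge0.
  by rewrite Kb -EFinM lee_fin mulrC ler_wpM2r ?sqr_ge0.
have hvK : Rintegrable (m1 \x m2)%E (fun z => h z.1 * v z.2 * K z).
  apply: Rintegrable_le (RintegrableD hKi vKi).
    apply: measurable_funM => //; apply: measurable_funM; exact: measurableT_comp.
  move=> z; rewrite !normrM [`|K z|]ger0_norm//.
  rewrite -[h _ ^+ 2]real_normK ?num_real// -[v _ ^+ 2]real_normK ?num_real//.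
  rewrite -mulrDl ler_wpM2r//.
  by have := sqr_ge0 (`|h z.1| - `|v z.2|); have := sqr_ge0 (`|h z.1| + `|v z.2|); nra.
have lhs : fine (\int[m1]_x fubini_F m2 (EFin \o (fun z : T1 * T2 => h z.1 * v z.2 * K z)%R) x)%E =
    \int[m1]_x (h x * \int[m2]_y (v y * K (x, y))).
  congr fine; apply: ae_eq_integral => //.
  - exact: measurable_fubini_F hvK.
  - apply/measurable_EFinP; apply: measurable_funM => //.
    apply: (@measurable_Rintegral_snd (fun z => v z.2 * K z)).
    by apply: measurable_funM => //; exact: measurableT_comp.
  - apply: aeW => x _ /=; rewrite /fubini_F /=.
    have [vK _ _] := kernel_cauchy_schwarz x (conj mv vi).
    rewrite -RintegralZl// -integral_EFin; last exact: RintegrableZ.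
    by apply: eq_integral => y _; rewrite mulrA.
have hKae : {ae m2, forall y, Rintegrable m1 (fun x => h x * K (x, y))}.
  apply: aeW => y.
  have mKy : measurable_fun [set: T1] (fun x => K (x, y)).
    by apply: measurableT_comp => //; exact: pair2_measurable.
  apply: (weighted_cauchy_schwarz mh (fun x => K0 (x, y)) _ _).1.
    by apply: ge0_Rintegrable => //; rewrite Kb ltry.
  apply: Rintegrable_le hi; first by apply: measurable_funM => //; exact: measurable_funX.
  move=> x; rewrite ger0_norm; first by rewrite ler_piMr ?sqr_ge0.
  by nneg.
have rhs : fine (\int[m2]_x fubini_G m1 (EFin \o (fun z : T1 * T2 => h z.1 * v z.2 * K z)%R) x)%E =
    \int[m2]_y (v y * \int[m1]_x (h x * K (x, y))).
  congr fine; apply: ae_eq_integral => //.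
  - exact: measurable_fubini_G hvK.
  - apply/measurable_EFinP; apply: measurable_funM => //.
    apply: (@measurable_Rintegral_fst (fun z => h z.1 * K z)).
    by apply: measurable_funM => //; exact: measurableT_comp.
  - apply: filterS (hKae) => y /= hKi' _.
    rewrite /fubini_G /=.
    rewrite -RintegralZl// -integral_EFin; last exact: RintegrableZ.
    by apply: eq_integral => x _; rewrite mulrAC mulrC.
by rewrite -lhs -rhs integral12_prod_meas1// integral21_prod_meas1.
Qed.

End kernel_operators.

(** * Primitives and the strain operator *)

Section primitives.
Context (R : realType).
Notation mu := (@lebesgue_measure R).
Implicit Types u : R -> R.

Definition locint u := forall a b, mu.-integrable `[a, b] (EFin \o u).

(** At least one of the two intervals is empty or a point, so this is the signed integral of [u]
    from 0 to [x]. *)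
Definition prim u (x : R) : R :=
  \int[mu]_(t in `[0, x]) u t - \int[mu]_(t in `[x, 0]) u t.

Lemma sqint_locint u : sqint mu u -> locint u.
Proof.
move=> [mu_ ui] a b.
have ab : mu.-integrable `[a, b] (EFin \o cst 1).
  apply: continuous_compact_integrable; first exact: segment_compact.
  by apply: continuous_subspaceT => x; exact: cst_continuous.
have u2 : mu.-integrable `[a, b] (EFin \o (fun x => u x ^+ 2)).
  by apply: integrableS ui.
apply: (le_integrable _ _ _ (integrableD _ ab u2)) => //.
  by apply/measurable_EFinP; exact: measurable_funS mu_.
move=> x _ /=; rewrite lee_fin -[u x ^+ 2]real_normK ?num_real// [leRHS]ger0_norm.
  by have := sqr_ge0 (`|u x| - 1); have := normr_ge0 (u x); nra.
by nneg.
Qed.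

Lemma continuous_locint u : continuous u -> locint u.
Proof.
by move=> cu a b; apply: continuous_compact_integrable; [exact: segment_compact|exact: continuous_subspaceT].
Qed.

Lemma prim0 u : prim u 0 = 0. Proof. exact: subrr. Qed.

Lemma Rintegral_itv_rev u a b : b <= a -> \int[mu]_(t in `[a, b]) u t = 0.
Proof.
rewrite le_eqVlt => /predU1P[->|ba]; first by rewrite set_itv1 Rintegral_set1.
by rewrite set_itv_ge ?Rintegral_set0// bnd_simp -ltNge.
Qed.

Lemma Rintegral_itvDB u a b c : locint u -> a <= b -> b <= c ->
  \int[mu]_(t in `[a, c]) u t - \int[mu]_(t in `[a, b]) u t =
  \int[mu]_(t in `[b, c]) u t.
Proof.
move=> lu ab bc; rewrite Rintegral_itvB ?bnd_simp//.
rewrite Rintegral_itv_obnd_cbnd//.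
by apply: integrableS (lu b c) => //; apply: subset_itvr; rewrite bnd_simp.
Qed.

Lemma primB u a b : locint u -> a <= b ->
  prim u b - prim u a = \int[mu]_(t in `[a, b]) u t.
Proof.
move=> lu ab; pose c := Num.min a 0.
have ca : c <= a by rewrite ge_min lexx.
have c0 : c <= 0 by rewrite ge_min lexx orbT.
have E x : c <= x ->
    prim u x = \int[mu]_(t in `[c, x]) u t - \int[mu]_(t in `[c, 0]) u t.
  move=> cx; rewrite /prim; have [x0|/ltW x0] := leP 0 x.
    by rewrite [X in _ - X]Rintegral_itv_rev// subr0 Rintegral_itvDB.
  by rewrite [X in X - _]Rintegral_itv_rev// -(Rintegral_itvDB lu cx x0); ring.
rewrite !E ?(le_trans ca ab)// -(Rintegral_itvDB lu ca ab); ring.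
Qed.

(** Locally the signed primitive is an integral with a fixed left end point, the form to which
    continuity of parameterized integrals and the fundamental theorem of calculus apply. *)
Lemma prim_near u (x : R) : locint u ->
  {near x, (fun y => \int[mu]_(t in `[x - 1, y]) u t + prim u (x - 1)) =1 prim u}.
Proof.
move=> lu; near=> y; rewrite -primB//; first by rewrite subrK.
near: y; exists 1 => //= y /=; rewrite ltr_norml; lra.
Unshelve. all: end_near. Qed.

Lemma prim_continuous u : locint u -> continuous (prim u).
Proof.
move=> lu x.
have xab : x \in `](x - 1), (x + 1)[%R by rewrite in_itv/=; lra.
have x11 : x - 1 < x + 1 by lra.
have [c _ _] := (continuous_within_itvP _ x11).1
  (@parameterized_integral_continuous R (x - 1) (x + 1) u (ltW x11) (lu _ _)).
have {}c : {for x, continuous (fun y => \int[mu]_(t in `[x - 1, y]) u t + prim u (x - 1))}.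
  by apply: cvgD; [exact: (c _ xab)|exact: cvg_cst].
rewrite /continuous_at -(nbhs_singleton (prim_near x lu)).
apply: cvg_trans c; apply: near_eq_cvg.
exact: prim_near.
Qed.

Lemma is_derive_prim u (x : R) : continuous u -> is_derive x 1 (prim u) (u x).
Proof.
move=> cu; have lu := continuous_locint cu.
have [|||dF F'] := @continuous_FTC1 R u (BLeft (x - 1)) x (x + 1) _ (lu _ _).
- by lra.
- by rewrite /Order.lt/=; lra.
- exact: cu.
have dG : is_derive x 1 (fun y => \int[mu]_(t in `[x - 1, y]) u t + prim u (x - 1)) (u x).
  have dF' : is_derive x 1 (fun y => \int[mu]_(t in `[x - 1, y]) u t) (u x).
    exact: DeriveDef dF (etrans (esym (derive1E _ _)) F').
  by rewrite -[u x]addr0; apply: is_deriveD.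
have [d e] := dG.
apply: DeriveDef; first exact: near_eq_derivable (prim_near x lu) d.
by rewrite -e; apply/esym/near_eq_derive => //; exact: prim_near.
Qed.

End primitives.

(** * Lebesgue measure on the plane and the window kernel of the strain *)

Section plane_measure.
Context (R : realType).
Notation RT := (measurableTypeR R).
Notation mu := (@lebesgue_measure R).

Definition plane_measure : set (RT * RT)%type -> \bar R := (mu \x mu)%E.

HB.instance Definition _ := Measure.on plane_measure.

(* The library proves this for products of measures, but its instance is not
   found by unification. *)
Lemma plane_measure_sigma_finite : sigma_finite setT plane_measure.
Proof.
have /sigma_finiteP[F [TF ndF Foo]] := sigma_finiteT mu.
exists (fun n => F n `*` F n).
  rewrite -setXTT [in LHS]TF predeqE => -[x y]; split.
    move=> [/= [n _ Fnx] [k _ Fky]]; exists (maxn n k) => //; split.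
    - by move: x Fnx; exact/subsetPset/ndF/leq_maxl.
    - by move: y Fky; exact/subsetPset/ndF/leq_maxr.
  by move=> [n _ []/= ? ?]; split; exists n.
move=> k; have [? ?] := Foo k.
split; first exact: measurableX.
by rewrite /plane_measure product_measure1E// lte_mul_pinfty// ge0_fin_numE.
Qed.

HB.instance Definition _ := Measure_isSigmaFinite.Build _ _ _ plane_measure
  plane_measure_sigma_finite.

End plane_measure.

Section window_kernel.
Context (R : realType).
Notation RT := (measurableTypeR R).
Notation mu := (@lebesgue_measure R).
Notation nu := (@plane_measure R).
Implicit Types (u v : R -> R) (p : RT * RT).
Variables l delta : R.
Hypothesis l0 : 0 < l.
Hypothesis ld : l < delta.

(** The points are ((z, xi), y) with y in [z, z + xi]. Its indicator writes the increment of a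
    primitive as an integral operator whose kernel lies in [0, 1] and vanishes for xi outside
    [l, delta], so that the Schur test and the adjoint formula apply. *)
Definition window : set ((RT * RT) * RT) :=
  [set z | [/\ l <= z.1.2, z.1.2 <= delta, z.1.1 <= z.2 & z.2 <= z.1.1 + z.1.2]].

Definition ker (z : (RT * RT) * RT) : R := \1_window z.

Lemma kerE p y : ker (p, y) = \1_`[l, delta] p.2 * \1_`[p.1, p.1 + p.2] y.
Proof.
rewrite /ker !indicE -natrM mulnb; congr (_%:R); congr nat_of_bool.
apply/idP/andP; rewrite !inE/= !in_itv/=.
  by move=> [-> -> -> ->].
by move=> [/andP[? ?] /andP[? ?]].
Qed.

Lemma kerE' z xi y : ker ((z, xi), y) = \1_`[l, delta] xi * \1_`[y - xi, y] z.
Proof.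
rewrite kerE !indicE !mem_setE !in_itv/= lerBlDr.
by rewrite [(z <= y) && _]andbC.
Qed.

Lemma measurable_window : measurable window.
Proof.
rewrite (_ : window = [set z | l <= z.1.2] `&` [set z | z.1.2 <= delta] `&`
   [set z | z.1.1 <= z.2] `&` [set z | z.2 <= z.1.1 + z.1.2]); last first.
  by apply/seteqP; split => [z [? ? ? ?]|z [[[? ?] ?] ?]].
have m1 : measurable_fun [set: (RT * RT) * RT] (fun z => z.1.1 : R) by exact: measurableT_comp.
have m2 : measurable_fun [set: (RT * RT) * RT] (fun z => z.1.2 : R) by exact: measurableT_comp.
have m3 : measurable_fun [set: (RT * RT) * RT] (fun z => z.2 : R) by exact: measurable_snd.
have H (f g : (RT * RT) * RT -> R) : measurable_fun setT f -> measurable_fun setT g ->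
    measurable [set z | f z <= g z].
  by move=> mf mg; rewrite -[X in measurable X]setTI; exact: measurable_fun_le.
do 3 (apply: measurableI; last by apply: H => //; exact: measurable_funD).
exact: H.
Qed.

Lemma measurable_ker : measurable_fun [set: (RT * RT) * RT] ker.
Proof. exact: measurable_indic measurable_window. Qed.

Lemma ker_ge0 z : 0 <= ker z. Proof. by rewrite /ker indicE. Qed.

Lemma ker_le1 z : ker z <= 1. Proof. by rewrite /ker indicE; case: (_ \in _). Qed.

Definition width (xi : R) : R := xi * \1_`[l, delta] xi.

Lemma integral_indic_itv (a b : R) : a <= b ->
  (\int[mu]_y (\1_`[a, b] y)%:E = (b - a)%:E)%E.
Proof.
move=> ab; rewrite integral_indic// setIT/= lebesgue_measure_itv/= lte_fin.
by move: ab; rewrite le_eqVlt => /predU1P[->|->//]; rewrite ltxx subrr.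
Qed.

Lemma integral_ker p : (\int[mu]_y (ker (p, y))%:E = (width p.2)%:E)%E.
Proof.
under eq_integral do rewrite kerE EFinM.
rewrite ge0_integralZl//=; last exact/measurable_EFinP.
rewrite /width mulrC indicE; case: (boolP (_ \in _)) => [|_]; last by rewrite !mul0e mul0r.
rewrite inE/= in_itv/= => /andP[lp _].
rewrite integral_indic_itv ?lerDl ?(le_trans (ltW l0) lp)//.
by rewrite mul1e mul1r addrAC subrr add0r.
Qed.

(** For fixed [xi] the windows containing [y] start in [[y - xi, y]], of length [xi]; so integrating
    out [z] also yields [width xi], whatever [y] is. *)
Lemma integral_kerl (c : R -> R) y : measurable_fun [set: RT] c -> (forall x, 0 <= c x) ->
  (\int[nu]_p (c p.2 * ker (p, y))%:E =
   \int[mu]_xi (c xi * width xi)%:E)%E.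
Proof.
move=> mc c0.
rewrite fubini_tonelli2//; last 2 first.
- apply/measurable_EFinP; apply: measurable_funM; first exact: measurableT_comp.
  by apply: measurableT_comp; [exact: measurable_ker|exact: pair2_measurable].
- by move=> p; rewrite lee_fin; apply: mulr_ge0 => //; exact: ker_ge0.
apply: eq_integral => xi _; rewrite /fubini_G/=.
under eq_integral do rewrite kerE' mulrA EFinM.
rewrite ge0_integralZl//=; last 2 first.
- exact/measurable_EFinP.
- by rewrite lee_fin; nneg.
rewrite /width indicE; case: (boolP (_ \in _)) => [|_]; last by rewrite !mulr0 mul0e.
rewrite inE/= in_itv/= => /andP[lp _].
rewrite integral_indic_itv ?gerBl ?(le_trans (ltW l0) lp)//.
by rewrite -EFinM !mulr1 subKr.
Qed.

Lemma width_ge0 xi : 0 <= width xi.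
Proof.
rewrite /width indicE; case: (boolP (_ \in _)) => [|_]; last by rewrite mulr0.
by rewrite mem_setE in_itv/= mulr1 => /andP[/(le_trans (ltW l0))].
Qed.

Lemma width_le xi : width xi <= delta.
Proof.
rewrite /width indicE; case: (boolP (_ \in _)) => [|_].
  by rewrite mem_setE in_itv/= mulr1 => /andP[].
by rewrite mulr0 (le_trans (ltW l0))// ltW.
Qed.

Lemma measurable_width : measurable_fun [set: RT] width.
Proof. exact: measurable_funM. Qed.

Lemma Rintegrable_bounded_support (f : R -> R) (M : R) :
  measurable_fun [set: RT] f -> (forall xi, `|f xi| <= M) ->
  (forall xi, xi \notin `[l, delta]%R -> f xi = 0) -> Rintegrable mu f.
Proof.
move=> mf fM f0; apply: (@Rintegrable_le _ RT R mu f (fun xi => M * \1_`[l, delta] xi)) => //.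
  move=> xi; rewrite indicE mem_setE; case: (boolP (_ \in _)) => [_|/f0 ->].
    by rewrite mulr1.
  by rewrite normr0 mulr0.
apply: RintegrableZ; apply: ge0_Rintegrable => //.
by rewrite integral_indic_itv ?ltry// ltW.
Qed.

Lemma width_out xi : xi \notin `[l, delta]%R -> width xi = 0.
Proof. by rewrite /width indicE mem_setE => /negbTE ->; rewrite mulr0. Qed.

Definition D u p : R := \int[mu]_y (u y * ker (p, y)).

Definition Dadj (h : RT * RT -> R) y : R := \int[nu]_p (h p * ker (p, y)).

Lemma D_out u p : p.2 \notin `[l, delta]%R -> D u p = 0.
Proof.
move=> pl; rewrite /D (_ : (fun y => _) = fun=> 0); last first.
  by apply/funext => y; rewrite kerE indicE mem_setE (negbTE pl) mul0r mulr0.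
by rewrite Rintegral_cst// mul0r.
Qed.

Lemma D_itv u z xi : xi \in `[l, delta]%R ->
  D u (z, xi) = \int[mu]_(y in `[z, z + xi]) u y.
Proof.
move=> xil; rewrite /D [RHS]Rintegral_mkcond; apply: eq_Rintegral => y _.
rewrite kerE/= indicE mem_setE xil mul1r patchE indicE.
by case: (y \in _); rewrite ?mulr1 ?mulr0.
Qed.

Lemma D_prim u z xi : locint u -> xi \in `[l, delta]%R ->
  D u (z, xi) = prim u (z + xi) - prim u z.
Proof.
move=> lu xil; rewrite D_itv// primB// lerDl.
by move: xil; rewrite in_itv/= => /andP[/(le_trans (ltW l0))].
Qed.

Lemma D_cauchy_schwarz u p : sqint mu u ->
  [/\ Rintegrable mu (fun y => u y * ker (p, y)),
      Rintegrable mu (fun y => u y ^+ 2 * ker (p, y)) &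
      D u p ^+ 2 <= width p.2 * \int[mu]_y (u y ^+ 2 * ker (p, y))].
Proof.
exact: (kernel_cauchy_schwarz measurable_ker ker_ge0 ker_le1 integral_ker).
Qed.

(** This pointwise bound confines the strain to a bounded interval on each ball of L^2, which is why
    local estimates on the potential suffice. *)
Lemma D_sqr_le u p : sqint mu u -> D u p ^+ 2 <= delta * \int[mu]_y u y ^+ 2.
Proof.
move=> su; have [_ ui le] := D_cauchy_schwarz p su.
apply: (le_trans le); apply: ler_pM.
- exact: width_ge0.
- by apply: Rintegral_ge0 => y _; apply: mulr_ge0; [exact: sqr_ge0|exact: ker_ge0].
- exact: width_le.
- apply: le_Rintegral => //; first by case: su.
  by move=> y _; rewrite ler_piMr ?sqr_ge0// ker_le1.
Qed.

Lemma DZ (c : R) u p : sqint mu u -> D (fun y => c * u y) p = c * D u p.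
Proof.
move=> su; have [ui _ _] := D_cauchy_schwarz p su.
by rewrite /D -RintegralZl//; apply: eq_Rintegral => y _; rewrite mulrA.
Qed.

Lemma DB u v p : sqint mu u -> sqint mu v ->
  D (fun y => u y - v y) p = D u p - D v p.
Proof.
move=> su sv; have [ui _ _] := D_cauchy_schwarz p su.
have [vi _ _] := D_cauchy_schwarz p sv.
by rewrite /D -RintegralB//; apply: eq_Rintegral => y _; rewrite mulrBl.
Qed.

Lemma measurable_D u : measurable_fun [set: RT] u -> measurable_fun [set: RT * RT] (D u).
Proof.
move=> mu_; apply: (@measurable_Rintegral_snd _ _ _ _ _ mu (fun z => u z.2 * ker z)).
by apply: measurable_funM; [exact: measurableT_comp|exact: measurable_ker].
Qed.

Lemma measurable_Dadj h : measurable_fun [set: RT * RT] h -> measurable_fun [set: RT] (Dadj h).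
Proof.
move=> mh; apply: (@measurable_Rintegral_fst _ _ _ _ _ nu (fun z => h z.1 * ker z)).
by apply: measurable_funM; [exact: measurableT_comp|exact: measurable_ker].
Qed.

(** One factor [width xi] is the mass of the row, from Cauchy-Schwarz, the other that of the column.
    The constant is kept as an integral because with [rho = kappa * omega^2] it is compared with the
    energy of long plateaus. *)
Lemma Rintegral_D_sqr_le (rho : R -> R) (M : R) u : sqint mu u ->
  measurable_fun [set: RT] rho -> (forall xi, 0 <= rho xi) ->
  (forall xi, rho xi <= M) ->
  Rintegrable nu (fun p => rho p.2 * D u p ^+ 2) /\
  \int[nu]_p (rho p.2 * D u p ^+ 2) <=
    (\int[mu]_xi (rho xi * width xi ^+ 2)) * \int[mu]_y u y ^+ 2.
Proof.
move=> su mrho rho0 rhoM.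
apply: (schur_test measurable_ker ker_ge0 ker_le1 integral_ker su) => //.
  exact: measurableT_comp.
move=> y; rewrite (integral_kerl (c := fun xi => rho xi * width xi)).
- rewrite -integral_EFin; last first.
    apply: (Rintegrable_bounded_support (M := M * delta ^+ 2)).
    + by apply: measurable_funM => //; apply: measurable_funX; exact: measurable_width.
    + move=> xi; rewrite ger0_norm; last by apply: mulr_ge0 => //; exact: sqr_ge0.
      apply: ler_pM => //; first exact: sqr_ge0.
      by rewrite ler_sqr ?nnegrE ?width_le ?width_ge0// (le_trans _ (width_le xi))// width_ge0.
    + by move=> xi /width_out ->; rewrite expr0n/= mulr0.
  by under [leRHS]eq_integral do rewrite expr2 mulrA.
- by apply: measurable_funM => //; exact: measurable_width.
- by move=> xi; apply: mulr_ge0 => //; exact: width_ge0.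
Qed.

Lemma D_sqint u : sqint mu u -> sqint nu (D u).
Proof.
move=> su; split; first by apply: measurable_D; case: su.
have [] := @Rintegral_D_sqr_le (fun=> 1) 1 u su _ _ _ => //.
by under eq_fun do rewrite mul1r.
Qed.

Lemma integral_kerr y :
  (\int[nu]_p (ker (p, y))%:E = (\int[mu]_xi width xi)%:E)%E.
Proof.
have := @integral_kerl (fun=> 1) y; under eq_integral do rewrite mul1r.
move=> ->//; under eq_integral do rewrite mul1r.
rewrite integral_EFin//; apply: (Rintegrable_bounded_support (M := delta)).
- exact: measurable_width.
- by move=> xi; rewrite ger0_norm ?width_ge0 ?width_le.
- by move=> xi /width_out.
Qed.

(** The Schur test for the transposed kernel: its row mass is the constant integral of [width], its
    column mass is [width <= delta]. *)
Lemma Dadj_sqint h : sqint nu h -> sqint mu (Dadj h).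
Proof.
move=> sh; split; first by apply: measurable_Dadj; case: sh.
have mk' : measurable_fun [set: RT * (RT * RT)] (fun z => ker (z.2, z.1)).
  by apply: measurableT_comp; [exact: measurable_ker|exact: measurable_swap].
have [] := @schur_test _ _ _ _ _ mu nu (fun z => ker (z.2, z.1)) _ mk'
  (fun z => ker_ge0 _) (fun z => ker_le1 _) integral_kerr h (fun=> 1)
  ((\int[mu]_xi width xi) * delta) sh _ _ _ => //.
  move=> p /=; under eq_integral do rewrite mul1r EFinM.
  rewrite ge0_integralZl//=.
  - rewrite integral_ker -EFinM lee_fin ler_wpM2l ?width_le//.
    by apply: Rintegral_ge0 => xi _; exact: width_ge0.
  - apply/measurable_EFinP; apply: measurableT_comp; first exact: measurable_ker.
    exact: pair1_measurable.
  - by move=> y _; rewrite lee_fin ker_ge0.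
  - by rewrite lee_fin; apply: Rintegral_ge0 => xi _; exact: width_ge0.
by under eq_fun do rewrite mul1r.
Qed.

Lemma D_adjoint h u : sqint nu h -> sqint mu u ->
  \int[nu]_p (h p * D u p) = \int[mu]_y (u y * Dadj h y).
Proof.
exact: (kernel_adjoint measurable_ker ker_ge0 ker_le1 integral_ker
  (fun p => width_le p.2) integral_kerr (fun y => lexx _)).
Qed.

End window_kernel.

(** * Translation invariance of Lebesgue measure *)

Section translation.
Context (R : realType).
Notation RT := (measurableTypeR R).
Notation mu := (@lebesgue_measure R).

Definition shiftT (a : R) : RT -> RT := fun x => x + a.

Lemma measurable_shift (a : R) : measurable_fun [set: RT] (shiftT a).
Proof. exact: measurable_funD. Qed.

(** The pushforward gives half-open intervals their length, and this determines Lebesgue measure. *)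
Lemma lebesgue_measure_shift (a : R) (A : set RT) : measurable A ->
  pushforward mu (shiftT a) A = mu A.
Proof.
move=> mA; apply/esym.
apply: (@lebesgue_measure_unique R (pushforward mu (shiftT a)) _ A mA) => //=; first exact: measurable_shift.
move=> _ _ [[b c]] _ <-.
rewrite /pushforward (_ : shiftT a @^-1` _ = `]b - a, c - a]%classic); last first.
  by apply/seteqP; split => x /=; rewrite /shiftT !in_itv/= ltrBlDr lerBrDr.
rewrite !lebesgue_measure_itv/= !lte_fin ltrD2r; case: ifP => // _.
by rewrite -!EFinD; congr EFin; ring.
Qed.

Lemma ge0_integral_shift (a : R) (f : RT -> \bar R) :
  measurable_fun [set: RT] f -> (forall x, 0 <= f x)%E ->
  (\int[mu]_x f (x + a)%R = \int[mu]_x f x)%E.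
Proof.
move=> mf f0.
have := @ge0_integral_pushforward _ _ _ _ R _ (measurable_shift a) mu setT f
  measurableT mf (fun x _ => f0 x).
rewrite preimage_setT => <-.
apply: eq_measure_integral; first exact: measurable_shift.
by move=> mS A mA _; exact: (lebesgue_measure_shift a mA).
Qed.

End translation.

(** * Even superquadratic potentials *)

Section real_derivatives.
Context (R : realType).
Implicit Types f df : R -> R.

Lemma is_derive_continuous f df : (forall x : R, is_derive x 1 f (df x)) -> continuous f.
Proof.
move=> fd x; apply: differentiable_continuous; apply/derivable1_diffP.
by case: (fd x).
Qed.

Lemma mean_value f df (a b : R) : (forall x : R, is_derive x 1 f (df x)) ->
  exists2 c, Num.min a b <= c <= Num.max a b & f b - f a = df c * (b - a).
Proof.
move=> fd; have cf := is_derive_continuous fd.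
have [ab|/ltW ba] := leP a b.
  have [|c cab e] := MVT_segment ab (fun x _ => fd x).
    exact: continuous_subspaceT.
  by exists c => //; move: cab; rewrite in_itv.
have [|c cab e] := MVT_segment ba (fun x _ => fd x).
  exact: continuous_subspaceT.
exists c; first by move: cab; rewrite in_itv.
by rewrite -[LHS]opprB e; ring.
Qed.

Lemma is_derive_lipschitz f df (a b C : R) : (forall x : R, is_derive x 1 f (df x)) ->
  (forall c, Num.min a b <= c <= Num.max a b -> `|df c| <= C) ->
  `|f b - f a| <= C * `|b - a|.
Proof.
by move=> fd dfC; have [c /dfC cC ->] := mean_value a b fd; rewrite normrM ler_wpM2r.
Qed.

(** Serves at the origin, where [v |x|] coincides with one of two smooth functions depending on the
    sign of [x]; equal values and equal derivatives there make the choice harmless. *)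
Lemma is_derive_glue (f g F : R -> R) (a c : R) :
  is_derive a 1 f c -> is_derive a 1 g c -> f a = F a -> g a = F a ->
  (forall x, F x = f x \/ F x = g x) -> is_derive a 1 F c.
Proof.
move=> [fd fc] [gd gc] fa ga Ffg.
have fl : (h^-1 *: (f (h *: (1:R) + a) - f a)) @[h --> 0^'] --> c by rewrite -fc; exact: fd.
have gl : (h^-1 *: (g (h *: (1:R) + a) - g a)) @[h --> 0^'] --> c by rewrite -gc; exact: gd.
suff Fl : (h^-1 *: (F (h *: (1:R) + a) - F a)) @[h --> 0^'] --> c.
  by apply: DeriveDef; [apply/cvg_ex; exists c|apply: cvg_lim].
apply/cvgrPdist_lt => e e0.
move/cvgrPdist_lt : fl => /(_ e e0) fl; move/cvgrPdist_lt : gl => /(_ e e0) gl.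
near=> h; have [->|->] := Ffg (h *: 1 + a).
  by rewrite -fa; near: h.
by rewrite -ga; near: h.
Unshelve. all: by end_near. Qed.

Lemma continuous_bounded_itv f (a b : R) : continuous f ->
  exists2 C, 0 <= C & forall x, a <= x <= b -> `|f x| <= C.
Proof.
move=> cf; have [ab|ba] := leP a b; last first.
  by exists 0 => // x /andP[ax xb]; have := le_lt_trans (le_trans ax xb) ba; rewrite ltxx.
have cnf : {within `[a, b], continuous (fun x => `|f x|)}.
  by apply: continuous_subspaceT => x; apply: cvg_norm; exact: cf.
have [c _ H] := EVT_max ab cnf.
by exists `|f c| => // x xab; apply: H; rewrite in_itv.
Qed.

End real_derivatives.

(* [w] is the symmetrised potential and [dw] its derivative. *)
Record potential (R : realType) (w dw : R -> R) : Prop := {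
  pot_ge0 : forall x, 0 <= w x;
  pot0 : w 0 = 0;
  pot_derive : forall x : R, is_derive x 1 w (dw x);
  pot_tangent : forall a b, w a + dw a * (b - a) <= w b;
  pot_superquadratic : forall x y, x != 0 -> `|x| < `|y| ->
    w x / x ^+ 2 < w y / y ^+ 2;
  pot_dcontinuous : continuous dw;
  pot_d0 : dw 0 = 0;
  pot_dlipschitz : forall M, exists2 C, 0 <= C & forall x y,
    `|x| <= M -> `|y| <= M -> `|dw x - dw y| <= C * `|x - y|
}.

Section potential_theory.
Context (R : realType) (w dw : R -> R) (Hw : potential w dw).

Lemma pot_continuous : continuous w.
Proof. exact: is_derive_continuous (pot_derive Hw). Qed.

Lemma pot_le_sqr (M x : R) : 0 < M -> `|x| < M -> w x <= w M / M ^+ 2 * x ^+ 2.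
Proof.
move=> M0 xM; have [->|x0] := eqVneq x 0; first by rewrite (pot0 Hw) expr0n/= mulr0.
rewrite -ler_pdivrMr; last by rewrite lt_neqAle sqr_ge0 eq_sym sqrf_eq0 x0.
by apply/ltW/(pot_superquadratic Hw) => //; rewrite [ltRHS]gtr0_norm.
Qed.

Lemma pot_scale (t x : R) : 1 <= t -> t ^+ 2 * w x <= w (t * x).
Proof.
rewrite le_eqVlt => /predU1P[<-|t1]; first by rewrite expr1n !mul1r.
have [->|x0] := eqVneq x 0; first by rewrite mulr0 (pot0 Hw) mulr0.
have := @pot_superquadratic _ _ _ Hw x (t * x) x0.
rewrite normrM [`|t|]gtr0_norm; last by lra.
rewrite ltr_pMl ?normr_gt0// => /(_ t1)/ltW.
rewrite exprMn ler_pdivrMr; last by rewrite lt_neqAle sqr_ge0 eq_sym sqrf_eq0 x0.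
rewrite (_ : _ / _ * _ = w (t * x) / t ^+ 2); last by field; rewrite x0 gt_eqF//; lra.
by rewrite ler_pdivlMr; [rewrite mulrC|apply: exprn_gt0; lra].
Qed.

Lemma pot_scale_lt (t x : R) : 1 < t -> x != 0 -> t ^+ 2 * w x < w (t * x).
Proof.
move=> t1 x0.
have := @pot_superquadratic _ _ _ Hw x (t * x) x0.
rewrite normrM [`|t|]gtr0_norm; last by lra.
rewrite ltr_pMl ?normr_gt0// => /(_ t1).
rewrite exprMn ltr_pdivrMr; last by rewrite lt_neqAle sqr_ge0 eq_sym sqrf_eq0 x0.
rewrite (_ : _ / _ * _ = w (t * x) / t ^+ 2); last by field; rewrite x0 gt_eqF//; lra.
by rewrite ltr_pdivlMr; [rewrite mulrC|apply: exprn_gt0; lra].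
Qed.

(** The last bound is the pointwise Brezis-Lieb estimate: [w (a + s) - w a - w s] vanishes at
    [s = 0] and has derivative [dw (a + s) - dw s], at most [C |a|]. As [a + s] may reach [2 M], the
    Lipschitz constant is taken on that larger ball. The first bound is the tangent at [a] evaluated
    at 0. *)
Lemma pot_bounds (M : R) : exists2 C, 0 <= C & forall a b, `|a| <= M -> `|b| <= M ->
  [/\ w a <= C * a ^+ 2, `|dw a| <= C * `|a| &
      `|w (a + b) - w a - w b| <= C * `|a * b|].
Proof.
have [C C0 HC] := pot_dlipschitz Hw (2 * M).
exists C => // a b aM bM.
have M0 : 0 <= M := le_trans (normr_ge0 a) aM.
have le2 (x : R) : `|x| <= M -> `|x| <= 2 * M by move=> ?; lra.
have dC x : `|x| <= M -> `|dw x| <= C * `|x|.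
  move=> xM; have := HC x 0 (le2 _ xM); rewrite normr0 (pot_d0 Hw) !subr0; apply.
  by lra.
split; last 1 first.
- have dphi (s : R) : is_derive s 1 (fun s => w (a + s) - w a - w s) (dw (a + s) - dw s).
    have d1 : is_derive s 1 (w \o (fun s => a + s)) (dw (a + s) * 1).
      apply: is_derive1_comp; first exact: pot_derive Hw _.
      rewrite -[X in is_derive _ _ _ X]add0r; apply: is_deriveD.
    have d2 := pot_derive Hw s.
    rewrite mulr1 in d1.
    have := is_deriveB (is_deriveB d1 (is_derive_cst (w a) s 1)) d2.
    by rewrite subr0.
  have := @is_derive_lipschitz _ _ _ 0 b (C * `|a|) dphi.
  rewrite addr0 (pot0 Hw) !subr0 subrr subr0 normrM mulrA; apply => c cb.
  have cM : `|c| <= M.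
    move: cb bM; rewrite !ler_norml; case: (leP 0 b) => b0; lra.
  have := HC (a + c) c; rewrite [a + c - c]addrK; apply; last exact: le2.
  by rewrite (le_trans (ler_normD _ _))//; lra.
- have := pot_tangent Hw a 0; rewrite (pot0 Hw) sub0r => H.
  have : dw a * a <= C * a ^+ 2.
    rewrite (le_trans (ler_norm _))// normrM -[a ^+ 2]real_normK ?num_real//.
    by rewrite expr2 mulrA ler_wpM2r// dC.
  by lra.
- exact: dC.
Qed.

End potential_theory.

Section symmetrization.
Context (R : realType).

Lemma near_is_derive (f g : R -> R) (a c : R) :
  {near a, f =1 g} -> is_derive a 1 f c -> is_derive a 1 g c.
Proof.
move=> fg [fd fc]; apply: DeriveDef; first exact: near_eq_derivable fg fd.
by rewrite -fc; apply/esym/near_eq_derive.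
Qed.

Lemma lipschitz_continuous (f : R -> R) :
  (forall M, exists2 C, 0 <= C & forall x y,
    `|x| <= M -> `|y| <= M -> `|f x - f y| <= C * `|x - y|) -> continuous f.
Proof.
move=> fL x; have [C C0 HC] := fL (`|x| + 1).
apply/cvgrPdist_lt => e e0.
exists (Num.min 1 (e / (C + 1))) => /=.
  by rewrite lt_min ltr01 divr_gt0//; lra.
move=> y /=; rewrite lt_min => /andP[xy1 xye].
have yM : `|y| <= `|x| + 1.
  have := ler_distD x 0 y; rewrite !sub0r !normrN; lra.
have xM : `|x| <= `|x| + 1 by lra.
apply: (le_lt_trans (HC _ _ xM yM)).
move: xye; rewrite ltr_pdivlMr; last by lra.
by have := normr_ge0 (x - y); nra.
Qed.

(** Since [dv 0 = 0] the two branches match to first order at 0. Since [dv >= 0] on the half-line,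
    replacing [b] by [|b|] only raises the tangent line, which carries the tangent inequality to the
    whole line. *)
Lemma even_potential (v dv ddv : R -> R) :
  (forall x : R, is_derive x 1 v (dv x)) -> (forall x : R, is_derive x 1 dv (ddv x)) ->
  continuous ddv -> v 0 = 0 -> dv 0 = 0 ->
  (forall x y, 0 <= x -> x <= y -> v x <= v y) ->
  (forall t x y, 0 <= t -> t <= 1 -> 0 <= x -> 0 <= y ->
    v (t * x + (1 - t) * y) <= t * v x + (1 - t) * v y) ->
  (forall x y, 0 < x -> x < y -> v x / x ^+ 2 < v y / y ^+ 2) ->
  potential (fun x => v `|x|) (fun x => Num.sg x * dv `|x|).
Proof.
move=> vd dvd cddv v0 dv0 vmono vconv vsuper.
have v_ge0 x : 0 <= x -> 0 <= v x by move=> x0; rewrite -v0 vmono.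
have tangent (a b : R) : 0 <= a -> 0 <= b -> v a + dv a * (b - a) <= v b.
  move=> a0 b0.
  have dphi : is_derive (0 : R) 1 (v \o (fun t => t * (b - a) + a)) (dv a * (b - a)).
    apply: is_derive1_comp; first by rewrite mul0r add0r.
    have := is_deriveD (is_deriveM (is_derive_id (0:R) (1:R)) (is_derive_cst (b - a) (0:R) (1:R)))
      (is_derive_cst a (0:R) (1:R)).
    by rewrite /= scaler0 add0r addr0 /GRing.scale /= mulr1.
  have [dc de] := dphi.
  (* By convexity the difference quotients of [t |-> v (a + t (b - a))] at 0, with step in (0, 1),
     are at most [v b - v a]; the derivative is their limit from the right. *)
  suff : dv a * (b - a) <= v b - v a by lra.
  rewrite -de.
  have q : (h^-1 *: ((v \o (fun t => t * (b - a) + a)) (h *: (1:R) + 0) -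
     (v \o (fun t => t * (b - a) + a)) 0)) @[h --> 0^'+] -->
     'D_1 (v \o (fun t => t * (b - a) + a)) 0.
    by apply: cvg_dnbhs_at_right; exact: dc.
  apply: (cvgr_to_le q); near=> h.
  have h0 : 0 < h by [].
  have h1 : h < 1 by near: h; exact: nbhs_right_lt.
  rewrite /= [h *: 1](_ : _ = h); last by rewrite /GRing.scale /= mulr1.
  rewrite addr0 mul0r add0r /GRing.scale /= mulrC ler_pdivrMr//.
  have -> : h * (b - a) + a = h * b + (1 - h) * a by ring.
  have := vconv h b a (ltW h0) (ltW h1) b0 a0; lra.
have dv_ge0 (a : R) : 0 <= a -> 0 <= dv a.
  rewrite le_eqVlt => /predU1P[<-|a0]; first by rewrite dv0.
  have := tangent a 0 (ltW a0) (lexx _); have := v_ge0 a (ltW a0); rewrite v0.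
  by nra.
have dlip (M : R) : exists2 C, 0 <= C & forall x y : R, `|x| <= M -> `|y| <= M ->
    `|Num.sg x * dv `|x| - Num.sg y * dv `|y| | <= C * `|x - y|.
  have [C C0 HC] := continuous_bounded_itv 0 M cddv.
  have L (x y : R) : 0 <= x <= M -> 0 <= y <= M -> `|dv x - dv y| <= C * `|x - y|.
    move=> /andP[x0 xM] /andP[y0 yM].
    apply: (is_derive_lipschitz (df := ddv)) => // c cxy; apply: HC.
    by move: cxy; case: (leP y x) => _ /andP[? ?]; apply/andP; split; lra.
  exists C => // x y xM yM.
  have Lx (x' : R) : `|x'| <= M -> dv `|x'| <= C * `|x'|.
    move=> x'M; have := L `|x'| 0; rewrite dv0 !subr0 normr_id normr_ge0 x'M lexx /=.
    by rewrite (le_trans (normr_ge0 x') x'M) => /(_ isT isT); apply: le_trans; exact: ler_norm.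
  (* For equal signs the bound on [ddv] decides. For opposite signs [|x - y| = |x| + |y|], and [Lx]
     is applied to each argument. *)
  have [->|x0|x0] := sgrP x; have [->|y0|y0] := sgrP y; rewrite ?mul0r ?mul1r ?mulN1r ?subr0 ?sub0r ?opprK.
  - by rewrite normr0 mulr_ge0.
  - rewrite !normrN (ger0_norm (dv_ge0 _ (ltW y0))).
    by have := Lx y yM; rewrite (gtr0_norm y0).
  - have y1 : 0 <= - y by lra.
    by rewrite normrN (ger0_norm (dv_ge0 _ y1)); have := Lx y yM; rewrite (ltr0_norm y0).
  - rewrite (ger0_norm (dv_ge0 _ (ltW x0))).
    by have := Lx x xM; rewrite (gtr0_norm x0).
  - move: xM yM; rewrite (gtr0_norm x0) (gtr0_norm y0) => xM yM.
    by apply: L; rewrite ?(ltW x0) ?(ltW y0).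
  - have y1 : 0 <= - y by lra.
    rewrite (ger0_norm (addr_ge0 (dv_ge0 _ (ltW x0)) (dv_ge0 _ y1))).
    rewrite (gtr0_norm (_ : 0 < x - y)); last by lra.
    by have := Lx x xM; have := Lx y yM; rewrite (gtr0_norm x0) (ltr0_norm y0); lra.
  - have x1 : 0 <= - x by lra.
    by rewrite normrN (ger0_norm (dv_ge0 _ x1)); have := Lx x xM; rewrite (ltr0_norm x0).
  - have x1 : 0 <= - x by lra.
    rewrite -opprD normrN (ger0_norm (addr_ge0 (dv_ge0 _ x1) (dv_ge0 _ (ltW y0)))).
    rewrite (ltr0_norm (_ : x - y < 0)); last by lra.
    by have := Lx x xM; have := Lx y yM; rewrite (gtr0_norm y0) (ltr0_norm x0); lra.
  - rewrite addrC (_ : x - y = - (- x - - y)); last by ring.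
    move: xM yM; rewrite (ltr0_norm x0) (ltr0_norm y0) => xM yM.
    by rewrite normrN distrC; apply: L; lra.
have dvN (x : R) : is_derive x 1 (v \o -%R) (- dv (- x)).
  by rewrite -mulrN1; apply: is_derive1_comp; exact: is_deriveN.
split => //.
- by move=> x; exact: v_ge0.
- by rewrite normr0.
- move=> x; have [->|x0|x0] := sgrP x.
  + rewrite mul0r.
    apply: (@is_derive_glue _ v (v \o -%R)); rewrite /= ?oppr0 ?normr0//.
    * by have := vd 0; rewrite dv0.
    * by have := dvN 0; rewrite oppr0 dv0 oppr0.
    * by move=> y; case: (ler0P y) => y0; [right|left].
  + rewrite mul1r ?(gtr0_norm x0).
    apply: (@near_is_derive v) => //.
    by near=> y; rewrite gtr0_norm//; near: y; exact: lt_nbhsr.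
  + rewrite mulN1r ?(ltr0_norm x0).
    apply: (@near_is_derive (v \o -%R)) => //.
    by near=> y; rewrite ltr0_norm//; near: y; exact: lt_nbhsl.
- move=> a b; have [->|a0|a0] := sgrP a.
  + by rewrite ?normr0 v0 !mul0r addr0 v_ge0.
  + rewrite mul1r ?(gtr0_norm a0).
    apply: le_trans (tangent a `|b| (ltW a0) (normr_ge0 b)).
    rewrite lerD2l; apply: ler_wpM2l; first exact/dv_ge0/ltW.
    by rewrite lerD2r ler_norm.
  + rewrite ?(ltr0_norm a0).
    apply: le_trans (tangent (- a) `|b| _ (normr_ge0 b)); last by lra.
    rewrite (_ : -1 * dv (- a) * (b - a) = dv (- a) * (- b - - a)); last by ring.
    rewrite lerD2l; apply: ler_wpM2l; first by apply: dv_ge0; lra.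
    by rewrite lerD2r -normrN ler_norm.
- move=> x y x0 xy.
  have H (z : R) : z ^+ 2 = `|z| ^+ 2 by rewrite real_normK// num_real.
  by rewrite (H x) (H y); apply: vsuper => //; rewrite normr_gt0.
- exact: lipschitz_continuous.
- by rewrite sgr0 mul0r.
Unshelve. all: by end_near. Qed.

(** On either half-line [Vbar] is a function of [|x|]: [V] itself, or [V] composed with the
    reflection, so that both cases are instances of [even_potential]. *)
Lemma potential_Vbar (I : set R) (V : R -> R) (c1 c2 gamma1 gamma2 : R) :
  C2 V -> H1 I V c1 c2 gamma1 gamma2 -> potential (Vbar I V) (Vbar I V)^`().
Proof.
move=> [dV ddV cddV] h1.
suff [dw p] : exists dw, potential (Vbar I V) dw.
  rewrite (_ : (Vbar I V)^`() = dw)//; apply/funext => x.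
  by rewrite derive1E; case: (pot_derive p x).
have VD (x : R) : is_derive x 1 V (V^`() x).
  exact: DeriveDef (_ : derivable _ x 1) (esym (derive1E _ x)).
have dVD (x : R) : is_derive x 1 V^`() (V^`()^`() x).
  exact: DeriveDef (_ : derivable _ x 1) (esym (derive1E _ x)).
have := H1_superquadratic h1; have := H1_convex h1.
case: (H1_monotone h1) => -[-> Vmono] conv super.
- have -> : Vbar `]-oo, 0] V = fun x => (V \o -%R) `|x|.
    apply/funext => x; rewrite /Vbar /= mem_setE in_itv/=.
    by case: (ler0P x) => x0; rewrite ?opprK.
  eexists; apply: (@even_potential (V \o -%R) (fun x => - V^`() (- x)) (fun x => V^`()^`() (- x))).
  + by move=> x; rewrite -mulrN1; apply: is_derive1_comp; exact: is_deriveN.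
  + move=> x; rewrite -[X in is_derive _ _ _ X]opprK; apply: is_deriveN.
    by rewrite -mulrN1; apply: is_derive1_comp; exact: is_deriveN.
  + by move=> x; apply: continuous_comp; [exact: opp_continuous|exact: cddV].
  + by rewrite /= oppr0 (H1_V0 h1).
  + by rewrite oppr0 (H1_dV0 h1) oppr0.
  + move=> x y x0 xy /=; apply: Vmono.
      by rewrite inE/= in_itv/=; lra.
    by rewrite inE/= in_itv/=; lra.
    by rewrite lerN2.
  + move=> t x y t0 t1 x0 y0 /=.
    have := conv (Itv01 t0 t1) (- x) (- y).
    rewrite !inE/= !in_itv/= !oppr_le0 => /(_ x0 y0).
    rewrite !convRE /=.
    have -> : - (t * x + (1 - t) * y) = t * (- x) + (1 - t) * (- y) by ring.
    by [].
  + move=> x y x0 xy /=; have := super (- x) (- y).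
    rewrite !sqrrN !inE/= !in_itv/= !oppr_eq0 !normrN => H.
    have y0 := lt_trans x0 xy.
    by apply: H; rewrite ?gt_eqF// ?gtr0_norm//; lra.
- have -> : Vbar `[0, +oo[ V = fun x => V `|x|.
    apply/funext => x; rewrite /Vbar /= mem_setE in_itv/= andbT.
    by case: (lerP 0 x) => x0; rewrite ?(ger0_norm x0)// ltr0_norm.
  eexists; apply: (@even_potential V V^`() V^`()^`()) => //.
  + exact: H1_V0 h1.
  + exact: H1_dV0 h1.
  + move=> x y x0 xy /=; apply: Vmono => //; rewrite inE/= in_itv/= andbT//.
    exact: le_trans xy.
  + move=> t x y t0 t1 x0 y0 /=.
    have := conv (Itv01 t0 t1) x y.
    rewrite !inE/= !in_itv/= !andbT => /(_ x0 y0).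
    by rewrite !convRE.
  + move=> x y x0 xy /=; have := super x y.
    rewrite !inE/= !in_itv/= !andbT => H.
    have y0 := lt_trans x0 xy.
    by apply: H; rewrite ?gt_eqF// ?gtr0_norm//; lra.
Qed.

End symmetrization.

(** * The elastic energy and its gradient *)

(* [kappa] and [omega] stand for [k] and [1 / m] on the interval [l, delta]. *)
Record weights (R : realType) (l delta : R) (kappa omega : R -> R)
    (kappa1 omega0 omega1 : R) : Prop := {
  wt_l0 : 0 < l;
  wt_ld : l < delta;
  wt_mkappa : measurable_fun [set: measurableTypeR R] kappa;
  wt_kappa_ge0 : forall xi, 0 <= kappa xi;
  wt_kappa_le : forall xi, kappa xi <= kappa1;
  wt_kappa_out : forall xi, xi \notin `[l, delta]%R -> kappa xi = 0;
  wt_momega : measurable_fun [set: measurableTypeR R] omega;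
  wt_omega0 : 0 < omega0;
  wt_omega_ge : forall xi, omega0 <= omega xi;
  wt_omega_le : forall xi, omega xi <= omega1
}.

Section functional.
Context (R : realType) (w dw : R -> R) (Hw : potential w dw).
Notation RT := (measurableTypeR R).
Notation mu := (@lebesgue_measure R).
Notation nu := (@plane_measure R).
Context (l delta : R) (kappa omega : R -> R) (kappa1 omega0 omega1 : R).
Hypothesis wt : weights l delta kappa omega kappa1 omega0 omega1.
Implicit Types (u v : R -> R) (p : RT * RT).

Let l0 : 0 < l := wt_l0 wt.
Let ld : l < delta := wt_ld wt.
Let delta0 : 0 < delta := lt_trans l0 ld.
Let Dl := D l delta.

Lemma omega_gt0 xi : 0 < omega xi.
Proof. exact: lt_le_trans (wt_omega0 wt) (wt_omega_ge wt xi). Qed.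

Lemma kappa1_ge0 : 0 <= kappa1.
Proof. exact: le_trans (wt_kappa_ge0 wt 0) (wt_kappa_le wt 0). Qed.

Lemma omega1_gt0 : 0 < omega1.
Proof. exact: lt_le_trans (omega_gt0 0) (wt_omega_le wt 0). Qed.

Definition normsq u : R := \int[mu]_y u y ^+ 2.

Definition elastic_strain u p : R := Dl u p * omega p.2.

Definition elastic_density u p : R := w (elastic_strain u p) * kappa p.2.

Definition elastic_ddensity u p : R := dw (elastic_strain u p) * omega p.2 * kappa p.2.

Definition elastic_energy u : R := \int[nu]_p elastic_density u p.

Definition elastic_gradient u : R -> R := Dadj l delta (elastic_ddensity u).

Lemma normsq_ge0 u : 0 <= normsq u.
Proof. by apply: Rintegral_ge0 => y _; exact: sqr_ge0. Qed.

(** The factor [1 + delta * N] replaces a square root, through [|x| <= 1 + x^2]. *)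
Lemma strain_le u p (N : R) : sqint mu u -> normsq u <= N ->
  `|elastic_strain u p| <= (1 + delta * N) * omega1.
Proof.
move=> su uN; rewrite normrM (gtr0_norm (omega_gt0 _)).
apply: ler_pM => //; [exact/ltW/omega_gt0| |exact: (wt_omega_le wt)].
have := D_sqr_le l0 ld p su; rewrite -[_ ^+ 2]real_normK ?num_real//.
rewrite -/Dl -/(normsq u) => H.
have : delta * normsq u <= delta * N by rewrite ler_pM2l.
by have := sqr_ge0 (`|Dl u p| - 1); have := normr_ge0 (Dl u p); nra.
Qed.

Lemma measurable_strain u : measurable_fun [set: RT] u ->
  measurable_fun [set: RT * RT] (elastic_strain u).
Proof.
move=> mu_; apply: measurable_funM; first exact: measurable_D.
by apply: measurableT_comp; [exact: wt_momega wt|exact: measurable_snd].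
Qed.

Lemma measurable_kappa2 : measurable_fun [set: RT * RT] (fun p => kappa p.2).
Proof. by apply: measurableT_comp; [exact: wt_mkappa wt|exact: measurable_snd]. Qed.

Lemma measurable_density u : measurable_fun [set: RT] u ->
  measurable_fun [set: RT * RT] (elastic_density u).
Proof.
move=> mu_; apply: measurable_funM; last exact: measurable_kappa2.
apply: measurableT_comp; last exact: measurable_strain.
by apply: continuous_measurable_fun; exact: pot_continuous Hw.
Qed.

Lemma measurable_ddensity u : measurable_fun [set: RT] u ->
  measurable_fun [set: RT * RT] (elastic_ddensity u).
Proof.
move=> mu_; apply: measurable_funM; last exact: measurable_kappa2.
apply: measurable_funM; last first.
  by apply: measurableT_comp; [exact: wt_momega wt|exact: measurable_snd].
apply: measurableT_comp; last exact: measurable_strain.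
by apply: continuous_measurable_fun; exact: pot_dcontinuous Hw.
Qed.

Lemma density_ge0 u p : 0 <= elastic_density u p.
Proof. by rewrite mulr_ge0 ?(pot_ge0 Hw) ?(wt_kappa_ge0 wt). Qed.

Lemma strainD u v p : sqint mu u -> sqint mu v ->
  elastic_strain (fun y => u y - v y) p = elastic_strain u p - elastic_strain v p.
Proof. by move=> su sv; rewrite /elastic_strain /Dl DB// mulrBl. Qed.

Lemma strainZ (t : R) u p : sqint mu u ->
  elastic_strain (fun y => t * u y) p = t * elastic_strain u p.
Proof. by move=> su; rewrite /elastic_strain /Dl DZ// mulrA. Qed.

(** [pot_bounds] at the radius given by [strain_le]: one constant serves a whole ball of L^2, so
    that it survives limits along bounded sequences. The third clause controls the error in the
    splitting of the energy. *)
Lemma density_bounds (N : R) : exists2 C, 0 <= C & forall u p, sqint mu u -> normsq u <= N ->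
  [/\ elastic_density u p <= C * Dl u p ^+ 2, `|elastic_ddensity u p| <= C * `|Dl u p| &
    forall v, sqint mu v -> normsq (fun y => v y - u y) <= N ->
    `|elastic_density v p - elastic_density u p - elastic_density (fun y => v y - u y) p| <=
       C * `|Dl u p * Dl (fun y => v y - u y) p| ].
Proof.
have [C C0 HC] := pot_bounds Hw ((1 + delta * N) * omega1).
have o1 := omega1_gt0; have k1 := kappa1_ge0.
exists (C * omega1 ^+ 2 * kappa1); first nneg.
move=> u p su uN.
have kp : 0 <= kappa p.2 <= kappa1 by rewrite (wt_kappa_ge0 wt) (wt_kappa_le wt).
have op : 0 <= omega p.2 <= omega1.
  by rewrite (wt_omega_le wt) andbT; exact/ltW/omega_gt0.
move: kp op => /andP[kp0 kp1] /andP[op0 op1].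
have op2 : omega p.2 ^+ 2 <= omega1 ^+ 2 by rewrite ler_sqr ?nnegrE// ltW.
have cok : C * omega p.2 ^+ 2 * kappa p.2 <= C * omega1 ^+ 2 * kappa1.
  by apply: ler_pM => //; [rewrite mulr_ge0 ?sqr_ge0|rewrite ler_wpM2l].
have suM := strain_le p su uN.
have [wa da _] := HC _ _ suM suM.
split.
- apply: (@le_trans _ _ (C * omega p.2 ^+ 2 * kappa p.2 * Dl u p ^+ 2)).
    rewrite [leRHS](_ : _ = (C * (elastic_strain u p) ^+ 2) * kappa p.2).
      by rewrite ler_wpM2r.
    by rewrite /elastic_strain; ring.
  by rewrite ler_wpM2r ?sqr_ge0.
- apply: (@le_trans _ _ (C * omega p.2 ^+ 2 * kappa p.2 * `|Dl u p|)).
    rewrite /elastic_ddensity normrM (ger0_norm kp0) normrM (ger0_norm op0).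
    rewrite [leRHS](_ : _ = (C * `|elastic_strain u p|) * omega p.2 * kappa p.2).
      by rewrite ler_wpM2r// ler_wpM2r.
    by rewrite /elastic_strain normrM (ger0_norm op0); ring.
  by rewrite ler_wpM2r.
- move=> v sv vuN.
  have svuM := strain_le p (sqintB sv su) vuN.
  have [_ _] := HC _ _ suM svuM.
  have -> : elastic_strain u p + elastic_strain (fun y => v y - u y) p = elastic_strain v p.
    by rewrite strainD// addrC subrK.
  rewrite strainD// => Hab.
  apply: (@le_trans _ _ (C * omega p.2 ^+ 2 * kappa p.2 * `|Dl u p * Dl (fun y => v y - u y) p|)).
    rewrite /elastic_density -!mulrBl normrM (ger0_norm kp0) strainD//.
    rewrite [leRHS](_ : _ = (C * `|elastic_strain u p * (elastic_strain v p - elastic_strain u p)|) * kappa p.2).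
      by rewrite ler_wpM2r.
    rewrite -strainD// /elastic_strain !normrM (ger0_norm op0); ring.
  by rewrite ler_wpM2r.
Qed.

Lemma Rintegrable_density u : sqint mu u -> Rintegrable nu (elastic_density u).
Proof.
move=> su; have [C C0 HC] := density_bounds (normsq u).
apply: (@Rintegrable_le _ (RT * RT)%type R nu _ (fun p => C * Dl u p ^+ 2)).
- by apply: measurable_density; case: su.
- by move=> p; rewrite ger0_norm ?density_ge0//; case: (HC u p su (lexx _)).
- by apply: RintegrableZ; case: (D_sqint l0 ld su).
Qed.

Lemma sqint_ddensity u : sqint mu u -> sqint nu (elastic_ddensity u).
Proof.
move=> su; have [C C0 HC] := density_bounds (normsq u).
have mh := measurable_ddensity (sqint_measurable su).
split => //.
apply: (@Rintegrable_le _ (RT * RT)%type R nu _ (fun p => C ^+ 2 * Dl u p ^+ 2)).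
- exact: measurable_funX.
- move=> p; have [_ H _] := HC u p su (lexx _).
  rewrite -[Dl u p ^+ 2]real_normK ?num_real// -exprMn normrX.
  by rewrite ler_sqr ?nnegrE// mulr_ge0.
- by apply: RintegrableZ; case: (D_sqint l0 ld su).
Qed.

Lemma sqint_dE u : sqint mu u -> sqint mu (elastic_gradient u).
Proof. by move=> su; apply: Dadj_sqint => //; exact: sqint_ddensity. Qed.

Lemma E_ge0 u : 0 <= elastic_energy u.
Proof. by apply: Rintegral_ge0 => p _; exact: density_ge0. Qed.

(** The tangent inequality of [w] is integrated over the plane; [D_adjoint] then moves the linear
    term from the strain of [v - u] onto [v - u] itself. *)
Lemma E_tangent u v : sqint mu u -> sqint mu v ->
  elastic_energy u + \int[mu]_y ((v y - u y) * elastic_gradient u y) <= elastic_energy v.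
Proof.
move=> su sv; have svu := sqintB sv su.
rewrite /elastic_gradient -(D_adjoint l0 ld (sqint_ddensity su) svu) -RintegralD//; first last.
- exact: sqintM (sqint_ddensity su) (D_sqint l0 ld svu).
- exact: Rintegrable_density.
apply: le_Rintegral => //; last first.
- move=> p _; rewrite /elastic_density /elastic_ddensity.
  have := pot_tangent Hw (elastic_strain u p) (elastic_strain v p).
  have := wt_kappa_ge0 wt p.2.
  rewrite -strainD// /elastic_strain -/Dl; set a := w _; set b := dw _; set c := w _ => k0 H.
  rewrite (_ : a * _ + _ = (a + b * (Dl (fun y => v y - u y) p * omega p.2)) * kappa p.2).
    by rewrite ler_wpM2r.
  by ring.
- exact: Rintegrable_density.
- apply: RintegrableD; first exact: Rintegrable_density.
  exact: sqintM (sqint_ddensity su) (D_sqint l0 ld svu).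
Qed.

Lemma E_tangentZ u (t : R) : sqint mu u ->
  elastic_energy u + (t - 1) * \int[mu]_y (u y * elastic_gradient u y) <= elastic_energy (fun y => t * u y).
Proof.
move=> su; have := E_tangent su (sqintZ t su).
rewrite (_ : (fun y => (t * u y - u y) * elastic_gradient u y) = fun y => (t - 1) * (u y * elastic_gradient u y)).
  by rewrite RintegralZl//; apply: sqintM => //; exact: sqint_dE.
by apply/funext => y; ring.
Qed.

(** The tangent at [u] is evaluated at the zero function, whose energy is 0. This is the source of
    the positivity of the pairing, hence of the multiplier. *)
Lemma E_le_pairing u : sqint mu u -> elastic_energy u <= \int[mu]_y (u y * elastic_gradient u y).
Proof.
move=> su; have E0 : elastic_energy (fun y => 0 * u y) = 0.
  rewrite /elastic_energy (_ : elastic_density _ = fun=> 0); first by rewrite Rintegral_cst// mul0r.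
  by apply/funext => p; rewrite /elastic_density strainZ// mul0r (pot0 Hw) mul0r.
by have := E_tangentZ 0 su; rewrite E0 sub0r mulN1r subr_le0.
Qed.

Lemma E_scale u (t : R) : sqint mu u -> 1 <= t ->
  t ^+ 2 * elastic_energy u <= elastic_energy (fun y => t * u y).
Proof.
move=> su t1; rewrite /elastic_energy -RintegralZl//; last exact: Rintegrable_density.
apply: le_Rintegral => //.
- by apply: RintegrableZ; exact: Rintegrable_density.
- by apply: Rintegrable_density; exact: sqintZ.
- move=> p _; rewrite /elastic_density strainZ// mulrA ler_wpM2r ?(wt_kappa_ge0 wt)//.
  by apply: (pot_scale Hw).
Qed.

(** In case of equality the nonnegative difference of densities has integral 0, so it vanishes
    almost everywhere; strict superquadraticity then leaves only points where the density of [u] is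
    0, against [E u > 0]. *)
Lemma E_scale_lt u (t : R) : sqint mu u -> 1 < t -> 0 < elastic_energy u ->
  t ^+ 2 * elastic_energy u < elastic_energy (fun y => t * u y).
Proof.
move=> su t1 Eu; rewrite lt_neqAle E_scale ?ltW// andbT.
apply/negP => /eqP e; move: Eu; rewrite lt_neqAle => /andP[/negP + _]; apply.
have stu := sqintZ t su.
pose f p := elastic_density (fun y => t * u y) p - t ^+ 2 * elastic_density u p.
have fi : Rintegrable nu f.
  by apply: RintegrableB; [|apply: RintegrableZ]; exact: Rintegrable_density.
have f0 p : 0 <= f p.
  rewrite subr_ge0 /elastic_density strainZ// mulrA ler_wpM2r ?(wt_kappa_ge0 wt)//.
  by apply: (pot_scale Hw); exact: ltW.
have If : (\int[nu]_p `|(f p)%:E| = 0)%E.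
  under eq_integral do rewrite gee0_abs ?lee_fin ?f0//.
  rewrite integral_EFin//; congr EFin; rewrite /f RintegralB//.
  - by rewrite RintegralZl; [rewrite -/(elastic_energy u) e subrr| |exact: Rintegrable_density].
  - exact: Rintegrable_density.
  - by apply: RintegrableZ; exact: Rintegrable_density.
have mf := measurable_int nu fi.
have fae := (ae_eq_integral_abs nu measurableT mf).1 If.
apply/eqP/esym; rewrite /elastic_energy /Rintegral (_ : (\int[nu]_p _ = 0)%E)//.
rewrite (ae_eq_integral (cst 0)%E) ?integral0//.
- by apply/measurable_EFinP; apply: measurable_density; case: su.
- apply: filterS fae => p /= /(_ I) [fp0] _; congr EFin.
  have [k0|k0] := eqVneq (kappa p.2) 0; first by rewrite /elastic_density k0 mulr0.
  have [s0|s0] := eqVneq (elastic_strain u p) 0; first by rewrite /elastic_density s0 (pot0 Hw) mul0r.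
  have := pot_scale_lt Hw t1 s0.
  move: fp0; rewrite /f /elastic_density strainZ// mulrA -mulrBl => /eqP.
  by rewrite mulf_eq0 (negbTE k0) orbF subr_eq0 => /eqP ->; rewrite ltxx.
Qed.

(** For the potential [x^2] in place of [w], this is the constant in the bound of the energy by
    [normsq]; long plateaus approach it. *)
Definition quadratic_coeff : R := \int[mu]_xi (kappa xi * omega xi ^+ 2 * width l delta xi ^+ 2).

Lemma E_le_small u (M : R) : sqint mu u -> 0 < M -> (forall p, `|elastic_strain u p| < M) ->
  elastic_energy u <= w M / M ^+ 2 * (quadratic_coeff * normsq u).
Proof.
move=> su M0 uM.
have o1 := omega1_gt0.
have [|||i le] := @Rintegral_D_sqr_le R l delta l0 ld (fun xi => kappa xi * omega xi ^+ 2)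
  (kappa1 * omega1 ^+ 2) u su.
- apply: measurable_funM; first exact: wt_mkappa wt.
  by apply: measurable_funX; exact: wt_momega wt.
- by move=> xi; apply: mulr_ge0; [exact: wt_kappa_ge0 wt xi|exact: sqr_ge0].
- move=> xi; apply: ler_pM; [exact: wt_kappa_ge0 wt xi|exact: sqr_ge0|exact: wt_kappa_le wt xi|].
  by rewrite ler_sqr ?nnegrE ?(wt_omega_le wt)//; [exact/ltW/omega_gt0|exact: ltW].
have c0 : 0 <= w M / M ^+ 2 by rewrite divr_ge0 ?(pot_ge0 Hw)// sqr_ge0.
apply: (@le_trans _ _ (w M / M ^+ 2 * \int[nu]_p (kappa p.2 * omega p.2 ^+ 2 * Dl u p ^+ 2))).
  rewrite -RintegralZl//; apply: le_Rintegral => //.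
  - exact: Rintegrable_density.
  - exact: RintegrableZ.
  - move=> p _; rewrite (_ : _ * (_ * _) = w M / M ^+ 2 * elastic_strain u p ^+ 2 * kappa p.2).
      by rewrite ler_wpM2r ?(wt_kappa_ge0 wt)// (pot_le_sqr Hw).
    by rewrite /elastic_strain; ring.
by rewrite ler_wpM2l.
Qed.

Lemma Q_ge0 : 0 <= quadratic_coeff.
Proof.
by apply: Rintegral_ge0 => xi _; apply: mulr_ge0; [apply: mulr_ge0; [exact: wt_kappa_ge0 wt xi|exact: sqr_ge0]|exact: sqr_ge0].
Qed.

Lemma normsqZ u (t : R) : sqint mu u -> normsq (fun y => t * u y) = t ^+ 2 * normsq u.
Proof.
move=> [mu_ ui]; rewrite /normsq -RintegralZl//.
by apply: eq_Rintegral => y _; rewrite exprMn.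
Qed.

(* Convexity makes the linearised functional at [u] a lower bound, and on the
   sphere through [u] it is maximal at the multiple of [elastic_gradient u]. *)
Lemma improvement u : sqint mu u -> 0 < elastic_energy u ->
  exists2 a, 0 < a <= normsq u / elastic_energy u &
    [/\ normsq (fun y => a * elastic_gradient u y) = normsq u,
        elastic_energy u <= elastic_energy (fun y => a * elastic_gradient u y) &
        elastic_energy u + (2 * a)^-1 * (\int[mu]_y (u y - a * elastic_gradient u y) ^+ 2) <=
          elastic_energy (fun y => a * elastic_gradient u y)].
Proof.
move=> su Eu; have sG := sqint_dE su.
set I := \int[mu]_y (u y * elastic_gradient u y).
have EI : elastic_energy u <= I := E_le_pairing su.
have quad t : \int[mu]_y (u y - t * elastic_gradient u y) ^+ 2 =
    normsq u - 2 * t * I + t ^+ 2 * normsq (elastic_gradient u).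
  rewrite (Rintegral_sqrB su (sqintZ t sG)) -/(normsq u) -/(normsq (fun y => t * elastic_gradient u y)) normsqZ//.
  rewrite (_ : (fun x => u x * (t * elastic_gradient u x)) = fun x => t * (u x * elastic_gradient u x)).
    by rewrite RintegralZl//; [rewrite -/I; ring|exact: sqintM].
  by apply/funext => x; ring.
have quad0 t : 0 <= normsq u - 2 * t * I + t ^+ 2 * normsq (elastic_gradient u).
  by rewrite -quad; apply: Rintegral_ge0 => y _; exact: sqr_ge0.
have n0 := normsq_ge0 u; have b0 := normsq_ge0 (elastic_gradient u).
have b_gt0 : 0 < normsq (elastic_gradient u).
  rewrite lt_neqAle b0 andbT eq_sym; apply/eqP => b_eq0.
  (* [quad0] is a nonnegative polynomial in [t] with linear coefficient [-2 I < 0]; without its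
     leading term it would be negative at this [t]. The constant term is shown to be nonzero in the
     same way. *)
  have := quad0 ((normsq u + 1) / I); rewrite b_eq0 mulr0 addr0.
  rewrite (_ : 2 * _ * I = 2 * (normsq u + 1)); first by lra.
  by field; rewrite gt_eqF//; lra.
have n_gt0 : 0 < normsq u.
  rewrite lt_neqAle n0 andbT eq_sym; apply/eqP => n_eq0.
  have := quad0 (I / normsq (elastic_gradient u)); rewrite n_eq0 sub0r.
  rewrite (_ : - _ + _ = - (I ^+ 2 / normsq (elastic_gradient u))); last by field; rewrite gt_eqF.
  rewrite oppr_ge0 => /le_lt_trans -/(_ _ _)/= H.
  suff : 0 < I ^+ 2 / normsq (elastic_gradient u) by move/H; rewrite ltxx.
  by rewrite divr_gt0// exprn_gt0//; lra.
(* The factor that puts the multiple of the gradient on the sphere through [u]. *)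
pose a := Num.sqrt (normsq u / normsq (elastic_gradient u)).
have a0 : 0 < a by rewrite sqrtr_gt0 divr_gt0.
have a2 : a ^+ 2 * normsq (elastic_gradient u) = normsq u.
  by rewrite sqr_sqrtr ?divr_ge0// divfK// gt_eqF.
have qa := quad a; rewrite a2 in qa.
have qa0 := quad0 a; rewrite a2 in qa0.
(* On that sphere the linear term, the pairing of [a dE u - u] with [dE u], equals
   [normsq (u - a dE u) / (2 a)]. *)
have key : elastic_energy u + (2 * a)^-1 * (\int[mu]_y (u y - a * elastic_gradient u y) ^+ 2) <=
    elastic_energy (fun y => a * elastic_gradient u y).
  apply: le_trans (E_tangent su (sqintZ a sG)).
  rewrite lerD2l qa (_ : \int[mu]_y _ = a * normsq (elastic_gradient u) - I).
    rewrite le_eqVlt; apply/orP; left; apply/eqP.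
    by rewrite -a2; field; rewrite gt_eqF.
  rewrite (_ : (fun y => _) = fun y => a * (elastic_gradient u y ^+ 2) - u y * elastic_gradient u y).
    rewrite RintegralB//; [|by apply: RintegrableZ; case: sG|exact: sqintM].
    by rewrite RintegralZl//; case: sG.
  by apply/funext => y; ring.
exists a.
  (* [qa0] says [a * I <= normsq u], and [E u <= I]. *)
  rewrite a0/=; clearbody I; move: (elastic_energy u) (normsq u) Eu EI qa0 => e n e0 eI.
  rewrite -mulrA ler_pdivlMr; last by [].
  move=> H; have : a * e <= a * I by rewrite ler_pM2l.
  by move: (a * I) H => x; lra.
split; [by rewrite normsqZ| |exact: key].
apply: le_trans key; rewrite lerDl mulr_ge0//; first by rewrite invr_ge0 mulr_ge0// ltW.
by apply: Rintegral_ge0 => y _; exact: sqr_ge0.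
Qed.

Lemma scale_down u (K : R) : sqint mu u -> 0 < K -> K < elastic_energy u ->
  exists2 t, 0 < t < 1 & K <= elastic_energy (fun y => t * u y).
Proof.
move=> su K0 KE; set I := \int[mu]_y (u y * elastic_gradient u y).
have EI : elastic_energy u <= I := E_le_pairing su.
(* With this [t] the tangent bound loses exactly half of the excess [E u - K]; [t > 0] because
   [I >= E u]. *)
exists (1 - (elastic_energy u - K) / (2 * I)).
  have : 0 < (elastic_energy u - K) / (2 * I) by rewrite divr_gt0//; lra.
  have : (elastic_energy u - K) / (2 * I) < 1 by rewrite ltr_pdivrMr; lra.
  by move=> ? ?; apply/andP; split; lra.
apply: le_trans (E_tangentZ _ su); rewrite -/I.
rewrite (_ : (1 - _ - 1) * I = - ((elastic_energy u - K) / 2)); first by lra.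
by field; rewrite gt_eqF//; lra.
Qed.

End functional.

(** * Splitting along pointwise limits *)

Section fatou_bound.
Context d (T : measurableType d) (R : realType).
Variable mu : {measure set T -> \bar R}.

(** Fatou's lemma: only an upper bound survives in the limit, and [normsq_split] accounts for the
    norm that escapes. *)
Lemma sqint_limit (un : nat -> T -> R) (u : T -> R) (N : R) :
  (forall n, sqint mu (un n)) -> (forall n, \int[mu]_x un n x ^+ 2 <= N) ->
  (forall x, un ^~ x @ \oo --> u x) ->
  sqint mu u /\ \int[mu]_x u x ^+ 2 <= N.
Proof.
move=> sun uN unu.
have mu_ : measurable_fun [set: T] u.
  by apply: measurable_fun_cvg => [n|x _]; [exact: sqint_measurable (sun n)|exact: unu].
suff le : (\int[mu]_x (u x ^+ 2)%:E <= N%:E)%E.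
  split; last by apply: integral_lee_fin => // x; exact: sqr_ge0.
  split => //; apply: ge0_Rintegrable; first exact: measurable_funX.
    by move=> x; exact: sqr_ge0.
  exact: le_lt_trans le (ltry _).
have E x : (u x ^+ 2)%:E = limn_einf (fun n => (un n x ^+ 2)%:E).
  apply/esym; apply: (cvg_limn_einf_sup _).1; apply: cvg_EFin; first exact: nearW.
  by apply: cvgM; exact: unu.
under eq_integral do rewrite E.
apply: le_trans (@fatou _ _ _ mu setT measurableT (fun n x => (un n x ^+ 2)%:E) _ _) _.
- by move=> n; apply/measurable_EFinP/measurable_funX; exact: sqint_measurable (sun n).
- by move=> n x _; rewrite lee_fin sqr_ge0.
rewrite limn_einf_lim; apply: lime_le; first exact: is_cvg_einfs.
apply: nearW => n; apply: (@le_trans _ _ (\int[mu]_x (un n x ^+ 2)%:E)%E).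
  by apply: ereal_inf_lbound; exists n => /=.
by rewrite integral_EFin ?lee_fin//; case: (sun n).
Qed.

End fatou_bound.

Section shift_real.
Context (R : realType).
Notation RT := (measurableTypeR R).
Notation mu := (@lebesgue_measure R).

Lemma Rintegral_shift (a : R) (f : RT -> R) : measurable_fun [set: RT] f ->
  \int[mu]_x f (x + a) = \int[mu]_x f x.
Proof.
move=> mf; congr fine; rewrite integralE [in RHS]integralE.
have mf' : measurable_fun [set: RT] (EFin \o f) by exact/measurable_EFinP.
rewrite -(ge0_integral_shift a (measurable_funepos mf'))//.
rewrite -(ge0_integral_shift a (measurable_funeneg mf'))//.
congr (_ - _)%E; apply: eq_integral => x _.
  by rewrite !funeposE.
by rewrite !funenegE.
Qed.

Lemma sqint_shift (a : R) (u : R -> R) : sqint mu u -> sqint mu (fun x => u (x + a)).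
Proof.
move=> [mu_ ui].
have mu' : measurable_fun [set: RT] (fun x => u (x + a)).
  by apply: measurableT_comp => //; exact: measurable_shift.
split => //; apply: ge0_Rintegrable; first exact: measurable_funX.
  by move=> x; exact: sqr_ge0.
rewrite (ge0_integral_shift a (f := fun x => (u x ^+ 2)%:E)).
- by rewrite integral_EFin ?ltry.
- exact/measurable_EFinP/measurable_funX.
- by move=> x; rewrite lee_fin sqr_ge0.
Qed.

End shift_real.

Section functional_limits.
Context (R : realType) (w dw : R -> R) (Hw : potential w dw).
Notation RT := (measurableTypeR R).
Notation mu := (@lebesgue_measure R).
Notation nu := (@plane_measure R).
Context (l delta : R) (kappa omega : R -> R) (kappa1 omega0 omega1 : R).
Hypothesis wt : weights l delta kappa omega kappa1 omega0 omega1.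
Implicit Types (u v : R -> R) (p : RT * RT).

Let l0 : 0 < l := wt_l0 wt.
Let ld : l < delta := wt_ld wt.
Let delta0 : 0 < delta := lt_trans l0 ld.
Local Notation Dl := (D l delta).
Local Notation E := (elastic_energy w l delta kappa omega).
Local Notation dE := (elastic_gradient dw l delta kappa omega).
Local Notation density := (elastic_density w l delta kappa omega).
Local Notation ddensity := (elastic_ddensity dw l delta kappa omega).
Local Notation strain := (elastic_strain l delta omega).

Lemma normsq_shift (a : R) u : measurable_fun [set: RT] u ->
  normsq (fun x => u (x + a)) = normsq u.
Proof.
move=> mu_; rewrite /normsq (Rintegral_shift a (f := fun x => u x ^+ 2))//.
exact: measurable_funX.
Qed.

Lemma D_shift (a : R) u z xi : measurable_fun [set: RT] u ->
  Dl (fun x => u (x + a)) (z, xi) = Dl u (z + a, xi).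
Proof.
move=> mu_; rewrite /D.
rewrite -(Rintegral_shift a (f := fun y => u y * ker l delta ((z + a, xi), y))).
  apply: eq_Rintegral => y _; congr (_ * _).
  rewrite !kerE/= !indicE !mem_setE !in_itv/= lerD2r.
  by rewrite (addrAC z a xi) lerD2r.
apply: measurable_funM => //; apply: measurableT_comp; first exact: measurable_ker.
exact: pair1_measurable.
Qed.

(** By Tonelli the integral over [z] becomes the inner one; at fixed [xi] a translation of [u] only
    translates the density in [z]. *)
Lemma E_shift (a : R) u : sqint mu u -> E (fun x => u (x + a)) = E u.
Proof.
move=> su; have mu_ := sqint_measurable su.
have H v : sqint mu v -> (\int[nu]_p (density v p)%:E =
    \int[mu]_xi \int[mu]_z (density v (z, xi))%:E)%E.
  move=> sv; rewrite /plane_measure fubini_tonelli2//.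
    apply/measurable_EFinP; exact: (measurable_density Hw wt (sqint_measurable sv)).
  by move=> p; rewrite lee_fin; by apply: (density_ge0 Hw wt).
rewrite /elastic_energy /Rintegral (H _ su) (H _ (sqint_shift a su)).
apply: (congr1 fine); apply: eq_integral => xi _.
rewrite -(ge0_integral_shift a (f := fun z => (density u (z, xi))%:E)).
- by apply: eq_integral => z _; rewrite /elastic_density /elastic_strain D_shift.
- apply/measurable_EFinP; apply: measurableT_comp; last exact: pair2_measurable.
  exact: (measurable_density Hw wt).
- by move=> x; rewrite lee_fin; by apply: (density_ge0 Hw wt).
Qed.

Section sequences.
Variables (un : nat -> R -> R) (u : R -> R) (N B : R).
Hypothesis sun : forall n, sqint mu (un n).
Hypothesis unN : forall n, normsq (un n) <= N.
Hypothesis unB : forall n x, `|un n x| <= B.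
Hypothesis unu : forall x, un ^~ x @ \oo --> u x.

Lemma sqint_lim : sqint mu u.
Proof. exact: (sqint_limit sun unN unu).1. Qed.

Lemma normsq_lim : normsq u <= N.
Proof. exact: (sqint_limit sun unN unu).2. Qed.

(** A fixed window is bounded, so the uniform bound [B] on the sequence provides an integrable
    majorant. *)
Lemma D_lim p : Dl (un n) p @[n --> \oo] --> Dl u p.
Proof.
apply: (@cvg_Rintegral _ RT R mu (fun n y => un n y * ker l delta (p, y)) _
  (fun y => B * ker l delta (p, y))).
- move=> n; apply: measurable_funM; first exact: sqint_measurable (sun n).
  by apply: measurableT_comp; [exact: measurable_ker|exact: pair1_measurable].
- by move=> n y; rewrite normrM (ger0_norm (ker_ge0 _ _ _)) ler_wpM2r ?ker_ge0.
- apply: RintegrableZ; apply: ge0_Rintegrable; first last.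
  + by rewrite integral_ker// ltry.
  + by move=> y; exact: ker_ge0.
  + by apply: measurableT_comp; [exact: measurable_ker|exact: pair1_measurable].
- by move=> y; apply: cvgMl; exact: unu.
Qed.

(** From [normsq (un + u) >= 0], as in the parallelogram identity; the sum enters as a difference
    with [-1 * u]. *)
Lemma normsqB_le n : normsq (fun y => un n y - u y) <= 4 * N.
Proof.
have su := sqint_lim; have uN := normsq_lim.
have := Rintegral_sqrB (sun n) su; have := Rintegral_sqrB (sun n) (sqintZ (-1) su).
rewrite -!/(normsq _) => e1 e2.
have : 0 <= normsq (un n) - 2 * (\int[mu]_x (un n x * (-1 * u x))) + normsq (fun x => -1 * u x).
  by rewrite -e1; exact: normsq_ge0.
rewrite normsqZ// [X in 2 * X](_ : _ = - \int[mu]_x (un n x * u x)).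
  by rewrite e2; have := unN n; rewrite sqrrN expr1n mul1r; lra.
rewrite -[RHS]mulN1r -RintegralZl//; last exact: sqintM.
by apply: eq_Rintegral => x _; ring.
Qed.

(** The difference is [normsq u] plus twice the pairing of [un - u] with [u], and that pairing tends
    to 0 by [cvg_Rintegral_sqintM]. *)
Lemma normsq_split :
  (fun n => normsq (un n) - normsq (fun y => un n y - u y)) @ \oo --> normsq u.
Proof.
have su := sqint_lim.
have S n : sqint mu (fun y => un n y - u y) by exact: sqintB.
have H := @cvg_Rintegral_sqintM _ RT R mu (fun n y => un n y - u y) u (4 * N)
  S normsqB_le _ su.
have {}H : (fun n => \int[mu]_x `|(un n x - u x) * u x|) @ \oo --> 0.
  by apply: H => x; rewrite -(subrr (u x)); apply: cvgB; [exact: unu|exact: cvg_cst].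
have {}H : (fun n => \int[mu]_x ((un n x - u x) * u x)) @ \oo --> 0.
  apply: norm_cvg0; apply: (squeeze_cvgr _ (cvg_cst 0) H); apply: nearW => n.
  by rewrite normr_ge0/=; apply: le_normr_Rintegral => //; exact: sqintM.
rewrite (_ : (fun n => _) = (fun n => 2 * \int[mu]_x ((un n x - u x) * u x) + normsq u)).
  rewrite -[X in _ --> X]add0r; apply: cvgD; last exact: cvg_cst.
  by rewrite -[X in _ --> X](mulr0 2); apply: cvgM; [exact: cvg_cst|exact: H].
apply/funext => n.
have e := Rintegral_sqrB (S n) (sqintZ (-1) su).
rewrite (_ : (fun x => _) = (fun x => un n x ^+ 2)) in e; last first.
  by apply/funext => x; congr (_ ^+ 2); ring.
rewrite -!/(normsq _) normsqZ// in e; rewrite e.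
rewrite (_ : \int[mu]_x _ = - \int[mu]_x ((un n x - u x) * u x)); first by ring.
rewrite -[RHS]mulN1r -RintegralZl//; last exact: sqintM.
by apply: eq_Rintegral => x _; ring.
Qed.

(** By [density_bounds] the error is at most a constant times the integral of [|D (un - u) * D u|].
    The first factor tends to 0 pointwise and is bounded in L^2 of the plane, the second is a fixed
    square-integrable function. *)
Lemma E_split :
  (fun n => E (un n) - E (fun y => un n y - u y)) @ \oo --> E u.
Proof.
have su := sqint_lim.
have S n : sqint mu (fun y => un n y - u y) by exact: sqintB.
have N0 : 0 <= N := le_trans (normsq_ge0 u) normsq_lim.
have [C C0 HC] := density_bounds Hw wt (4 * N).
have D0 p : Dl (fun y => un n y - u y) p @[n --> \oo] --> 0.
  rewrite (_ : (fun n => _) = (fun n => Dl (un n) p - Dl u p)); last first.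
    by apply/funext => n; rewrite DB.
  by rewrite -(subrr (Dl u p)); apply: cvgB; [exact: D_lim|exact: cvg_cst].
have DM n : \int[nu]_p Dl (fun y => un n y - u y) p ^+ 2 <=
    (\int[mu]_xi (1 * width l delta xi ^+ 2)) * (4 * N).
  have [] := @Rintegral_D_sqr_le R l delta l0 ld (fun=> 1) 1 _ (S n) => // _.
  under eq_Rintegral do rewrite mul1r.
  move=> /le_trans; apply; rewrite ler_wpM2l ?normsqB_le//.
  by apply: Rintegral_ge0 => xi _; rewrite mul1r sqr_ge0.
have H := @cvg_Rintegral_sqintM _ (RT * RT)%type R nu _ _ _
  (fun n => D_sqint l0 ld (S n)) DM D0 (D_sqint l0 ld su).
have {}H : (fun n => C * \int[nu]_p `|Dl (fun y => un n y - u y) p * Dl u p|) @ \oo --> 0.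
  by rewrite -(mulr0 C); apply: cvgM; [exact: cvg_cst|exact: H].
suff K : (fun n => E (un n) - E u - E (fun y => un n y - u y)) @ \oo --> 0.
  rewrite (_ : (fun n => _) = (fun n => (E (un n) - E u - E (fun y => un n y - u y)) + E u)).
    by rewrite -[X in _ --> X]add0r; apply: cvgD; [exact: K|exact: cvg_cst].
  by apply/funext => n; rewrite addrAC subrK.
apply: norm_cvg0; apply: (squeeze_cvgr _ (cvg_cst 0) H); apply: nearW => n.
rewrite normr_ge0/=.
have i1 := Rintegrable_density Hw wt (sun n).
have i2 := Rintegrable_density Hw wt su.
have i3 := Rintegrable_density Hw wt (S n).
have i4 := RintegrableB (RintegrableB i1 i2) i3.
have i5 := Rintegrable_norm (sqintM (D_sqint l0 ld (S n)) (D_sqint l0 ld su)).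
rewrite /elastic_energy -RintegralB// -RintegralB//; last exact: RintegrableB.
apply: (le_trans (le_normr_Rintegral measurableT i4)).
rewrite -RintegralZl//; apply: le_Rintegral => //.
- exact: Rintegrable_norm.
- exact: RintegrableZ.
- move=> p _; have [|_ _] := HC u p su.
    by apply: (le_trans normsq_lim); lra.
  by move=> /(_ _ (sun n) (normsqB_le n)); rewrite [Dl u p * _]mulrC.
Qed.

End sequences.

End functional_limits.

(** * Regularity of the gradient *)

Section gradient_regularity.
Context (R : realType) (w dw : R -> R) (Hw : potential w dw).
Notation RT := (measurableTypeR R).
Notation mu := (@lebesgue_measure R).
Notation nu := (@plane_measure R).
Context (l delta : R) (kappa omega : R -> R) (kappa1 omega0 omega1 : R).
Hypothesis wt : weights l delta kappa omega kappa1 omega0 omega1.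
Implicit Types (u v : R -> R) (p : RT * RT).

Let l0 : 0 < l := wt_l0 wt.
Let ld : l < delta := wt_ld wt.
Let delta0 : 0 < delta := lt_trans l0 ld.
Local Notation Dl := (D l delta).
Local Notation dE := (elastic_gradient dw l delta kappa omega).
Local Notation ddensity := (elastic_ddensity dw l delta kappa omega).
Local Notation strain := (elastic_strain l delta omega).
Local Notation chi := (\1_(`[l, delta]%classic) : RT -> R).

(** Outside [l, delta] both sides vanish with [kappa], so the formula through [prim u], which shows
    continuity in [z], holds for every [xi]. *)
Lemma ddensityE u z xi : sqint mu u -> ddensity u (z, xi) =
  dw ((prim u (z + xi) - prim u z) * omega xi) * omega xi * kappa xi.
Proof.
move=> su; rewrite /elastic_ddensity /elastic_strain /=.
have [xil|xil] := boolP (xi \in `[l, delta]%R).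
  by rewrite (D_prim l0 _ (sqint_locint su)).
by rewrite (wt_kappa_out wt)// !mulr0.
Qed.

Lemma ddensity_out u z xi : xi \notin `[l, delta]%R -> ddensity u (z, xi) = 0.
Proof. by move=> xil; rewrite /elastic_ddensity /= (wt_kappa_out wt)// !mulr0. Qed.

Lemma ddensity_le (N : R) : exists2 C, 0 <= C & forall u p, sqint mu u -> normsq u <= N ->
  `|ddensity u p| <= C * chi p.2.
Proof.
have [C C0 HC] := density_bounds Hw wt N.
have [N0|N0] := lerP 0 N; last first.
  exists 0 => // u p su uN; have := lt_le_trans N0 (normsq_ge0 u).
  by move=> /(le_lt_trans uN); rewrite ltxx.
exists (C * (1 + delta * N)); first by nneg.
move=> u [z xi] su uN; rewrite indicE mem_setE /=; case: (boolP (_ \in _)) => xil; last first.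
  by rewrite ddensity_out// normr0 mulr0.
have [_ H _] := HC u (z, xi) su uN; rewrite mulr1.
apply: (le_trans H); rewrite ler_wpM2l//.
have := D_sqr_le l0 ld (z, xi) su; rewrite -[_ ^+ 2]real_normK ?num_real//.
rewrite -/(normsq u) => H2.
have : delta * normsq u <= delta * N by rewrite ler_pM2l.
by have := sqr_ge0 (`|Dl u (z, xi)| - 1); have := normr_ge0 (Dl u (z, xi)); nra.
Qed.

Lemma ddensity_continuous u xi : sqint mu u -> continuous (fun z => ddensity u (z, xi)).
Proof.
move=> su; rewrite (_ : (fun z => _) = (fun z =>
    dw ((prim u (z + xi) - prim u z) * omega xi) * omega xi * kappa xi)); last first.
  by apply/funext => z; rewrite ddensityE.
move=> z; apply: cvgMl; apply: cvgMl.
apply: (@continuous_comp _ _ _ (fun z => (prim u (z + xi) - prim u z) * omega xi) dw); last first.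
  exact: pot_dcontinuous Hw _.
apply: cvgMl; apply: cvgB; last exact: prim_continuous (sqint_locint su) z.
apply: (@continuous_comp _ _ _ (fun z => z + xi) (prim u)).
  by apply: cvgD; [exact: cvg_id|exact: cvg_cst].
exact: prim_continuous (sqint_locint su) _.
Qed.

(** The contribution of a single [xi] to the gradient at [y]. It is an increment of a primitive of a
    continuous function, hence differentiable in [y] although [u] need not be continuous. *)
Definition slice u y xi : R := \int[mu]_z (ddensity u (z, xi) * ker l delta ((z, xi), y)).

Lemma slice_prim u y xi : sqint mu u -> slice u y xi =
  prim (fun z => ddensity u (z, xi)) y - prim (fun z => ddensity u (z, xi)) (y - xi).
Proof.
move=> su; have lc := continuous_locint (@ddensity_continuous u xi su).
have [xil|xil] := boolP (xi \in `[l, delta]%R); last first.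
  have e : (fun z => ddensity u (z, xi)) = fun=> 0.
    by apply/funext => z; rewrite ddensity_out.
  rewrite /slice e /prim !Rintegral_cst// !mul0r !subr0.
  rewrite (_ : (fun z => _) = fun=> 0); first by rewrite Rintegral_cst// mul0r.
  by apply/funext => z; rewrite ddensity_out// mul0r.
have xi0 : 0 <= xi.
  by move: xil; rewrite in_itv/= => /andP[/(le_trans (ltW l0))].
rewrite primB//; last by rewrite gerBl.
rewrite /slice [RHS]Rintegral_mkcond; apply: eq_Rintegral => z _.
rewrite kerE' indicE mem_setE xil mul1r patchE indicE.
by case: (z \in _); rewrite ?mulr1 ?mulr0.
Qed.

Lemma is_derive_slice u (y : R) xi : sqint mu u ->
  is_derive y 1 (slice u ^~ xi) (ddensity u (y, xi) - ddensity u (y - xi, xi)).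
Proof.
move=> su; rewrite (_ : slice u ^~ xi = fun y =>
    prim (fun z => ddensity u (z, xi)) y - prim (fun z => ddensity u (z, xi)) (y - xi)).
  have c := @ddensity_continuous u xi su.
  apply: is_deriveB; first exact: is_derive_prim.
  rewrite -[X in is_derive _ _ _ X]mulr1.
  apply: (@is_derive1_comp _ (prim (fun z => ddensity u (z, xi))) (fun y => y - xi)).
    exact: is_derive_prim.
  by rewrite -[X in is_derive _ _ _ X]addr0; apply: is_deriveD.
by apply/funext => x; rewrite slice_prim.
Qed.

Lemma ddensity_ker_integrable u y : sqint mu u ->
  Rintegrable nu (fun p => ddensity u p * ker l delta (p, y)).
Proof.
move=> su; have [C C0 HC] := ddensity_le (normsq u).
apply: (@Rintegrable_le _ (RT * RT)%type R nu _ (fun p => C * ker l delta (p, y))).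
- apply: measurable_funM; first exact: (measurable_ddensity Hw wt (sqint_measurable su)).
  by apply: measurableT_comp; [exact: measurable_ker|exact: pair2_measurable].
- move=> p; rewrite normrM (ger0_norm (ker_ge0 _ _ _)) ler_wpM2r ?ker_ge0//.
  apply: (le_trans (HC _ _ su (lexx _))); rewrite ler_piMr// indicE lern1 leq_b1.
- apply: RintegrableZ; apply: ge0_Rintegrable.
  + by apply: measurableT_comp; [exact: measurable_ker|exact: pair2_measurable].
  + by move=> p; exact: ker_ge0.
  + by rewrite (integral_kerr l0 ld) ltry.
Qed.

Lemma slice_integrand u y xi : sqint mu u ->
  Rintegrable mu (fun z => ddensity u (z, xi) * ker l delta ((z, xi), y)).
Proof.
move=> su; have [C C0 HC] := ddensity_le (normsq u).
apply: (@Rintegrable_le _ RT R mu _ (fun z => C * \1_`[y - xi, y] z)).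
- apply: measurable_funM.
    apply: measurableT_comp; last exact: pair2_measurable.
    exact: (measurable_ddensity Hw wt (sqint_measurable su)).
  apply: (measurableT_comp (measurable_ker _ _)).
  by apply: (measurableT_comp (pair2_measurable y)); exact: pair2_measurable.
- move=> z; rewrite normrM (ger0_norm (ker_ge0 _ _ _)) kerE' mulrA.
  rewrite ler_wpM2r//.
  apply: (@le_trans _ _ (C * \1_`[l, delta] xi)); last first.
    by rewrite ler_piMr// indicE lern1 leq_b1.
  have := HC u (z, xi) su (lexx _); rewrite /= indicE.
  case: (_ \in _); rewrite ?mulr1// mulr0.
  by move=> H; rewrite mulr0.
- by apply: RintegrableZ; exact: integrable_indic_itv.
Qed.

Lemma fubini_slice u y : sqint mu u ->
  fubini_G mu (EFin \o (fun p => ddensity u p * ker l delta (p, y))) = EFin \o slice u y.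
Proof.
move=> su; apply/funext => xi; rewrite /fubini_G /slice integral_EFin//.
exact: slice_integrand.
Qed.

Lemma dE_slice u y : sqint mu u -> dE u y = \int[mu]_xi slice u y xi.
Proof.
move=> su; have i := ddensity_ker_integrable y su.
by rewrite /elastic_gradient /Dadj /Rintegral -(integral21_prod_meas1 i) fubini_slice.
Qed.

Lemma Rintegrable_slice u y : sqint mu u -> Rintegrable mu (slice u y).
Proof.
move=> su; have [C C0 HC] := ddensity_le (normsq u).
apply: (Rintegrable_bounded_support ld (M := C * delta)).
- apply: (@measurable_Rintegral_fst _ _ _ _ R mu (fun p => ddensity u p * ker l delta (p, y))).
  exact: Rintegrable_measurable (ddensity_ker_integrable y su).
- move=> xi; have [xil|xil] := boolP (xi \in `[l, delta]%R); last first.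
    rewrite /slice (_ : (fun z => _) = fun=> 0).
      by rewrite Rintegral_cst// mul0r normr0 mulr_ge0// ltW.
    by apply/funext => z; rewrite ddensity_out// mul0r.
  have /andP[xl xd] : l <= xi <= delta by move: xil; rewrite in_itv.
  apply: (le_trans (le_normr_Rintegral measurableT (slice_integrand y xi su))).
  apply: (@le_trans _ _ (\int[mu]_z (C * \1_`[y - xi, y] z))).
    apply: le_Rintegral => //.
    + exact: Rintegrable_norm (slice_integrand y xi su).
    + by apply: RintegrableZ; exact: integrable_indic_itv.
    + move=> z _; rewrite normrM (ger0_norm (ker_ge0 _ _ _)) kerE' indicE mem_setE xil mul1r.
      rewrite ler_wpM2r//.
      by have := HC u (z, xi) su (lexx _); rewrite /= indicE mem_setE xil mulr1.
  rewrite RintegralZl//; last exact: integrable_indic_itv.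
  rewrite ler_wpM2l// /Rintegral integral_indic_itv; last by rewrite gerBl (le_trans (ltW l0)).
  by rewrite /= subKr.
- move=> xi xil; rewrite /slice (_ : (fun z => _) = fun=> 0).
    by rewrite Rintegral_cst// mul0r.
  by apply/funext => z; rewrite ddensity_out// mul0r.
Qed.

Definition ddE u (x : R) : R := \int[mu]_xi (ddensity u (x, xi) - ddensity u (x - xi, xi)).

Lemma Rintegrable_chi : Rintegrable mu chi.
Proof. exact: integrable_indic_itv. Qed.

(** The gain of regularity: [ddensity] depends on [u] through its primitive only, so each slice is
    differentiable; the derivatives are dominated by [2 C] on [l, delta], and one differentiates
    under the integral over [xi]. The result [ddE] is the right-hand side of the Euler-Lagrange
    equation. *)
Lemma is_derive_dE u (x : R) : sqint mu u -> is_derive x 1 (dE u) (ddE u x).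
Proof.
move=> su; have [C C0 HC] := ddensity_le (normsq u).
rewrite (_ : dE u = fun y => \int[mu]_xi slice u y xi); last first.
  by apply/funext => y; exact: dE_slice.
have Ix : `]x - 1, x + 1[%classic x by rewrite /= in_itv/=; lra.
have i y (_ : `]x - 1, x + 1[%classic y) : mu.-integrable setT (EFin \o slice u y).
  exact: Rintegrable_slice.
have d y (xi : RT) (_ : `]x - 1, x + 1[%classic y) (_ : [set: RT] xi) :
    derivable (slice u ^~ xi) y 1.
  by case: (is_derive_slice y xi su).
have p1 y xi : partial1of2 (slice u) y xi = ddensity u (y, xi) - ddensity u (y - xi, xi).
  by rewrite partial1of2E; case: (is_derive_slice y xi su).
have b y (xi : RT) (_ : `]x - 1, x + 1[%classic y) (_ : [set: RT] xi) :
    `|partial1of2 (slice u) y xi| <= 2 * C * chi xi.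
  rewrite p1 (le_trans (ler_normB _ _))//.
  have := HC u (y, xi) su (lexx _); have := HC u (y - xi, xi) su (lexx _).
  by rewrite /=; lra.
have g0 (xi : RT) : 0 <= 2 * C * chi xi.
  by rewrite mulr_ge0// ?indicE//; nneg.
have gi : mu.-integrable setT (EFin \o (fun xi => 2 * C * chi xi)).
  by apply: RintegrableZ; exact: Rintegrable_chi.
have D1 := derivable_under_integral measurableT Ix i d g0 gi b.
have D2 := differentiation_under_integral measurableT Ix i d g0 gi b.
apply: DeriveDef; first exact: D1.
by rewrite -derive1E D2; apply: eq_Rintegral => xi _; rewrite p1.
Qed.

Lemma ddE_continuous u : sqint mu u -> continuous (ddE u).
Proof.
move=> su x; have [C C0 HC] := ddensity_le (normsq u).
pose f (x : R) (xi : RT) := ddensity u (x, xi) - ddensity u (x - xi, xi).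
have mh := measurable_ddensity Hw wt (sqint_measurable su).
have mf y : measurable_fun [set: RT] (f y).
  apply: measurable_funB; first by apply: measurableT_comp => //; exact: pair1_measurable.
  apply: (measurableT_comp mh) => //; apply: measurable_fun_pair => //.
  exact: measurable_funB.
have fC y xi : `|f y xi| <= 2 * C * chi xi.
  rewrite (le_trans (ler_normB _ _))//.
  have := HC u (y, xi) su (lexx _); have := HC u (y - xi, xi) su (lexx _).
  by rewrite /=; lra.
have gi : mu.-integrable setT (EFin \o (fun xi => 2 * C * chi xi)).
  by apply: RintegrableZ; exact: Rintegrable_chi.
have fi y (_ : `]x - 1, x + 1[%classic y) : mu.-integrable setT (EFin \o f y).
  exact: Rintegrable_le (mf y) (fC y) gi.
have cf : {ae mu, forall xi, [set: RT] xi -> {in `]x - 1, x + 1[%classic, continuous (f ^~ xi)}}.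
  apply: aeW => xi _ y _; apply: cvgB; first exact: ddensity_continuous.
  apply: (@continuous_comp _ _ _ (fun y => y - xi) (fun z => ddensity u (z, xi))).
    by apply: cvgB; [exact: cvg_id|exact: cvg_cst].
  exact: ddensity_continuous.
have ub y (_ : `]x - 1, x + 1[%classic y) : {ae mu, forall xi, [set: RT] xi -> `|f y xi| <= 2 * C * chi xi}.
  by apply: aeW.
have := continuity_under_integral measurableT fi cf gi ub.
apply; rewrite inE/= in_itv/=; lra.
Qed.

(** Supplies the common bound and Lipschitz constant of the improved minimizing sequence. *)
Lemma dE_bounds (N : R) : exists2 C, 0 <= C & forall u, sqint mu u -> normsq u <= N ->
  (forall x, `|dE u x| <= C) /\ (forall x, `|ddE u x| <= C).
Proof.
have [C C0 HC] := ddensity_le N.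
pose W := \int[mu]_xi width l delta xi; pose X := \int[mu]_xi chi xi.
have W0 : 0 <= W by apply: Rintegral_ge0 => xi _; exact: width_ge0.
have X0 : 0 <= X by apply: Rintegral_ge0 => xi _; rewrite indicE.
exists (C * W + 2 * C * X); first by nneg.
move=> u su uN; split => x.
- apply: (@le_trans _ _ (C * W)); last by rewrite lerDl; nneg.
  have i := ddensity_ker_integrable x su.
  apply: (le_trans (le_normr_Rintegral measurableT i)).
  have kx : Rintegrable nu (fun p => ker l delta (p, x)).
    apply: ge0_Rintegrable.
    + by apply: measurableT_comp; [exact: measurable_ker|exact: pair2_measurable].
    + by move=> p; exact: ker_ge0.
    + by rewrite (integral_kerr l0 ld) ltry.
  have -> : W = \int[nu]_p ker l delta (p, x).
    by rewrite [RHS]/Rintegral (integral_kerr l0 ld).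
  rewrite -RintegralZl//; apply: le_Rintegral => //.
  + exact: Rintegrable_norm.
  + exact: RintegrableZ.
  + move=> p _; rewrite normrM (ger0_norm (ker_ge0 _ _ _)) ler_wpM2r ?ker_ge0//.
    by apply: (le_trans (HC _ _ su uN)); rewrite ler_piMr// indicE lern1 leq_b1.
- apply: (@le_trans _ _ (2 * C * X)); last by rewrite lerDr; nneg.
  have mh := measurable_ddensity Hw wt (sqint_measurable su).
  have mf : measurable_fun [set: RT] (fun xi => ddensity u (x, xi) - ddensity u (x - xi, xi)).
    apply: measurable_funB; first by apply: measurableT_comp => //; exact: pair1_measurable.
    apply: (measurableT_comp mh) => //; apply: measurable_fun_pair => //.
    exact: measurable_funB.
  have fC (xi : RT) : `|ddensity u (x, xi) - ddensity u (x - xi, xi)| <= 2 * C * chi xi.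
    rewrite (le_trans (ler_normB _ _))//.
    have := HC u (x, xi) su uN; have := HC u (x - xi, xi) su uN.
    by rewrite /=; lra.
  have gi := RintegrableZ (2 * C) Rintegrable_chi.
  have fi := Rintegrable_le mf fC gi.
  apply: (le_trans (le_normr_Rintegral measurableT fi)).
  rewrite -RintegralZl//; last exact: Rintegrable_chi.
  by apply: le_Rintegral => //; exact: Rintegrable_norm.
Qed.

End gradient_regularity.

(** * Existence of a minimizer *)

Section pointwise_compactness.
Context (R : realType).
Implicit Types (un : nat -> R -> R).

(** Indices that code no rational are sent to 0, which does no harm as only density of the range
    matters. *)
Definition rat_enum (k : nat) : R := ratr (odflt 0 (unpickle k : option rat)).

Lemma rat_enum_dense (x e : R) : 0 < e -> exists k, `|x - rat_enum k| < e.
Proof.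
move=> e0; have [|q] := @rat_in_itvoo R (x - e) (x + e); first by lra.
rewrite in_itv/= => /andP[q1 q2]; exists (pickle q).
rewrite /rat_enum pickleK /= ltr_norml; lra.
Qed.

(* Limits along an ultrafilter exist at every point; those at the rational points
   are reached along a sequence, and the Lipschitz bound gives all the others. *)
Lemma lipschitz_subsequence un (B L : R) :
  (forall n x, `|un n x| <= B) -> (forall n x y, `|un n x - un n y| <= L * `|x - y|) ->
  exists phi : nat -> nat, (forall j, (j <= phi j)%N) /\
    exists u : R -> R, forall x, un (phi j) x @[j --> \oo] --> u x.
Proof.
move=> unB unL.
have L0 : 0 <= L.
  by have := le_trans (normr_ge0 _) (unL 0%N 1 0); rewrite subr0 normr1 mulr1.
have [U [UU Uoo]] := ultraFilterLemma (@eventually_filter).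
have PU : ProperFilter U := @ultra_proper _ _ UU.
have Ulim x : exists c : R, un n x @[n --> U] --> c.
  have cB : compact `[- B, B]%classic := @segment_compact R (- B) B.
  have Ux : (un ^~ x @ U) `[- B, B]%classic.
    by apply: (@filterE _ U) => n; have := unB n x; rewrite ler_norml /= in_itv.
  have [c [_ cl]] := cB _ (fmap_proper_filter (un ^~ x) PU) Ux.
  (* A cluster point of an ultrafilter is a limit: otherwise the complement of the preimage of [V]
     belongs to [U], and [cl] gives a point in both [V] and its complement. *)
  exists c => V Vc; have [//|nV] := in_ultra_setVsetC (un ^~ x @^-1` V) UU.
  by have [y [/= ny Vy]] := cl (~` V) V nV Vc.
have [u uP] := choice Ulim.
have uL x y : `|u x - u y| <= L * `|x - y|.
  have c : (fun n => `|un n x - un n y|) @ U --> `|u x - u y|.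
    by apply: cvg_norm; apply: cvgB; exact: uP.
  by apply: (cvgr_to_le c); apply: nearW => n; exact: unL.
(* Stage [j] involves finitely many rational points, so a single index close to the limit at all of
   them exists; this replaces the nested subsequences of a diagonal argument. *)
have near_fin j : \forall n \near U, forall k, (k <= j)%N ->
    `|u (rat_enum k) - un n (rat_enum k)| < j.+1%:R^-1.
  have H k : \forall n \near U, `|u (rat_enum k) - un n (rat_enum k)| < j.+1%:R^-1.
    by move/cvgrPdist_lt : (uP (rat_enum k)); apply; rewrite invr_gt0.
  elim: {1 3}j => [|i IH].
    by apply: filterS (H 0%N) => n Hn k; rewrite leqn0 => /eqP ->.
  apply: filterS2 IH (H i.+1) => n IHn Hn k; rewrite leq_eqVlt => /predU1P[->//|].
  by rewrite ltnS => /IHn.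
have sel j : exists n, (j <= n)%N /\ forall k, (k <= j)%N ->
    `|u (rat_enum k) - un n (rat_enum k)| < j.+1%:R^-1.
  have Uj : \forall n \near U, (j <= n)%N by apply: Uoo; exists j.
  have [n [n1 n2]] := filter_ex (filterI Uj (near_fin j)).
  by exists n.
have [phi phiP] := choice sel.
exists phi; split; first by move=> j; case: (phiP j).
exists u => x; apply/cvgrPdist_lt => e e0.
have e4 : 0 < e / (4 * (L + 1)) by rewrite divr_gt0//; lra.
have [k xk] := rat_enum_dense x e4.
have e2 : 0 < e / 2 by lra.
have [m _ Hm] := @near_infty_natSinv_lt R (PosNum e2).
exists (maxn k m) => // j /=; rewrite geq_max => /andP[kj mj].
have [_ /(_ k kj) close] := phiP j.
have lt2 : j.+1%:R^-1 < e / 2 by exact: (Hm j mj).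
have Lx : L * `|x - rat_enum k| <= e / 4.
  apply: (@le_trans _ _ (L * (e / (4 * (L + 1))))); first by rewrite ler_wpM2l// ltW.
  rewrite (_ : L * _ = e / 4 * (L / (L + 1))); last by field; lra.
  by rewrite ler_piMr ?ler_pdivrMr; lra.
have := uL x (rat_enum k); have := unL (phi j) x (rat_enum k).
move: close lt2 Lx; move: (un _ _) (un _ _) (u _) (u _) (j.+1%:R^-1) (L * _) => a b c d s t.
rewrite !ltr_norml !ler_norml => /andP[? ?] ? ? /andP[? ?] /andP[? ?].
by apply/andP; split; lra.
Qed.

End pointwise_compactness.

Section continuous_null.
Context (R : realType).
Notation RT := (measurableTypeR R).
Notation mu := (@lebesgue_measure R).

Lemma continuous_normsq_eq0 (u : R -> R) : continuous u -> sqint mu u ->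
  normsq u <= 0 -> forall x, u x = 0.
Proof.
move=> cu su u0 x; apply/eqP; apply: contraTT u0 => ux0; rewrite -ltNge.
have c0 : 0 < `|u x| / 2 by rewrite divr_gt0// normr_gt0.
have /cvgrPdist_lt/(_ _ c0)[r /= r0 Hr] := cu x.
apply: (@lt_le_trans _ _ (\int[mu]_y ((`|u x| / 2) ^+ 2 * \1_`[x - r / 2, x + r / 2] y))).
  rewrite RintegralZl//; last exact: integrable_indic_itv.
  apply: mulr_gt0; first exact: exprn_gt0.
  by rewrite /Rintegral integral_indic_itv /=; lra.
apply: le_Rintegral => //.
- by apply: RintegrableZ; exact: integrable_indic_itv.
- by case: su.
- move=> y _; rewrite indicE mem_setE in_itv/=; case: (boolP (_ && _)) => xy; last first.
    by rewrite mulr0 sqr_ge0.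
  have /Hr /= xy2 : `|x - y| < r.
    by move: xy => /andP[? ?]; rewrite ltr_norml; apply/andP; split; lra.
  have le : `|u x| / 2 <= `|u y|.
    by have := ler_normD (u x - u y) (u y); rewrite subrK; lra.
  by rewrite mulr1 -[leRHS]real_normK ?num_real// ler_sqr ?nnegrE// ltW.
Qed.

End continuous_null.

Section minimizer.
Context (R : realType) (w dw : R -> R) (Hw : potential w dw).
Notation RT := (measurableTypeR R).
Notation mu := (@lebesgue_measure R).
Context (l delta : R) (kappa omega : R -> R) (kappa1 omega0 omega1 : R).
Hypothesis wt : weights l delta kappa omega kappa1 omega0 omega1.
Implicit Types (u v : R -> R).

Let l0 : 0 < l := wt_l0 wt.
Let ld : l < delta := wt_ld wt.
Let delta0 : 0 < delta := lt_trans l0 ld.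
Local Notation E := (elastic_energy w l delta kappa omega).
Local Notation dE := (elastic_gradient dw l delta kappa omega).
Local Notation strain := (elastic_strain l delta omega).
Local Notation Q := (quadratic_coeff l delta kappa omega).
#[local] Opaque normsq elastic_energy elastic_gradient quadratic_coeff.

(* A sequence of vanishing strain only sees the energy [g0 * Q * normsq]. *)
Definition g0 : R := inf [set w x / x ^+ 2 | x in [set x : R | 0 < x]].

Lemma g0_lbound x : 0 < x -> g0 <= w x / x ^+ 2.
Proof.
move=> x0; apply: ge_inf; last by exists x.
by exists 0 => _ [y _ <-]; rewrite divr_ge0 ?(pot_ge0 Hw)// sqr_ge0.
Qed.

Lemma g0_lt x : 0 < x -> g0 < w x / x ^+ 2.
Proof.
move=> x0; have x2 : 0 < x / 2 by lra.
apply: (le_lt_trans (g0_lbound x2)); apply: (pot_superquadratic Hw).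
  by rewrite gt_eqF.
by rewrite !gtr0_norm//; lra.
Qed.

Lemma g0_approx e : 0 < e -> exists2 x, 0 < x & w x / x ^+ 2 < g0 + e.
Proof.
move=> e0.
have hi : has_inf [set w x / x ^+ 2 | x in [set x : R | 0 < x]].
  split; first by exists (w 1 / 1 ^+ 2), 1 => //=.
  by exists 0 => _ [y _ <-]; rewrite divr_ge0 ?(pot_ge0 Hw)// sqr_ge0.
by have [_ [x x0 <-] H] := inf_adherent e0 hi; exists x.
Qed.

Lemma strain_le_sup u (e : R) : sqint mu u -> (forall x, `|u x| <= e) ->
  forall p, `|strain u p| <= e * delta * omega1.
Proof.
move=> su ue p; have e0 : 0 <= e := le_trans (normr_ge0 _) (ue 0).
rewrite /elastic_strain normrM (gtr0_norm (omega_gt0 wt _)).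
apply: ler_pM => //; [exact/ltW/(omega_gt0 wt)| |exact: (wt_omega_le wt)].
have [i _ _] := D_cauchy_schwarz delta l0 p su.
apply: (le_trans (le_normr_Rintegral measurableT i)).
have kp : Rintegrable mu (fun y => ker l delta (p, y)).
  apply: ge0_Rintegrable.
  - by apply: measurableT_comp; [exact: measurable_ker|exact: pair1_measurable].
  - by move=> y; exact: ker_ge0.
  - by rewrite integral_ker// ltry.
apply: (@le_trans _ _ (\int[mu]_y (e * ker l delta (p, y)))).
  apply: le_Rintegral => //; [exact: Rintegrable_norm|exact: RintegrableZ|].
  by move=> y _; rewrite normrM (ger0_norm (ker_ge0 _ _ _)) ler_wpM2r ?ker_ge0.
rewrite RintegralZl// ler_wpM2l// /Rintegral integral_ker//.
exact: width_le.
Qed.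

Variable K : R.
Hypothesis K0 : 0 < K.

(** The inequality, unlike [E u = K], is preserved by [improvement]; equality is recovered for
    minimizers by [scale_down]. *)
Definition admissible u := sqint mu u /\ K <= E u.

Definition nstar : R := inf [set normsq u | u in admissible].

Lemma nstar_le u : admissible u -> nstar <= normsq u.
Proof.
move=> Su; apply: ge_inf; last by exists u.
by exists 0 => _ [v _ <-]; exact: normsq_ge0.
Qed.

Lemma normsq_gt0 u : sqint mu u -> 0 < E u -> 0 < normsq u.
Proof.
move=> su Eu; have [a /andP[a0 +] _] := improvement Hw wt su Eu.
by move=> /(lt_le_trans a0); rewrite pmulr_lgt0// invr_gt0.
Qed.

Lemma sqrt_ratio (x : R) : 0 < x -> x < K -> 1 < Num.sqrt (K / x) /\ Num.sqrt (K / x) ^+ 2 = K / x.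
Proof.
move=> x0 xK; split; last by rewrite sqr_sqrtr// divr_ge0// ltW.
by rewrite -[ltLHS]sqrtr1 ltr_sqrt ?divr_gt0// ltr_pdivlMr// mul1r.
Qed.

Lemma nstar_ge0 : 0 <= nstar.
Proof.
have [[x Sx]|nS] := pselect ([set normsq u | u in admissible] !=set0).
  apply: lb_le_inf; first by exists x.
  by move=> _ [v _ <-]; exact: normsq_ge0.
rewrite /nstar (_ : [set _ | _ in _] = set0) ?inf0//.
by apply/seteqP; split => // x Sx; apply: nS; exists x.
Qed.

(** Scaling by [t = sqrt (K / E u) > 1] brings the energy strictly above [K], so that a further
    factor [s < 1] still leaves an admissible function; its squared norm
    [s^2 * (K / E u) * normsq u] is at least [nstar]. *)
Lemma normsq_gt_ratio u : sqint mu u -> 0 < E u -> E u < K ->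
  E u / K * nstar < normsq u.
Proof.
move=> su E0 EK; have [t1 t2] := sqrt_ratio E0 EK.
set t := Num.sqrt _ in t1 t2.
have KE : K < E (fun y => t * u y).
  rewrite -[ltLHS](_ : t ^+ 2 * E u = K); last by rewrite t2 divfK// gt_eqF.
  exact: (E_scale_lt Hw wt).
have [s /andP[s0 s1] Ks] := scale_down Hw wt (sqintZ t su) K0 KE.
have := nstar_le (conj (sqintZ s (sqintZ t su)) Ks).
rewrite (normsqZ s (sqintZ t su)) normsqZ// t2 => H.
have n0 := normsq_gt0 su E0.
move: H E0 n0; move: (E u) (normsq u) => x n H x0 n0.
rewrite mulrAC ltr_pdivrMr//.
apply: (@le_lt_trans _ _ (x * (s ^+ 2 * (K / x * n)))); first by rewrite ler_pM2l.
rewrite (_ : x * _ = s ^+ 2 * (n * K)); last by field; rewrite gt_eqF.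
rewrite gtr_pMl; last by rewrite mulr_gt0.
by rewrite expr_lt1// ltW.
Qed.

(** The form for the remainders of the sequence, whose energy is known only from below and may
    exceed [K]. *)
Lemma normsq_ge_ratio u (c : R) : sqint mu u -> c <= E u -> c <= K ->
  c / K * nstar <= normsq u.
Proof.
move=> su cE cK; have n0 := nstar_ge0.
have [EK|KE] := ltP (E u) K; last first.
  apply: le_trans (nstar_le (conj su KE)).
  by clear KE cE; rewrite ler_piMl// ler_pdivrMr// mul1r.
have mono (x y : R) : x <= y -> x / K * nstar <= y / K * nstar.
  by move=> xy; rewrite ler_wpM2r// ler_pM2r// invr_gt0.
apply: (le_trans (mono _ _ cE)).
have [E0|E0] := eqVneq (E u) 0; first by rewrite E0 !mul0r normsq_ge0.
by apply/ltW/normsq_gt_ratio => //; rewrite lt_neqAle eq_sym E0 (E_ge0 Hw wt).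
Qed.

(* [g0 * Q * nstar < K] excludes vanishing; dichotomy is excluded by
   [normsq_gt_ratio] once the energy splits along the weak limit. *)
Hypothesis admissible_small : exists2 u, admissible u & g0 * Q * normsq u < K.

(** Each near-minimizer is replaced by the multiple of its gradient given by [improvement], which is
    bounded and Lipschitz, and is then translated so that a point where it is not small moves to
    0. *)
Lemma minimizing_sequence : exists (A B L e : R) (vn : nat -> R -> R),
  [/\ forall n, admissible (vn n), 0 < e,
      forall n, normsq (vn n) <= A /\ (forall x, `|vn n x| <= B),
      forall n x y, `|vn n x - vn n y| <= L * `|x - y| &
      (forall n, e <= `|vn n 0|) /\ (normsq (vn n) @[n --> \oo] --> nstar)].
Proof.
have [u0 S0 u0K] := admissible_small.
have hi : has_inf [set normsq u | u in admissible].
  split; first by exists (normsq u0), u0.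
  by exists 0 => _ [v _ <-]; exact: normsq_ge0.
have Q0 := Q_ge0 wt; have n0 := nstar_ge0.
have g00 : 0 <= g0.
  apply: lb_le_inf; first by exists (w 1 / 1 ^+ 2), 1 => //=.
  by move=> _ [y _ <-]; rewrite divr_ge0 ?(pot_ge0 Hw)// sqr_ge0.
have nK : g0 * (Q * nstar) < K.
  apply: le_lt_trans u0K; rewrite mulrA; apply: ler_wpM2l; first by rewrite mulr_ge0.
  exact: nstar_le.
have Qn0 : 0 <= Q * nstar by rewrite mulr_ge0.
(* The quotient at [M] is so close to its infimum [g0] that [nK] stays strict; the [+ 1] below
   allows for [Q * nstar = 0]. *)
have [M M0 HM] : exists2 M, 0 < M & w M / M ^+ 2 * (Q * nstar) < K.
  have e0 : 0 < (K - g0 * (Q * nstar)) / (Q * nstar + 1) by rewrite divr_gt0//; lra.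
  have [M M0 HM] := g0_approx e0; exists M => //.
  apply: (@le_lt_trans _ _ ((g0 + (K - g0 * (Q * nstar)) / (Q * nstar + 1)) * (Q * nstar))).
    by rewrite ler_wpM2r// ltW.
  rewrite mulrDl -ltrBrDl -mulrA gtr_pMr; last by lra.
  by rewrite mulrC ltr_pdivrMr; lra.
set g := w M / M ^+ 2 in HM.
have gM0 : 0 <= g by rewrite divr_ge0 ?(pot_ge0 Hw)// sqr_ge0.
(* The tolerance on the norm, small enough to keep the strict inequality [HMe]; being at most 1, it
   also keeps the sequence in the ball of [dE_bounds]. *)
pose eta := Num.min 1 ((K - g * (Q * nstar)) / (g * Q + 1)).
have gQ0 : 0 <= g * Q by rewrite mulr_ge0.
have eta0 : 0 < eta by rewrite lt_min ltr01 divr_gt0//; lra.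
have eta1 : eta <= 1 by rewrite ge_min lexx.
have HMe : g * (Q * (nstar + eta)) < K.
  have : eta <= (K - g * (Q * nstar)) / (g * Q + 1) by rewrite ge_min lexx orbT.
  rewrite ler_pdivlMr; last by lra.
  by move=> H; rewrite mulrDr mulrDr [g * (Q * eta)]mulrA; nra.
clearbody eta.
have o1 := omega1_gt0 wt.
(* A function bounded by [e] has strain at most [M / 2]. *)
pose e := M / (2 * delta * omega1).
have e0 : 0 < e by rewrite divr_gt0// !mulr_gt0.
have eM : e * delta * omega1 < M.
  have -> : e * delta * omega1 = M / 2 by rewrite /e; field; rewrite !gt_eqF.
  by rewrite ltr_pdivrMr// ltr_pMr// ltr1n.
have [C C0 HC] := dE_bounds Hw wt (nstar + 1).
(* Bounds the factor [a <= normsq u / E u] of the improvement step. *)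
pose A := (nstar + 1) / K.
have A0 : 0 <= A by rewrite divr_ge0// ?ltW//; lra.
have step n : exists v, [/\ admissible v, normsq v <= nstar + eta / n.+1%:R,
   (forall x, `|v x| <= A * C), (forall x y, `|v x - v y| <= A * C * `|x - y|) & e <= `|v 0|].
  have en0 : 0 < eta / n.+1%:R by rewrite divr_gt0.
  have en1 : eta / n.+1%:R <= eta.
    by rewrite ler_pdivrMr// ler_peMr ?ler1n// ltW.
  have [_ [u [su uK] <-] un] := inf_adherent en0 hi; rewrite -/nstar in un.
  have E0 : 0 < E u := lt_le_trans K0 uK.
  have [a /andP[a0 aA] [nv Ev _]] := improvement Hw wt su E0.
  have un' : normsq u <= nstar + eta.
    by apply: (le_trans (ltW un)); rewrite lerD2l.
  have uN : normsq u <= nstar + 1.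
    by apply: (le_trans un'); rewrite lerD2l.
  have aA' : a <= A.
    apply: (le_trans aA); rewrite ler_pdivrMr; last exact: E0.
    rewrite /A mulrAC ler_pdivlMr; last exact: K0.
    by apply: ler_pM; [exact: normsq_ge0|exact: ltW|exact: uN|exact: uK].
  have [G1 G2] := HC u su uN.
  pose v y := a * dE u y.
  have sv : sqint mu v by exact/sqintZ/(sqint_dE Hw wt).
  have vB x : `|v x| <= A * C.
    by rewrite normrM (gtr0_norm a0); apply: ler_pM => //; exact: ltW.
  have vd (x : R) : is_derive x 1 v (a * ddE dw l delta kappa omega u x).
    have d := is_derive_dE Hw wt x su.
    exact: is_deriveZ.
  have vL x y : `|v x - v y| <= A * C * `|x - y|.
    apply: (is_derive_lipschitz vd) => c _; rewrite normrM (gtr0_norm a0).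
    by apply: ler_pM => //; exact: ltW.
  (* Otherwise all strains are below [M], and [E_le_small] gives
     [K <= E v <= g * (Q * (nstar + eta)) < K]. *)
  have [x vx] : exists x, e <= `|v x|.
    apply: contrapT => nx.
    have ve x : `|v x| <= e.
      by rewrite leNgt; apply/negP => ex; apply: nx; exists x; exact: ltW.
    have st p : `|strain v p| < M.
      exact: le_lt_trans (strain_le_sup sv ve p) eM.
    have := E_le_small Hw wt sv M0 st; rewrite -/g nv => H.
    have H2 : g * (Q * normsq u) <= g * (Q * (nstar + eta)).
      by apply: ler_wpM2l => //; exact: ler_wpM2l.
    have := le_lt_trans (le_trans (le_trans (le_trans uK Ev) H) H2) HMe.
    by rewrite ltxx.
  exists (fun y => v (y + x)); split.
  - split; first exact: sqint_shift.
    rewrite (E_shift Hw wt x sv); exact: le_trans uK Ev.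
  - by rewrite normsq_shift; [rewrite nv; exact: ltW|exact: sqint_measurable sv].
  - by move=> y; exact: vB.
  - by move=> y z; apply: le_trans (vL _ _) _; rewrite opprD addrACA subrr addr0.
  - by rewrite add0r.
have [vn vnP] := choice step.
exists (nstar + eta), (A * C), (A * C), e, vn; split.
- by move=> n; case: (vnP n).
- exact: e0.
- move=> n; have [_ H ? _ _] := vnP n; split => //; apply: (le_trans H).
  by rewrite lerD2l ler_pdivrMr// ler_peMr ?ler1n// ltW.
- by move=> n; case: (vnP n).
- split; first by move=> n; case: (vnP n).
  apply: (@squeeze_cvgr _ _ _ _ (fun=> nstar) (fun n => nstar + eta / n.+1%:R)).
  + apply: nearW => n; have [Sv -> _ _ _] := vnP n; rewrite andbT; exact: nstar_le.
  + exact: cvg_cst.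
  + rewrite -[X in _ --> X]addr0; apply: cvgD; first exact: cvg_cst.
    rewrite -(mulr0 eta); apply: cvgM; first exact: cvg_cst.
    exact: cvg_harmonic.
Qed.

(** If the limit has energy at least [K], it is a minimizer by lower semicontinuity of the norm.
    Otherwise energy and norm split between the limit and the remainder, against the strict
    inequality of [normsq_gt_ratio]. *)
Lemma minimizer_exists : exists2 u, admissible u & normsq u = nstar.
Proof.
have [A [B [L [e [vn [Sv e0 vAB vL [ve vn0]]]]]]] := minimizing_sequence.
have [phi [phi_ge [u vu]]] := lipschitz_subsequence (fun n => (vAB n).2) vL.
pose un j := vn (phi j).
have sun j : sqint mu (un j) := (Sv (phi j)).1.
have unA j : normsq (un j) <= A := (vAB (phi j)).1.
have unB j x : `|un j x| <= B := (vAB (phi j)).2 x.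
have unn : normsq (un j) @[j --> \oo] --> nstar.
  apply: (cvg_comp phi (fun n => normsq (vn n)) _ vn0).
  move=> P [m _ Hm]; exists m => // j /= mj; apply: Hm => /=.
  exact: leq_trans (phi_ge j).
have su := sqint_lim sun unA vu.
have uL x y : `|u x - u y| <= L * `|x - y|.
  have c : `|un j x - un j y| @[j --> \oo] --> `|u x - u y|.
    by apply: cvg_norm; apply: cvgB; exact: vu.
  by apply: (cvgr_to_le c); apply: nearW => j; exact: vL.
have cu : continuous u.
  apply: lipschitz_continuous => M; exists `|L| => // x y _ _.
  by apply: (le_trans (uL x y)); rewrite ler_wpM2r// ler_norm.
have u0 : e <= `|u 0|.
  have c : `|un j 0| @[j --> \oo] --> `|u 0| by apply: cvg_norm; exact: vu.
  by apply: (cvgr_to_ge c); apply: nearW => j; exact: ve.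
have nsplit := normsq_split sun unA vu.
have Esplit := E_split Hw wt sun unA unB vu.
have unK j : K <= E (un j) := (Sv (phi j)).2.
(* Eventually the remainder has energy at least [c], hence squared norm at least [c / K * nstar],
   and the limit is left with the rest. *)
have u_le c : c <= K -> E u < K - c -> normsq u <= nstar - c / K * nstar.
  move=> cK Ec.
  have arith (x y : R) : K <= x -> x - y < K - c -> c <= y by lra.
  apply: (ler_cvg_to nsplit (cvgB unn (cvg_cst (c / K * nstar)))).
  near=> j; rewrite lerD2l lerN2; apply: normsq_ge_ratio => //; first exact: sqintB.
  apply: arith (unK j) _.
  near: j; exact: (cvgr_lt _ Esplit _ Ec).
have nu_le : normsq u <= nstar.
  apply: (ler_cvg_to nsplit unn); apply: nearW => j.
  by rewrite gerBl normsq_ge0.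
have [KE|EK] := leP K (E u).
  by exists u => //; apply/eqP; rewrite eq_le nu_le (nstar_le (conj su KE)).
exfalso.
(* When [E u = 0] the strictness comes from nonvanishing: [u] is continuous and [|u 0| >= e], so its
   norm is positive. *)
have H : E u / K * nstar < normsq u.
  have [E0|E0] := eqVneq (E u) 0; last first.
    by apply: normsq_gt_ratio => //; rewrite lt_neqAle eq_sym E0 (E_ge0 Hw wt).
  rewrite E0 !mul0r ltNge; apply/negP => nu0.
  have := continuous_normsq_eq0 cu su nu0 0 => u00.
  by move: u0; rewrite u00 normr0 leNgt e0.
have n0 := nstar_ge0.
(* [e'] is chosen so that the upper bound from [u_le] at [c = K - x - e'] exceeds [x / K * nstar] by
   at most half of the gap to [n]. *)
have arith (x n : R) : x / K * nstar < n ->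
    exists2 e', 0 < e' & ~ (n <= nstar - (K - x - e') / K * nstar).
  move=> xn; exists ((n - x / K * nstar) * K / (2 * (nstar + 1))).
    by rewrite divr_gt0//; [rewrite mulr_gt0// subr_gt0|lra].
  rewrite (_ : nstar - _ = x / K * nstar + (n - x / K * nstar) / 2 * (nstar / (nstar + 1))).
    have : nstar / (nstar + 1) <= 1 by rewrite ler_pdivrMr; lra.
    have : 0 <= nstar / (nstar + 1) by rewrite divr_ge0//; lra.
    move: xn; move: (x / K * nstar) (nstar / (nstar + 1)) => a b; nra.
  by field; apply/andP; split; [lra|rewrite gt_eqF].
have [e' e'0] := arith _ _ H; apply.
apply: u_le; have := E_ge0 Hw wt u; move: (E u) => x; lra.
Unshelve. all: by end_near. Qed.

End minimizer.

(** * Energy of long plateaus, and the equation satisfied by minimizers *)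

Section critical_minimizer.
Context (R : realType) (w dw : R -> R) (Hw : potential w dw).
Notation RT := (measurableTypeR R).
Notation mu := (@lebesgue_measure R).
Notation nu := (@plane_measure R).
Context (l delta : R) (kappa omega : R -> R) (kappa1 omega0 omega1 : R).
Hypothesis wt : weights l delta kappa omega kappa1 omega0 omega1.
Implicit Types (u v : R -> R).

Let l0 : 0 < l := wt_l0 wt.
Let ld : l < delta := wt_ld wt.
Let delta0 : 0 < delta := lt_trans l0 ld.
Local Notation E := (elastic_energy w l delta kappa omega).
Local Notation dE := (elastic_gradient dw l delta kappa omega).
Local Notation strain := (elastic_strain l delta omega).
Local Notation density := (elastic_density w l delta kappa omega).
Local Notation Q := (quadratic_coeff l delta kappa omega).
Local Notation ns := (nstar w l delta kappa omega).
Local Notation adm := (admissible w l delta kappa omega).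

Let quad xi : R := kappa xi * omega xi ^+ 2 * width l delta xi ^+ 2.

Lemma quad_ge0 xi : 0 <= quad xi.
Proof.
by apply: mulr_ge0; [apply: mulr_ge0; [exact: wt_kappa_ge0 wt xi|exact: sqr_ge0]|exact: sqr_ge0].
Qed.

Lemma measurable_quad : measurable_fun [set: RT] quad.
Proof.
apply: measurable_funM; last by apply: measurable_funX; exact: measurable_width.
by apply: measurable_funM; [exact: wt_mkappa wt|apply: measurable_funX; exact: wt_momega wt].
Qed.

Lemma Rintegrable_quad : Rintegrable mu quad.
Proof.
have o1 := omega1_gt0 wt.
apply: (Rintegrable_bounded_support ld (M := kappa1 * omega1 ^+ 2 * delta ^+ 2) measurable_quad).
  move=> xi; rewrite ger0_norm ?quad_ge0//; apply: ler_pM.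
  - by apply: mulr_ge0; [exact: wt_kappa_ge0 wt xi|exact: sqr_ge0].
  - exact: sqr_ge0.
  - apply: ler_pM; [exact: wt_kappa_ge0 wt xi|exact: sqr_ge0|exact: wt_kappa_le wt xi|].
    by rewrite ler_sqr ?nnegrE ?(wt_omega_le wt)//; [exact/ltW/(omega_gt0 wt)|exact: ltW].
  - by rewrite ler_sqr ?nnegrE ?width_le ?width_ge0// ltW.
by move=> xi /width_out xi0; rewrite /quad xi0 expr0n/= mulr0.
Qed.

Lemma quadratic_coeff_gt0 (kappa0 : R) : 0 < kappa0 ->
  (forall xi, xi \in `[l, delta]%R -> kappa0 <= kappa xi) -> 0 < Q.
Proof.
move=> k0 Hk; have o0 := wt_omega0 wt.
have c0 : 0 < kappa0 * omega0 ^+ 2 * l ^+ 2 by rewrite !mulr_gt0// exprn_gt0.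
apply: (@lt_le_trans _ _ (\int[mu]_xi (kappa0 * omega0 ^+ 2 * l ^+ 2 * \1_`[l, delta] xi))).
  rewrite RintegralZl//; last exact: integrable_indic_itv.
  by rewrite mulr_gt0// /Rintegral integral_indic_itv ?(ltW ld)//= subr_gt0.
apply: le_Rintegral => //.
- by apply: RintegrableZ; exact: integrable_indic_itv.
- exact: Rintegrable_quad.
- move=> xi _; rewrite indicE mem_setE; case: (boolP (_ \in _)) => xil; last first.
    by rewrite mulr0 quad_ge0.
  have lx : l <= xi by rewrite (itvP xil).
  rewrite mulr1 /quad (_ : width l delta xi = xi); last by rewrite /width indicE mem_setE xil mulr1.
  apply: ler_pM; [|exact: sqr_ge0| |].
  - by rewrite mulr_ge0 ?sqr_ge0// ltW.
  - apply: ler_pM; [exact: ltW|exact: sqr_ge0|exact: Hk|].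
    by rewrite ler_sqr ?nnegrE ?(wt_omega_ge wt)//; [exact: ltW|exact/ltW/(omega_gt0 wt)].
  - by rewrite ler_sqr ?nnegrE// ltW// (lt_le_trans l0).
Qed.

Lemma E_fubini u : sqint mu u ->
  ((E u)%:E = \int[mu]_z \int[mu]_xi (density u (z, xi))%:E)%E.
Proof.
move=> su; rewrite -(integral_EFin (Rintegrable_density Hw wt su)).
rewrite /plane_measure fubini_tonelli1//.
- by apply/measurable_EFinP; exact: (measurable_density Hw wt su.1).
- by move=> p; rewrite lee_fin (density_ge0 Hw wt).
Qed.

Section indicator_energy.
Variable N : R.
Hypothesis Nd : delta < N.
Let u1 : R -> R := \1_`[0, N].

Lemma sqint_indic : sqint mu u1.
Proof.
split; first exact: measurable_indic.
rewrite (_ : (fun x => u1 x ^+ 2) = u1); first exact: integrable_indic_itv.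
by apply/funext => x; rewrite /u1 indicE; case: (_ \in _); rewrite ?expr1n ?expr0n.
Qed.

Lemma normsq_indic : normsq u1 = N.
Proof.
rewrite /normsq /Rintegral (_ : (fun x => (u1 x ^+ 2)%:E) = (fun x => (u1 x)%:E)).
  by rewrite integral_indic_itv /= ?subr0//; exact: ltW (lt_trans delta0 Nd).
by apply/funext => x; rewrite /u1 indicE; case: (_ \in _); rewrite ?expr1n ?expr0n.
Qed.

(** A window that starts in [[0, N - delta]] stays inside [[0, N]]. *)
Lemma D_indic z xi : z \in `[0, N - delta]%R -> D l delta u1 (z, xi) = width l delta xi.
Proof.
rewrite in_itv/= => /andP[z0 zN].
have [xil|xil] := boolP (xi \in `[l, delta]%R); last by rewrite D_out// width_out.
have xid : xi <= delta by rewrite (itvP xil).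
rewrite /D (_ : (fun y => _) = fun y => ker l delta (z, xi, y)).
  by rewrite /Rintegral integral_ker.
apply/funext => y; rewrite kerE /= [\1_`[z, _] y]indicE mem_setE in_itv/=.
case: (boolP (_ && _)) => [/andP[zy yz]|]; last by rewrite !mulr0.
rewrite /u1 indicE mem_setE in_itv/= (_ : _ && _ = true) ?mul1r//.
by apply/andP; split; lra.
Qed.

(** On those windows the strain [xi * omega xi] is at least [l * omega0], where the quotient
    [w x / x^2] has already reached its value at [l * omega0]. *)
Lemma E_indic_ge : w (l * omega0) / (l * omega0) ^+ 2 * Q * (N - delta) <= E u1.
Proof.
set g1 := w _ / _.
have o0 := wt_omega0 wt.
have g10 : 0 <= g1 by rewrite divr_ge0 ?(pot_ge0 Hw)// sqr_ge0.
rewrite -lee_fin (E_fubini sqint_indic).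
have md : measurable_fun [set: RT * RT] (density u1) := measurable_density Hw wt sqint_indic.1.
have pt z xi : z \in `[0, N - delta]%R ->
    g1 * quad xi <= density u1 (z, xi).
  move=> zN; rewrite /elastic_density /elastic_strain D_indic//= /quad.
  have [xil|xil] := boolP (xi \in `[l, delta]%R); last first.
    by rewrite (wt_kappa_out wt xil) !mul0r !mulr0.
  have wE : width l delta xi = xi by rewrite /width indicE mem_setE xil mulr1.
  rewrite !wE (_ : _ * _ = (g1 * (xi * omega xi) ^+ 2) * kappa xi); last by ring.
  rewrite ler_wpM2r ?(wt_kappa_ge0 wt)//.
  have s0 : 0 < l * omega0 by rewrite mulr_gt0.
  have sx : l * omega0 <= xi * omega xi.
    by apply: ler_pM; [exact: ltW|exact: ltW|rewrite (itvP xil)|exact: wt_omega_ge wt xi].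
  rewrite -ler_pdivlMr; last by rewrite exprn_gt0// (lt_le_trans s0 sx).
  move: sx; rewrite le_eqVlt => /predU1P[<-//|sx].
  by apply/ltW/(pot_superquadratic Hw); rewrite ?gt_eqF// !gtr0_norm// (lt_trans s0).
have inner z : z \in `[0, N - delta]%R ->
    ((g1 * Q)%:E <= \int[mu]_xi (density u1 (z, xi))%:E)%E.
  move=> zN.
  rewrite EFinM /quadratic_coeff -(integral_EFin Rintegrable_quad) -ge0_integralZl//; first last.
  - by move=> xi _; rewrite lee_fin quad_ge0.
  - by apply/measurable_EFinP; exact: measurable_quad.
  apply: ge0_le_integral => //.
  - by move=> xi _; rewrite lee_fin; apply: mulr_ge0 => //; exact: quad_ge0.
  - by apply/measurable_EFinP; apply: measurable_funM => //; exact: measurable_quad.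
  - by apply/measurable_EFinP; apply: (measurableT_comp md); exact: pair1_measurable.
  - by move=> xi _; rewrite -EFinM lee_fin; exact: pt.
have Nd0 : 0 <= N - delta by rewrite subr_ge0 ltW.
apply: (@le_trans _ _ (\int[mu]_z (g1 * Q * \1_`[0, (N - delta)] z)%:E)%E).
  under eq_integral do rewrite EFinM.
  rewrite ge0_integralZl//; first last.
  - by rewrite lee_fin mulr_ge0// (Q_ge0 wt).
  - by apply/measurable_EFinP.
  by rewrite integral_indic_itv// subr0 EFinM.
apply: ge0_le_integral => //.
- by move=> z _; rewrite lee_fin; apply: mulr_ge0 => //; apply: mulr_ge0 => //; exact: (Q_ge0 wt).
- by apply/measurable_EFinP; apply: measurable_funM.
- apply: (@measurable_fun_fubini_tonelli_F _ _ _ _ _ mu (fun z => (density u1 z)%:E)).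
    exact/measurable_EFinP.
  by move=> p; rewrite lee_fin (density_ge0 Hw wt).
- move=> z _; rewrite indicE mem_setE; case: (boolP (_ \in _)) => zN.
    by rewrite mulr1; exact: inner.
  by rewrite mulr0 integral_ge0// => xi _; rewrite lee_fin (density_ge0 Hw wt).
Qed.

End indicator_energy.

Lemma g0_ge0 : 0 <= g0 w.
Proof.
apply: lb_le_inf; first by exists (w 1 / 1 ^+ 2), 1 => //=.
by move=> _ [x _ <-]; rewrite divr_ge0 ?(pot_ge0 Hw)// sqr_ge0.
Qed.

(* The indicator function of a long interval has strain bounded away from 0 on
   most of it, hence more energy than its quadratic part. *)
Lemma admissible_small_large (kappa0 : R) : 0 < kappa0 ->
  (forall xi, xi \in `[l, delta]%R -> kappa0 <= kappa xi) ->
  exists2 K0, 0 <= K0 & forall K, K0 < K ->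
    exists2 u, adm K u & g0 w * Q * normsq u < K.
Proof.
move=> k0 Hk; have o0 := wt_omega0 wt.
have s0 : 0 < l * omega0 by rewrite mulr_gt0.
have g01 := g0_lt Hw s0; have gg := g0_ge0.
have := E_indic_ge; set g1 := w _ / _ in g01 * => Hg.
have Q0 := quadratic_coeff_gt0 k0 Hk.
have g10 : 0 < g1 - g0 w by rewrite subr_gt0.
have gd : 0 <= g1 * delta / (g1 - g0 w).
  by rewrite divr_ge0 ?ltW// mulr_gt0// (le_lt_trans gg).
(* Makes the surplus [g1 * (N - delta) - g0 * N] equal to [(g1 - g0) * (1 + delta) > 0]: the gain in
   the quotient outweighs the loss at the end of the interval. *)
pose N := g1 * delta / (g1 - g0 w) + 1 + delta.
have Nd : delta < N by rewrite /N; lra.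
have NE : g0 w * N < g1 * (N - delta).
  have : (g1 - g0 w) * N = g1 * delta + (g1 - g0 w) * (1 + delta).
    by rewrite /N; field; rewrite gt_eqF.
  have : 0 < (g1 - g0 w) * (1 + delta) by rewrite mulr_gt0// addr_gt0.
  lra.
have := Hg N Nd; set u1 := \1_`[0, N] => HE.
have E0 : 0 < E u1.
  apply: lt_le_trans HE; rewrite mulr_gt0 ?subr_gt0// mulr_gt0// (le_lt_trans gg)//.
exists (E u1); first exact: ltW.
(* Scaling by [sqrt (K / E u1)] brings the energy to at least [K] and multiplies [normsq] by
   [K / E u1], which preserves the strict inequality. *)
move=> K KE; have [t1 t2] := sqrt_ratio (lt_trans E0 KE) E0 KE.
exists (fun y => Num.sqrt (K / E u1) * u1 y).
  split; first exact: sqintZ (sqint_indic N).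
  apply: le_trans (E_scale Hw wt (sqint_indic N) (ltW t1)).
  by rewrite t2 divfK// gt_eqF.
rewrite normsqZ ?normsq_indic ?t2//; last exact: sqint_indic.
rewrite mulrCA -[ltRHS](@divfK _ (E u1)); last by rewrite gt_eqF.
rewrite ltr_pM2l; last exact: divr_gt0 (lt_trans E0 KE) E0.
apply: lt_le_trans HE.
by rewrite mulrAC [ltRHS]mulrAC ltr_pM2r.
Qed.

#[local] Opaque elastic_energy elastic_gradient quadratic_coeff.

(* A minimizer is a multiple of its own gradient only almost everywhere; that
   multiple is a continuous minimizer, for which the equation holds everywhere. *)
Lemma minimizer_critical (K : R) v : 0 < K -> adm K v -> normsq v = ns K ->
  exists u a, [/\ sqint mu u, continuous u, normsq u = ns K, E u = K &
    0 < a /\ forall y, u y = a * dE u y].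
Proof.
move=> K0 Av nv.
have step u : adm K u -> normsq u = ns K -> exists2 a, 0 < a &
    [/\ adm K (fun y => a * dE u y), normsq (fun y => a * dE u y) = ns K, E u = K &
      normsq (fun y => u y - a * dE u y) = 0].
  (* With energy above [K] a minimizer could be multiplied by some [t < 1] and stay admissible with
     a smaller norm. *)
  have EK v' : adm K v' -> normsq v' = ns K -> E v' = K.
    move=> [sv' KE'] nv'; apply/eqP; rewrite eq_le KE' andbT leNgt; apply/negP => KE.
    have [t /andP[t0 t1] Kt] := scale_down Hw wt sv' K0 KE.
    have := nstar_le (conj (sqintZ t sv') Kt); rewrite normsqZ// -nv'.
    have := normsq_gt0 Hw wt sv' (lt_le_trans K0 KE'); move: (normsq v') => n n0.
    rewrite -[leLHS]mul1r ler_pM2r// leNgt => /negP; apply.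
    by rewrite expr_lt1// ltW.
  move=> Au nu; have [su KE] := Au.
  have [a /andP[a0 _] [n1 E1 key]] := improvement Hw wt su (lt_le_trans K0 KE).
  have Aa : adm K (fun y => a * dE u y).
    by split; [exact: sqintZ (sqint_dE Hw wt su)|exact: le_trans E1].
  have na : normsq (fun y => a * dE u y) = ns K by rewrite n1.
  exists a => //; split => //; first exact: EK.
  (* [u] and its improvement are both minimizers and have energy exactly [K], so the gain in [key]
     must vanish. *)
  move: key; rewrite (EK _ Aa na) (EK _ Au nu) -/(normsq (fun y => u y - a * dE u y)).
  have := normsq_ge0 (fun y => u y - a * dE u y); move: (normsq _) => n n0 H.
  apply/eqP; rewrite eq_le n0 andbT -(pmulr_rle0 _ (_ : 0 < (2 * a)^-1)).
    by move: ((2 * a)^-1 * n) H => x; lra.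
  by rewrite invr_gt0 mulr_gt0.
have cdE a u : sqint mu u -> continuous (fun y => a * dE u y).
  move=> su y; apply: cvgM; first exact: cvg_cst.
  exact: (@is_derive_continuous _ _ _ (fun x : R => is_derive_dE Hw wt x su)).
have [a _ [A1 n1 _ _]] := step v Av nv.
move: (fun y => a * dE v y) (cdE a v Av.1) A1 n1 => u cu A1 n1.
have [b b0 [A2 _ E2 z]] := step u A1 n1.
exists u, b; split; [exact: A1.1|exact: cu|exact: n1|exact: E2|split; first exact: b0].
move=> y; apply/eqP; rewrite -subr_eq0; apply/eqP.
apply: (@continuous_normsq_eq0 _ (fun y => u y - b * dE u y)).
- by move=> x; apply: cvgB; [exact: cu|exact: (cdE b u A1.1)].
- exact: sqintB A1.1 A2.1.
- by rewrite z.
Qed.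

End critical_minimizer.

(** * Smooth cutoffs *)

Section smooth_functions.
Context (R : realType).
Implicit Types f g : R -> R.

Fixpoint diffn (n : nat) f : Prop :=
  (forall x : R, derivable f x 1) /\ if n is m.+1 then diffn m f^`() else True.

Lemma diffn_derivable n f : diffn n f -> forall x : R, derivable f x 1.
Proof. by case: n => [|n] []. Qed.

Lemma diffn_pred n f : diffn n.+1 f -> diffn n f.
Proof. by elim: n f => [|n IH] f [fd] => [_|df']; split => //; exact: IH. Qed.

Lemma derivable_is_derive f (x : R) : derivable f x 1 -> is_derive x 1 f (f^`() x).
Proof. by move=> fx; exact: DeriveDef fx (esym (derive1E f x)). Qed.

Lemma is_derive_derive1 f f' : (forall x : R, is_derive x 1 f (f' x)) -> f^`() = f'.
Proof. by move=> fd; apply/funext => x; rewrite derive1E; case: (fd x). Qed.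

Lemma diffn_is_derive n f (x : R) : diffn n f -> is_derive x 1 f (f^`() x).
Proof. by move=> fn; exact: (derivable_is_derive (@diffn_derivable n f fn x)). Qed.

Lemma diffnD n f g : diffn n f -> diffn n g -> diffn n (fun x => f x + g x).
Proof.
elim: n f g => [|n IH] f g [fd f'] [gd g'].
  by split => [x|]; [exact: derivableD (fd x) (gd x)|].
split => [x|]; first exact: derivableD (fd x) (gd x).
rewrite (_ : (fun x => f x + g x)^`() = fun x => f^`() x + g^`() x); first exact: IH.
by apply: is_derive_derive1 => x; apply: is_deriveD; exact: derivable_is_derive.
Qed.

Lemma diffnM n f g : diffn n f -> diffn n g -> diffn n (fun x => f x * g x).
Proof.
elim: n f g => [|n IH] f g Hf Hg; have [fd f'] := Hf; have [gd g'] := Hg.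
  by split => [x|]; [exact: derivableM (fd x) (gd x)|].
split => [x|]; first exact: derivableM (fd x) (gd x).
rewrite (_ : (fun x => f x * g x)^`() = fun x => f x * g^`() x + g x * f^`() x).
  by apply: diffnD; apply: IH => //; exact: diffn_pred.
apply: is_derive_derive1 => x.
exact: (is_deriveM (derivable_is_derive (fd x)) (derivable_is_derive (gd x))).
Qed.

Lemma diffn_cst n (c : R) : diffn n (fun=> c).
Proof.
elim: n c => [|n IH] c; first by split => // x; exact: derivable_cst.
split => [x|]; first exact: derivable_cst.
rewrite (is_derive_derive1 (fun x => is_derive_cst c x 1)).
exact: IH.
Qed.

Lemma is_derive_affine f f' (a b : R) (x : R) : (forall x : R, is_derive x 1 f (f' x)) ->
  is_derive x 1 (fun x => f (a * x + b)) (f' (a * x + b) * a).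
Proof.
move=> fd; apply: (@is_derive1_comp R f (fun x => a * x + b) x _ _ (fd _)).
have := is_deriveD (is_deriveM (is_derive_cst a x 1) (is_derive_id x 1)) (is_derive_cst b x 1).
by rewrite /= scaler0 addr0 addr0 /GRing.scale /= mulr1.
Qed.

Lemma diffn_affine n f (a b : R) : diffn n f -> diffn n (fun x => f (a * x + b)).
Proof.
elim: n f => [|n IH] f Hf; have fd (x : R) := diffn_is_derive x Hf.
  by split => // x; case: (is_derive_affine a b x fd).
split => [x|]; first by case: (is_derive_affine a b x fd).
rewrite (is_derive_derive1 (fun x => is_derive_affine a b x fd)).
by apply: diffnM; [apply: IH; case: Hf|exact: diffn_cst].
Qed.

Lemma diffn_derive1n f : (forall n, diffn n f) -> forall n (x : R), derivable f^`(n) x 1.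
Proof.
move=> fn n; elim: n f fn => [|n IH] f fn x; first exact: diffn_derivable (fn 0%N) x.
rewrite derive1Sn.
by apply: IH => m; case: (fn m.+1).
Qed.

(** Write [t^n = n^n (t / n)^n] and bound [t / n] by [expR (t / n)]. *)
Lemma exprn_le_expR (n : nat) (t : R) : 0 <= t -> t ^+ n <= n%:R ^+ n * expR t.
Proof.
move=> t0; case: n => [|n]; first by rewrite !expr0 mul1r (le_trans _ (expR_ge1Dx _))// lerDl.
have n0 : 0 < n.+1%:R :> R by [].
rewrite -ler_pdivrMl ?exprn_gt0// mulrC -exprVn -exprMn.
apply: (@le_trans _ _ (expR (t / n.+1%:R) ^+ n.+1)).
  apply: lerXn2r; rewrite ?nnegrE ?expR_ge0 ?divr_ge0//.
  by apply: le_trans (expR_ge1Dx _); rewrite lerDr.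
by rewrite -expRM_natl mulrC divfK// gt_eqF.
Qed.

Lemma poly_le_expR (p : {poly R}) : exists2 C, 0 <= C & forall t, 0 <= t ->
  `|p.[t]| <= C * expR t.
Proof.
exists (\sum_(i < size p) `|p`_i| * i%:R ^+ i).
  by apply: sumr_ge0 => i _; rewrite mulr_ge0// exprn_ge0.
move=> t t0; rewrite horner_coef mulr_suml (le_trans (ler_norm_sum _ _ _))//.
apply: ler_sum => i _; rewrite normrM normrX (ger0_norm t0) -mulrA.
by rewrite ler_wpM2l// exprn_le_expR.
Qed.

(** The functions [p(1/x) exp(-1/x)], extended by 0: a family stable under differentiation, [p]
    being replaced by [X^2 (p - p')], so that smoothness of [exp(-1/x)] follows by induction. *)
Definition flat (p : {poly R}) (x : R) : R :=
  if 0 < x then p.[x^-1] * expR (- x^-1) else 0.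

Lemma is_derive_flat (p : {poly R}) (x : R) :
  is_derive x 1 (flat p) (flat ('X^2 * (p - deriv p)) x).
Proof.
have [x0|x0|->] := ltgtP x 0.
- rewrite /flat ltNge (ltW x0)/=.
  apply: (@near_is_derive R (fun=> 0)).
    by near=> y; rewrite ltNge ltW//=; near: y; exact: lt_nbhsl.
- rewrite {2}/flat x0.
  apply: (@near_is_derive _ (fun x => p.[x^-1] * expR (- x^-1))).
    by near=> y; rewrite /flat ifT//; near: y; exact: lt_nbhsr.
  have dV : is_derive x 1 (fun y : R => y^-1) (- x ^- 2).
    have := @is_deriveV R id x 1 1 _ (is_derive_id x 1).
    by rewrite /GRing.scale /= mulr1; apply; rewrite gt_eqF.
  have dp : is_derive x 1 (fun y => p.[y^-1]) ((deriv p).[x^-1] * - x ^- 2).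
    apply: (@is_derive1_comp _ (fun y => p.[y]) (fun y => y^-1)) => //.
    exact: is_derive_poly.
  have de : is_derive x 1 (fun y => expR (- y^-1)) (expR (- x^-1) * x ^- 2).
    apply: (@is_derive1_comp _ expR (fun y => - y^-1)).
    by rewrite -[X in is_derive _ _ _ X]opprK; apply: is_deriveN.
  have := is_deriveM dp de.
  rewrite /GRing.scale /= => d.
  rewrite (_ : ('X^2 * (p - deriv p)).[x^-1] * expR (- x^-1) = p.[x^-1] * (expR (- x^-1) / x ^+ 2) +
    expR (- x^-1) * ((deriv p).[x^-1] * - x ^- 2)); first exact: d.
  by rewrite hornerM hornerXn hornerD hornerN exprVn; ring.
(* The factor [X^2] yields [|flat p h| <= C h^2], so the difference quotients at 0 tend to 0. *)
- have [C C0 HC] := poly_le_expR (p * 'X^2).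
  have flat_le h : `|flat p h| <= C * h ^+ 2.
    rewrite /flat; case: ltP => h0; last by rewrite normr0 mulr_ge0// sqr_ge0.
    rewrite normrM (ger0_norm (expR_ge0 _)) expRN ler_pdivrMr ?expR_gt0//.
    have := HC h^-1; rewrite invr_ge0 => /(_ (ltW h0)).
    rewrite hornerM hornerXn normrM (ger0_norm (sqr_ge0 _)) exprVn.
    rewrite ler_pdivrMr ?exprn_gt0//; lra.
  rewrite {2}/flat ltxx.
  suff F : h^-1 *: (flat p (h *: (1:R) + 0) - flat p 0) @[h --> 0^'] --> (0 : R).
    by apply: DeriveDef; [apply/cvg_ex; exists 0|apply: cvg_lim].
  apply/cvgrPdist_lt => e e0; near=> h.
  have h0 : h != 0 by near: h; exact: nbhs_dnbhs_neq.
  rewrite {2}/flat ltxx subr0 addr0 sub0r normrN /GRing.scale /= mulr1.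
  rewrite normrM normfV ltr_pdivrMl ?normr_gt0// (le_lt_trans (flat_le _))//.
  have hC : `|h| * (C + 1) < e.
    rewrite -ltr_pdivlMr; last by rewrite ltr_wpDl.
    near: h; apply: dnbhs0_lt; rewrite divr_gt0// ltr_wpDl//.
  rewrite -[h ^+ 2]real_normK ?num_real// expr2 mulrCA ltr_pM2l ?normr_gt0//.
  have := normr_ge0 h; lra.
Unshelve. all: by end_near. Qed.

Lemma diffn_flat n (p : {poly R}) : diffn n (flat p).
Proof.
elim: n p => [|n IH] p; split => //; try by move=> x; case: (is_derive_flat p x).
by rewrite (is_derive_derive1 (is_derive_flat p)).
Qed.

Lemma diffn_prim n f : diffn n f -> diffn n.+1 (prim f).
Proof.
move=> fn; have cf : continuous f.
  exact: (@is_derive_continuous _ f _ (fun x : R => diffn_is_derive x fn)).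
have d (x : R) := is_derive_prim x cf.
by split => [x|]; [case: (d x)|rewrite (is_derive_derive1 d)].
Qed.

Definition bump (x : R) : R := flat 1 x * flat 1 (1 - x).

Lemma diffn_bump n : diffn n bump.
Proof.
apply: diffnM; first exact: diffn_flat.
rewrite (_ : (fun x => _) = fun x => flat 1 (-1 * x + 1)).
  by apply: diffn_affine; exact: diffn_flat.
by apply/funext => x; congr flat; ring.
Qed.

Lemma bump_ge0 x : 0 <= bump x.
Proof.
by rewrite /bump /flat !hornerE; do 2 case: ifP => _; rewrite ?mulr0 ?mul0r// !mul1r mulr_ge0// expR_ge0.
Qed.

Lemma bump_out x : x <= 0 \/ 1 <= x -> bump x = 0.
Proof.
rewrite /bump /flat => -[x0|x1]; first by rewrite ltNge x0 mul0r.
by rewrite subr_gt0 (ltNge x) x1 mulr0.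
Qed.

Lemma bump_continuous : continuous bump.
Proof.
exact: (@is_derive_continuous _ bump _ (fun x : R => diffn_is_derive x (diffn_bump 0))).
Qed.

End smooth_functions.

(** * Functions vanishing outside an interval, smooth steps and approximate identities *)

Section support.
Context (R : realType).
Notation mu := (@lebesgue_measure R).
Implicit Types f g q p : R -> R.

Lemma Rintegrable_support f (a b : R) : mu.-integrable `[a, b] (EFin \o f) ->
  (forall x, x \notin `[a, b]%R -> f x = 0) -> Rintegrable mu f.
Proof.
move=> fi f0; rewrite /Rintegrable (_ : f = f \_ `[a, b]).
  have := iffLR (@integrable_mkcond _ _ _ mu _ (EFin \o f) (measurable_itv _)) fi.
  by rewrite restrict_EFin.
apply/funext => x; rewrite patchE mem_setE; case: ifPn => // xab; exact: f0.
Qed.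

Lemma Rintegral_support f (a b : R) :
  (forall x, x \notin `[a, b]%R -> f x = 0) -> \int[mu]_x f x = \int[mu]_(x in `[a, b]) f x.
Proof.
move=> f0; rewrite [RHS]Rintegral_mkcond; congr Rintegral.
apply/funext => x; rewrite patchE mem_setE; case: ifPn => // xab; exact: f0.
Qed.

Lemma locintM q f : locint q -> continuous f -> locint (fun x => q x * f x).
Proof.
move=> lq cf a b; have [C C0 HC] := continuous_bounded_itv a b cf.
have mq := measurable_int _ (lq a b).
apply: (le_integrable _ _ _ (integrableZl _ C (integrable_norm (lq a b)))) => //.
  apply/measurable_EFinP; apply: measurable_funM; first exact/measurable_EFinP.
  by apply: measurable_funTS; exact: continuous_measurable_fun.
move=> x xab; rewrite lee_fin [leRHS]normrM normrM normr_id mulrC (ger0_norm C0).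
by rewrite ler_wpM2r// HC//; move: xab; rewrite /= in_itv.
Qed.

Lemma continuous_locally_integrable f : continuous f -> locally_integrable [set: R] f.
Proof.
move=> cf; split; [exact: continuous_measurable_fun|exact: openT|move=> K _ cK].
have /integrableP[_] : mu.-integrable K (EFin \o f).
  by apply: continuous_compact_integrable => //; exact: continuous_subspaceT.
by [].
Qed.

Lemma locally_integrable_locint f : locally_integrable [set: R] f -> locint f.
Proof.
move=> [mf _ fK] a b; apply/integrableP; split.
  by apply/measurable_EFinP; exact: measurable_funTS.
by apply: fK => //; exact: segment_compact.
Qed.

Lemma integral_is_derive (F f : R -> R) (a b : R) : continuous f ->
  (forall x : R, is_derive x 1 F (f x)) -> a <= b -> \int[mu]_(x in `[a, b]) f x = F b - F a.
Proof.
move=> cf dF ab; rewrite -primB//; last exact: continuous_locint.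
have d (x : R) : is_derive x 1 (fun x => prim f x - F x) 0.
  by rewrite -(subrr (f x)); apply: is_deriveB; exact: is_derive_prim.
by have [c _] := mean_value a b d; rewrite mul0r; lra.
Qed.

End support.

Section cutoff.
Context (R : realType).
Notation mu := (@lebesgue_measure R).
Implicit Types (f q p : R -> R) (a b x : R).

Definition bump_mass : R := prim (@bump R) 1.

Lemma is_derive_prim_bump (x : R) : is_derive x 1 (prim (@bump R)) (bump x).
Proof. by apply: is_derive_prim; exact: bump_continuous. Qed.

Lemma prim_bump_homo x y : x <= y -> prim (@bump R) x <= prim (@bump R) y.
Proof.
move=> xy; have [c _ e] := mean_value x y is_derive_prim_bump.
by rewrite -subr_ge0 e mulr_ge0 ?bump_ge0// subr_ge0.
Qed.

Lemma prim_bump_le0 x : x <= 0 -> prim (@bump R) x = 0.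
Proof.
move=> x0; have [c] := mean_value 0 x is_derive_prim_bump.
rewrite prim0 subr0 (max_idPl x0) => /andP[_ c0] ->.
by rewrite bump_out ?mul0r//; left.
Qed.

Lemma prim_bump_ge1 x : 1 <= x -> prim (@bump R) x = bump_mass.
Proof.
move=> x1; have [c] := mean_value 1 x is_derive_prim_bump.
rewrite (min_idPl x1) => /andP[c1 _].
rewrite (bump_out (or_intror c1)) mul0r /bump_mass; lra.
Qed.

Lemma bump_mass_gt0 : 0 < bump_mass.
Proof.
have [c] := mean_value (1 / 4) (3 / 4) is_derive_prim_bump.
have h : (1 / 4 : R) <= 3 / 4 by lra.
rewrite (min_idPl h) (max_idPr h) => /andP[c1 c2] e.
have p1 : prim (@bump R) (3 / 4) <= prim (@bump R) 1 by apply: prim_bump_homo; lra.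
have p2 : prim (@bump R) 0 <= prim (@bump R) (1 / 4) by apply: prim_bump_homo; lra.
have c0 : 0 < bump c.
  rewrite /bump /flat !ifT; [|lra|lra].
  by rewrite !hornerC !mul1r mulr_gt0// expR_gt0.
move: p2; rewrite prim0 /bump_mass => p2.
have : 0 < bump c * (3 / 4 - 1 / 4) by rewrite mulr_gt0//; lra.
lra.
Qed.

(** A smooth step rising from 0 to 1 on [[a, a + 1/(n+1)]]; [dcut], its derivative, is an
    approximate identity concentrating at [a] from the right. The argument is written as an affine
    function to fit [is_derive_affine]. *)
Definition cut n a x : R := prim (@bump R) (n.+1%:R * x + - (n.+1%:R * a)) / bump_mass.
Definition dcut n a x : R := bump (n.+1%:R * x + - (n.+1%:R * a)) * n.+1%:R / bump_mass.

Lemma cut_arg n a x : n.+1%:R * x + - (n.+1%:R * a) = n.+1%:R * (x - a).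
Proof. by ring. Qed.

Lemma is_derive_cut n a (x : R) : is_derive x 1 (cut n a) (dcut n a x).
Proof.
have d := is_derive_affine n.+1%:R (- (n.+1%:R * a)) x is_derive_prim_bump.
have := is_deriveM d (is_derive_cst bump_mass^-1 x 1).
rewrite scaler0 add0r /GRing.scale /= => dc.
by rewrite /dcut mulrC.
Qed.

Lemma diffn_cut m n a : diffn m (cut n a).
Proof.
apply: diffnM; last exact: diffn_cst.
by apply: diffn_affine; apply: diffn_pred; apply: diffn_prim; exact: diffn_bump.
Qed.

Lemma cut_le0 n a x : x <= a -> cut n a x = 0.
Proof.
move=> xa; rewrite /cut cut_arg prim_bump_le0 ?mul0r//.
by rewrite mulr_ge0_le0// subr_le0.
Qed.

Lemma cut_ge1 n a x : a + n.+1%:R^-1 <= x -> cut n a x = 1.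
Proof.
move=> ax; rewrite /cut cut_arg prim_bump_ge1 ?divff ?gt_eqF ?bump_mass_gt0//.
by rewrite -ler_pdivrMl// mulr1 lerBrDl.
Qed.

Lemma cut_ge0 n a x : 0 <= cut n a x.
Proof.
rewrite /cut divr_ge0// ?(ltW bump_mass_gt0)//.
have [x0|/ltW x0] := leP (n.+1%:R * x - n.+1%:R * a) 0; first by rewrite prim_bump_le0.
by rewrite -(prim0 (@bump R)) prim_bump_homo.
Qed.

Lemma cut_le1 n a x : cut n a x <= 1.
Proof.
rewrite /cut ler_pdivrMr ?bump_mass_gt0// mul1r.
have [x0|/ltW x0] := leP (n.+1%:R * x - n.+1%:R * a) 1; first exact: prim_bump_homo.
by rewrite prim_bump_ge1.
Qed.

Lemma dcut_ge0 n a x : 0 <= dcut n a x.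
Proof. by rewrite /dcut; apply: divr_ge0 (ltW bump_mass_gt0); rewrite mulr_ge0 ?bump_ge0. Qed.

Lemma dcut_out n a x : x <= a \/ a + n.+1%:R^-1 <= x -> dcut n a x = 0.
Proof.
move=> H; rewrite /dcut bump_out ?mul0r// cut_arg; case: H => H; [left|right].
  by rewrite mulr_ge0_le0// subr_le0.
by rewrite -ler_pdivrMl// mulr1 lerBrDl.
Qed.

Lemma dcut_continuous n a : continuous (dcut n a).
Proof.
apply: (@is_derive_continuous _ _ (dcut n a)^`()) => x.
apply: (@diffn_is_derive R 0).
rewrite -(is_derive_derive1 (is_derive_cut n a)).
by have [_] := diffn_cut 1 n a.
Qed.

Lemma invS_le1 n : n.+1%:R^-1 <= 1 :> R.
Proof. by rewrite invf_le1// ler1n. Qed.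

Lemma dcut_out_itv n a x : x \notin `[a, a + 1]%R -> dcut n a x = 0.
Proof.
rewrite in_itv/= => xa; apply: dcut_out.
have [|ax] := leP x a; first by left.
right; move: xa; rewrite (ltW ax)/= -ltNge => /ltW.
by apply: le_trans; rewrite lerD2l invS_le1.
Qed.

Lemma Rintegrable_dcut q n a : continuous q -> Rintegrable mu (fun x => q x * dcut n a x).
Proof.
move=> cq; have z x : x \notin `[a, a + 1]%R -> q x * dcut n a x = 0.
  by move=> xa; rewrite dcut_out_itv ?mulr0.
apply: (Rintegrable_support _ z).
exact: (locintM (continuous_locint cq) (@dcut_continuous n a)).
Qed.

Lemma cvg_integral_dcut q a : continuous q ->
  (fun n => \int[mu]_x (q x * dcut n a x)) @ \oo --> q a.
Proof.
move=> cq; apply/cvgrPdist_le => e e0.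
have total n c : \int[mu]_x (c * dcut n a x) = c.
  rewrite (@Rintegral_support _ _ a (a + 1)); last first.
    by move=> x xa; rewrite dcut_out_itv ?mulr0.
  have d (x : R) : is_derive x 1 (fun x => c * cut n a x) (c * dcut n a x).
    have := is_deriveM (is_derive_cst c x 1) (is_derive_cut n a x).
    by rewrite scaler0 addr0.
  rewrite (integral_is_derive _ d); last 2 first.
  - by move=> x; apply: cvgM; [exact: cvg_cst|exact: dcut_continuous].
  - by rewrite lerDl.
  by rewrite cut_ge1 ?cut_le0// ?mulr0 ?mulr1 ?subr0// lerD2l invS_le1.
have /cvgrPdist_le /(_ e e0) [d /= d0 Hd] := cq a.
near=> n.
have nd : n.+1%:R^-1 < d by near: n; exact: near_infty_natSinv_lt (PosNum d0).
have close x : `|q x - q a| * dcut n a x <= e * dcut n a x.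
  have [xa|ax] := leP x a; first by rewrite (dcut_out (or_introl xa)) !mulr0.
  have [xa|xb] := leP (a + n.+1%:R^-1) x; first by rewrite (dcut_out (or_intror xa)) !mulr0.
  rewrite ler_wpM2r ?dcut_ge0// distrC; apply: Hd => /=.
  have {}nd := lt_trans (_ : x - a < _) nd.
  by rewrite ltr_norml; apply/andP; split; [rewrite ltrNl opprB nd// ltrBlDl|rewrite (lt_trans _ d0)// subr_lt0].
have iq := Rintegrable_dcut n a cq.
have ic c : Rintegrable mu (fun x => c * dcut n a x).
  exact: Rintegrable_dcut (@cst_continuous _ _ c).
rewrite ler_distlC; apply/andP; split.
  rewrite -[leLHS](total n); apply: (le_Rintegral _ (ic _) iq) => // x _.
  have := close x; have := dcut_ge0 n a x.
  have := ler_norm (- (q x - q a)); rewrite normrN; nra.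
rewrite -[leRHS](total n); apply: (le_Rintegral _ iq (ic _)) => // x _.
have := close x; have := dcut_ge0 n a x.
have := ler_norm (q x - q a); nra.
Unshelve. all: by end_near. Qed.

End cutoff.

(** * Weak derivatives *)

Section weak_derivative.
Context (R : realType).
Notation RT := (measurableTypeR R).
Notation mu := (@lebesgue_measure R).
Implicit Types (f q p phi : R -> R) (a b x : R).

(** The step lies to the right of [a], so the limit at [x = a] is 0; this is why half-open intervals
    []a, b]] appear below. *)
Lemma cvg_cut a x : (fun n => cut n a x) @ \oo --> ((a < x)%R%:R : R).
Proof.
have [ax|xa] := ltP a x.
  apply: cvg_near_cst; near=> n; apply: cut_ge1; rewrite -lerBrDl.
  near: n; have ax0 : 0 < x - a by rewrite subr_gt0.
  by near=> n; apply: ltW; near: n; exact: near_infty_natSinv_lt (PosNum ax0).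
by apply: cvg_near_cst; near=> n; exact: cut_le0.
Unshelve. all: by end_near. Qed.

Lemma compact_closure_itv (A : set R) a b : A `<=` `[a, b] -> compact (closure A).
Proof.
move=> Aab; apply: (subclosed_compact (@closed_closure _ _) (@segment_compact _ a b)).
rewrite [X in _ `<=` X](iffLR (closure_id _)); last exact: interval_closed.
exact: closure_subset.
Qed.

(** A test function that approximates the indicator of []a, b]]; its derivative is a difference of
    approximate identities at [a] and [b]. *)
Definition plateau n a b x : R := cut n a x + -1 * cut n b x.
Definition dplateau n a b x : R := dcut n a x + -1 * dcut n b x.

Lemma plateau_out n a b x : a <= b -> x \notin `[a, b + 1]%R -> plateau n a b x = 0.
Proof.
rewrite in_itv/= => ab; have [xa _|ax] := ltP x a.
  by rewrite /plateau !cut_le0 ?(ltW xa)// ?(ltW (lt_le_trans xa ab))//; ring.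
rewrite /= -ltNge => bx; rewrite /plateau !cut_ge1; first by ring.
  by rewrite (le_trans _ (ltW bx))// lerD2l invS_le1.
by rewrite (le_trans _ (ltW bx))// lerD// invS_le1.
Qed.

Lemma derive1_plateau n a b : (plateau n a b)^`() = dplateau n a b.
Proof.
apply: is_derive_derive1 => x.
have := is_deriveD (is_derive_cut n a x)
  (is_deriveM (is_derive_cst (-1 : R) x 1) (is_derive_cut n b x)).
by rewrite scaler0 addr0.
Qed.

Lemma test_plateau n a b : a <= b -> test_function (plateau n a b).
Proof.
move=> ab; split.
  apply: diffn_derive1n => m; apply: diffnD; first exact: diffn_cut.
  by apply: diffnM; [exact: diffn_cst|exact: diffn_cut].
apply: (@compact_closure_itv _ a (b + 1)) => x /= p0.
by apply: contra_neqT p0; exact: plateau_out.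
Qed.

Lemma cvg_plateau a b x :
  (fun n => plateau n a b x) @ \oo --> ((a < x)%R%:R + -1 * (b < x)%R%:R : R).
Proof. by apply: cvgD; [exact: cvg_cut|apply: cvgM; [exact: cvg_cst|exact: cvg_cut]]. Qed.

(** Tested against [plateau], the weak derivative identity tends to [q a - q b] on the left, by
    continuity of [q], and to minus the integral of [p] on the right, dominated by [|p|] on
    [[a, b + 1]]. *)
Lemma du_bois_reymond q p a b : continuous q -> is_weak_derivative q p -> a <= b ->
  q b - q a = \int[mu]_(x in `[a, b]) p x.
Proof.
move=> cq [_ lip qp] ab; have lp := locally_integrable_locint lip.
have [mp _ _] := lip.
pose w n x := p x * plateau n a b x.
pose g := (fun x => `|p x|) \_ `[a, b + 1].
have wE n x : x \notin `[a, b + 1]%R -> w n x = 0.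
  by move=> xab; rewrite /w plateau_out ?mulr0.
have mplateau n : measurable_fun setT (plateau n a b).
  apply: continuous_measurable_fun.
  apply: (@is_derive_continuous _ _ (plateau n a b)^`()) => x.
  by apply: derivable_is_derive; have [d _] := test_plateau n ab; exact: (d 0%N x).
have mw n : measurable_fun setT (w n) by apply: measurable_funM.
have plateau_le1 n x : `|plateau n a b x| <= 1.
  rewrite /plateau ler_norml; have := cut_ge0 n a x; have := cut_ge0 n b x.
  have := cut_le1 n a x; have := cut_le1 n b x; lra.
have wg n x : `|w n x| <= g x.
  rewrite /g patchE mem_setE; case: ifPn => [_|/(wE n) ->]; last by rewrite normr0.
  by rewrite normrM ler_piMr.
have gi : Rintegrable mu g.
  apply: (@Rintegrable_support _ _ a (b + 1)) => [|x]; last first.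
    by move=> xab; rewrite /g patchE mem_setE (negbTE xab).
  apply: eq_integrable (integrable_norm (lp a (b + 1))) => //= x xab.
  by rewrite /g patchE xab.
have wf x : w ^~ x @ \oo --> p x * ((a < x)%R%:R + -1 * (b < x)%R%:R).
  by apply: cvgM; [exact: cvg_cst|exact: cvg_plateau].
have := @cvg_Rintegral _ RT R mu w _ g mw wg gi wf.
rewrite (@Rintegral_support _ _ a b); last first.
  move=> x; rewrite in_itv/=; have [ax|xa _] := ltP a x.
    by rewrite (ltW ax)/= -ltNge => ->; rewrite mulr1 subrr mulr0.
  by rewrite ltNge (le_trans xa ab)/= mulr0 addr0 mulr0.
have pab : mu.-integrable `]a, b] (EFin \o p).
  by apply: integrableS (lp a b) => //; apply: subset_itvr; rewrite bnd_simp.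
have pE x : x \in `]a, b] -> p x = p x * ((a < x)%R%:R + -1 * (b < x)%R%:R).
  rewrite mem_setE in_itv/= => /andP[-> xb].
  by rewrite ltNge xb/= mulr0 addr0 mulr1.
rewrite -Rintegral_itv_obnd_cbnd; last first.
  by apply: eq_integrable pab => // x xab; rewrite /= -pE.
have -> : \int[mu]_(x in `]a, b]) (p x * ((a < x)%R%:R + -1 * (b < x)%R%:R)) =
    \int[mu]_(x in `]a, b]) p x by apply: eq_Rintegral => x /pE.
rewrite Rintegral_itv_obnd_cbnd//.
move=> lim1.
have wint n : Rintegrable mu (w n).
  by exact: (@Rintegrable_le _ RT R mu (w n) g (mw n) (wg n) gi).
have eqn n : \int[mu]_x (q x * dcut n a x) - \int[mu]_x (q x * dcut n b x) = - \int[mu]_x w n x.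
  have ia := Rintegrable_dcut n a cq; have ib := Rintegrable_dcut n b cq.
  have := qp _ (test_plateau n ab); rewrite derive1_plateau.
  rewrite (integral_EFin (wint n)) -EFinN.
  have -> : (fun x => (q x * dplateau n a b x)%:E) =
      (fun x => (q x * dcut n a x - q x * dcut n b x)%:E).
    by apply/funext => x; congr EFin; rewrite /dplateau; ring.
  by rewrite (integral_EFin (RintegrableB ia ib)) RintegralB// => -[].
have lim3 : (fun n => - \int[mu]_x w n x) @ \oo --> q a - q b.
  rewrite (_ : (fun n => _) = fun n => \int[mu]_x (q x * dcut n a x) - \int[mu]_x (q x * dcut n b x)).
    by apply: cvgB; exact: cvg_integral_dcut.
  by apply/funext => n; rewrite eqn.
have lim4 : (fun n => - \int[mu]_x w n x) @ \oo --> - \int[mu]_(x in `[a, b]) p x.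
  exact: cvgN lim1.
by rewrite -[RHS]opprK -(cvg_unique _ lim3 lim4) ?opprB.
Qed.

Lemma weak_derivP q : H q -> is_weak_derivative q (weak_deriv q).
Proof. by case=> _ [_ [p qp _]] _ _; apply: (@xgetPex _ (cst 0) [set p | is_weak_derivative q p]); exists p. Qed.

Lemma sqint_Lfun f : sqint mu f -> f \in Lfun mu 2%:E.
Proof.
move=> [mf fi]; rewrite inE; apply/andP; split; rewrite inE//=.
rewrite /finite_norm unlock /Lnorm poweR_lty//.
have /integrableP[_] := fi; apply: le_lt_trans.
apply: ge0_le_integral => //=.
- apply/measurable_EFinP; apply: (@measurableT_comp _ _ _ _ _ _ (fun x : R => x `^ 2)) => //.
  exact: measurableT_comp.
- apply/measurable_EFinP; apply: measurableT_comp => //; exact: measurable_funX.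
by move=> x _; rewrite lee_fin normrX powR_mulrn.
Qed.

Lemma Lfun_sqint f : f \in Lfun mu 2%:E -> sqint mu f.
Proof.
move=> fL; split; last exact: Lfun2_integrable_sqr.
by move: fL; rewrite inE => /andP[+ _]; rewrite inE.
Qed.

Lemma H_sqint q : H q -> sqint mu (weak_deriv q).
Proof. by move=> [_ _ /Lfun_sqint]. Qed.

Lemma H_prim_weak_deriv q : H q -> q = prim (weak_deriv q).
Proof.
move=> Hq; have [cq _ _ q0] := Hq; have wq := weak_derivP Hq.
apply/funext => x; rewrite /prim; have [x0|/ltW x0] := leP 0 x.
  by rewrite -(du_bois_reymond cq wq x0) (Rintegral_itv_rev _ x0) q0 !subr0.
by rewrite -(du_bois_reymond cq wq x0) (Rintegral_itv_rev _ x0) q0; ring.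
Qed.

Lemma is_weak_derivative_prim (u : R -> R) : continuous u -> is_weak_derivative (prim u) u.
Proof.
move=> cu; have cU : continuous (prim u).
  exact: (@is_derive_continuous _ _ u (fun x : R => is_derive_prim x cu)).
split; [exact: continuous_locally_integrable|exact: continuous_locally_integrable|].
move=> phi [dphi cphi].
have cphi0 : continuous phi.
  apply: (@is_derive_continuous _ _ phi^`()) => x.
  by apply: derivable_is_derive; exact: (dphi 0%N x).
have cphi1 : continuous phi^`().
  apply: (@is_derive_continuous _ _ phi^`()^`()) => x.
  by apply: derivable_is_derive; exact: (dphi 1%N x).
(* Off the closed support [phi] is locally zero, hence so is its derivative; integration by parts on
   [[-M, M]] then has no boundary terms. *)
have [M M0 HM] : exists2 M, 0 < M & forall x, M <= `|x| -> phi x = 0 /\ phi^`() x = 0.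
  have [M [_ HM]] := compact_bounded cphi.
  pose M1 := Num.max M 0 + 1.
  have M10 : 0 < M1 by rewrite ltr_pwDr// le_max lexx orbT.
  have out x : M1 <= `|x| -> ~ closure [set x | phi x != 0] x.
    have M2 : M < Num.max M 0 + 2^-1 by rewrite ltr_pwDr// le_max lexx.
    by move=> Mx /(HM _ M2) /=; move: Mx; rewrite /M1; lra.
  exists M1 => // x /out xN.
  have : \forall y \near x, phi y = 0.
    have : nbhs x (~` closure [set x | phi x != 0]).
      by apply: open_nbhs_nbhs; split => //; apply: closed_openC; exact: closed_closure.
    apply: filterS => y ycl; apply/eqP; rewrite -[_ == _]negbK; apply/negP => y0.
    by apply: ycl; exact: subset_closure.
  move=> nx; split; first exact: nbhs_singleton nx.
  have [_ d0] := @near_is_derive R (fun=> 0) phi x 0 (filterS (fun=> esym) nx) (is_derive_cst _ _ _).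
  by rewrite derive1E.
have z1 x : x \notin `[- M, M]%R -> prim u x * phi^`() x = 0.
  move=> xM; rewrite (HM x _).2 ?mulr0//; move: xM; rewrite in_itv/= -ler_norml -ltNge; exact: ltW.
have z2 x : x \notin `[- M, M]%R -> u x * phi x = 0.
  move=> xM; rewrite (HM x _).1 ?mulr0//; move: xM; rewrite in_itv/= -ler_norml -ltNge; exact: ltW.
have l1 := locintM (continuous_locint cU) cphi1.
have l2 := locintM (continuous_locint cu) cphi0.
rewrite integral_EFin; last exact: Rintegrable_support (l1 _ _) z1.
rewrite integral_EFin; last exact: Rintegrable_support (l2 _ _) z2.
rewrite (Rintegral_support z1) (Rintegral_support z2) -EFinN; congr EFin.
have d (x : R) : is_derive x 1 (fun x => prim u x * phi x) (prim u x * phi^`() x + u x * phi x).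
  have := is_deriveM (is_derive_prim x cu) (derivable_is_derive (dphi 0%N x)).
  by rewrite /GRing.scale /= [phi x * _]mulrC.
apply/eqP; rewrite -addr_eq0 -(RintegralD _ (l1 _ _) (l2 _ _))//.
rewrite (integral_is_derive _ d).
- by rewrite (HM M _).1 ?(HM (- M) _).1 ?normrN ?ger0_norm ?mulr0 ?subrr// ltW.
- by move=> x; apply: cvgD; apply: cvgM; [exact: cU|exact: cphi1|exact: cu|exact: cphi0].
- lra.
Qed.

(** The weak derivative that was picked has the same integrals as [u] by [du_bois_reymond]; at its
    Lebesgue points it is the derivative of its own integral, which is [u]. *)
Lemma weak_deriv_prim (u : R -> R) : continuous u -> ae_eq mu [set: R] (weak_deriv (prim u)) u.
Proof.
move=> cu; have cU : continuous (prim u).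
  exact: (@is_derive_continuous _ _ u (fun x : R => is_derive_prim x cu)).
have wu : is_weak_derivative (prim u) (weak_deriv (prim u)).
  apply: (@xgetPex _ (cst 0) [set p | is_weak_derivative (prim u) p]).
  by exists u; exact: is_weak_derivative_prim.
set p := weak_deriv _ in wu *; have [_ lip _] := wu.
have lp := locally_integrable_locint lip.
apply: (negligibleS _ (lebesgue_differentiation lip)); apply: subsetC => x px _.
have xx1 : x < x + 1 by lra.
have [|d e] := @FTC1_lebesgue_pt R p (BLeft (x - 1)) x (x + 1) xx1 (lp _ _) _ px.
  by rewrite /Order.lt/=; lra.
rewrite -e derive1E.
have -> : u x = 'D_1 (fun y => prim u y - prim u (x - 1)) x.
  have := is_deriveB (is_derive_prim x cu) (is_derive_cst (prim u (x - 1)) x 1).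
  by rewrite subr0 => -[].
apply: near_eq_derive; near=> y.
rewrite -(du_bois_reymond cU wu)//.
near: y; exists 1 => //= y /=; rewrite ltr_norml; lra.
Unshelve. all: by end_near. Qed.

Lemma continuous_L2_loc f : continuous f -> L2_loc f.
Proof.
move=> cf B cB; have mB : measurable B by apply: closed_measurable; exact: compact_closed.
have mf := continuous_measurable_fun cf.
have mfB : measurable_fun [set: RT] (f \_ B).
  by apply/(measurable_restrictT f mB); exact: measurable_funTS.
apply: sqint_Lfun; split => //.
rewrite /Rintegrable (_ : EFin \o _ = (EFin \o (fun x => f x ^+ 2)) \_ B); last first.
  apply/funext => x; rewrite /= !patchE; case: ifP => //= _.
  by rewrite expr0n.
apply: (iffLR (@integrable_mkcond _ _ _ mu _ _ mB)).
apply: continuous_compact_integrable => //; apply: continuous_subspaceT => x.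
by rewrite /continuous_at expr2; apply: cvgM; exact: cf.
Qed.

Lemma weak_deriv_measurable (u : R -> R) : continuous u ->
  measurable_fun [set: RT] (weak_deriv (prim u)).
Proof.
move=> cu; suff [_ [mp _ _] _] : is_weak_derivative (prim u) (weak_deriv (prim u)) by [].
apply: (@xgetPex _ (cst 0) [set p | is_weak_derivative (prim u) p]).
by exists u; exact: is_weak_derivative_prim.
Qed.

Lemma integral_weak_deriv_sqr (u : R -> R) : continuous u ->
  (\int[mu]_x (weak_deriv (prim u) x ^+ 2)%:E = \int[mu]_x (u x ^+ 2)%:E)%E.
Proof.
move=> cu; apply: ae_eq_integral => //.
- by apply/measurable_EFinP; apply: measurable_funX; exact: weak_deriv_measurable.
- by apply/measurable_EFinP; apply: measurable_funX; exact: continuous_measurable_fun.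
- apply: (negligibleS _ (weak_deriv_prim cu)); apply: subsetC => x /= H xT.
  by rewrite (H xT).
Qed.

Lemma integral_weak_derivM (u f : R -> R) : continuous u -> measurable_fun [set: RT] f ->
  (\int[mu]_x (weak_deriv (prim u) x * f x)%:E = \int[mu]_x (u x * f x)%:E)%E.
Proof.
move=> cu mf; apply: ae_eq_integral => //.
- by apply/measurable_EFinP; apply: measurable_funM => //; exact: weak_deriv_measurable.
- by apply/measurable_EFinP; apply: measurable_funM => //; exact: continuous_measurable_fun.
- apply: (negligibleS _ (weak_deriv_prim cu)); apply: subsetC => x /= H xT.
  by rewrite (H xT).
Qed.

Lemma H_prim (u : R -> R) : continuous u -> sqint mu u -> H (prim u).
Proof.
move=> cu su; have cU : continuous (prim u).
  exact: (@is_derive_continuous _ _ u (fun x : R => is_derive_prim x cu)).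
split => //; last exact: prim0.
  split; first exact: continuous_L2_loc.
  by exists u; [exact: is_weak_derivative_prim|exact: continuous_L2_loc].
apply: sqint_Lfun; split; first exact: weak_deriv_measurable.
apply: ge0_Rintegrable => [|x|].
- by apply: measurable_funX; exact: weak_deriv_measurable.
- exact: sqr_ge0.
rewrite integral_weak_deriv_sqr// (integral_EFin su.2); exact: ltry.
Qed.

Lemma T_prim (u : R -> R) : continuous u -> sqint mu u ->
  T (prim u) = (2^-1 * normsq u)%:E.
Proof. by move=> cu su; rewrite /T integral_weak_deriv_sqr// (integral_EFin su.2) EFinM. Qed.

Lemma H_T q : H q -> T q = (2^-1 * normsq (weak_deriv q))%:E.
Proof. by move=> /H_sqint[_ si]; rewrite /T (integral_EFin si) EFinM. Qed.

End weak_derivative.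

(** * The interaction energy *)

Section interaction.
Context (R : realType) (I : set R) (V k m : R -> R) (delta gamma2 l : R).
Notation RT := (measurableTypeR R).
Notation mu := (@lebesgue_measure R).
Notation nu := (@plane_measure R).
Local Notation w := (Vbar I V).
Local Notation dw := (derive1 (Vbar I V)).
Hypothesis Hw : potential w dw.
Hypothesis Hkm : H2 k m delta gamma2.
Hypothesis l0 : 0 < l.
Hypothesis ld : l < delta.
Implicit Types (u v : R -> R).

Definition clamp (x : R) : R := Num.max l (Num.min delta x).

Lemma clamp_id x : x \in `[l, delta]%R -> clamp x = x.
Proof. by rewrite in_itv/= => /andP[lx xd]; rewrite /clamp (min_idPr xd) (max_idPr lx). Qed.

Lemma clamp_itv x : l <= clamp x <= delta.
Proof. by rewrite /clamp le_max lexx/= ge_max ge_min lexx (ltW ld). Qed.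

Lemma clamp_homo x y : x <= y -> clamp x <= clamp y.
Proof.
move=> xy; rewrite /clamp ge_max !le_max lexx/= le_min !ge_min lexx xy/= !orbT.
by [].
Qed.

Lemma nondecreasing_gt0 (f : R -> R) : (forall x, f x = 0 <-> x = 0) ->
  {in `[0, +oo[ &, {homo f : x y / x <= y}} -> forall x, 0 < x -> 0 < f x.
Proof.
move=> f0 fh x x0; rewrite lt_neqAle; apply/andP; split.
  by rewrite eq_sym; apply/eqP => /f0 x_eq0; move: x0; rewrite x_eq0 ltxx.
rewrite -{1}(iffRL (f0 0) erefl); apply: fh (ltW x0); rewrite mem_setE in_itv/= ?lexx//.
by rewrite andbT ltW.
Qed.

Lemma m_gt0 x : 0 < x -> 0 < m x.
Proof. exact: nondecreasing_gt0 (H2_m_zero Hkm) (H2_m_nondecreasing Hkm) x. Qed.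

Lemma k_gt0 x : 0 < x -> 0 < k x.
Proof. exact: nondecreasing_gt0 (H2_k_zero Hkm) (H2_k_nondecreasing Hkm) x. Qed.

Lemma clamp_comp_homo (f : R -> R) : {in `[0, +oo[ &, {homo f : x y / x <= y}} ->
  {homo f \o clamp : x y / x <= y}.
Proof.
move=> fh x y xy; apply: fh; last exact: clamp_homo.
  by rewrite mem_setE in_itv/= andbT (le_trans (ltW l0))//; case/andP: (clamp_itv x).
by rewrite mem_setE in_itv/= andbT (le_trans (ltW l0))//; case/andP: (clamp_itv y).
Qed.

Lemma clamp_gt0 x : 0 < clamp x.
Proof. by rewrite (lt_le_trans l0)//; case/andP: (clamp_itv x). Qed.

(* Clamping keeps [omega] positive and monotone off [l, delta], where its
   values are irrelevant because [kappa] vanishes. *)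
Definition kappa (xi : R) : R := k (clamp xi) * \1_(`[l, delta]) xi.
Definition omega (xi : R) : R := (m (clamp xi))^-1.

Lemma kappaE xi : xi \in `[l, delta]%R -> kappa xi = k xi.
Proof. by move=> xil; rewrite /kappa clamp_id// indicE mem_setE xil mulr1. Qed.

Lemma omegaE xi : xi \in `[l, delta]%R -> omega xi = (m xi)^-1.
Proof. by move=> xil; rewrite /omega clamp_id. Qed.

Lemma k_homo x y : 0 <= x -> x <= y -> k x <= k y.
Proof.
move=> x0 xy; apply: (H2_k_nondecreasing Hkm) => //; rewrite mem_setE in_itv/= andbT//.
exact: le_trans xy.
Qed.

Lemma m_homo x y : 0 <= x -> x <= y -> m x <= m y.
Proof.
move=> x0 xy; apply: (H2_m_nondecreasing Hkm) => //; rewrite mem_setE in_itv/= andbT//.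
exact: le_trans xy.
Qed.

(** After clamping, [k] and [1 / m] are monotone on the whole line, hence measurable, and bounded by
    their values at the ends of [l, delta]; [1 / m] is bounded because [l > 0]. *)
Lemma weights_interaction : weights l delta kappa omega (k delta) (m delta)^-1 (m l)^-1.
Proof.
have d0 := lt_trans l0 ld.
have cl xi : [/\ 0 < clamp xi, l <= clamp xi & clamp xi <= delta].
  by have /andP[? ?] := clamp_itv xi; split => //; exact: clamp_gt0.
split => //.
- apply: measurable_funM; last exact: measurable_indic.
  apply: nondecreasing_measurable => //.
  exact: clamp_comp_homo (H2_k_nondecreasing Hkm).
- by move=> xi; have [c0 _ _] := cl xi; rewrite /kappa mulr_ge0 ?(ltW (k_gt0 c0))// indicE.
- move=> xi; have [c0 _ cd] := cl xi.
  rewrite /kappa indicE; case: (_ \in _); rewrite ?mulr1 ?mulr0 ?(ltW (k_gt0 d0))//.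
  exact: k_homo (ltW c0) cd.
- by move=> xi xil; rewrite /kappa indicE mem_setE (negbTE xil) mulr0.
- apply: nonincreasing_measurable => // x y xy; rewrite lef_pV2 ?posrE ?m_gt0 ?clamp_gt0//.
  exact: clamp_comp_homo (H2_m_nondecreasing Hkm) _ _ xy.
- by rewrite invr_gt0 m_gt0.
- move=> xi; have [c0 _ cd] := cl xi.
  by rewrite lef_pV2 ?posrE ?m_gt0//; exact: m_homo (ltW c0) cd.
- move=> xi; have [c0 lc _] := cl xi.
  by rewrite lef_pV2 ?posrE ?m_gt0//; exact: m_homo (ltW l0) lc.
Qed.

Let wt := weights_interaction.
Local Notation E := (elastic_energy w l delta kappa omega).
Local Notation dE := (elastic_gradient dw l delta kappa omega).
Local Notation ddensity := (elastic_ddensity dw l delta kappa omega).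
Local Notation density := (elastic_density w l delta kappa omega).

Lemma kappa_ge xi : xi \in `[l, delta]%R -> k l <= kappa xi.
Proof. by move=> xil; rewrite kappaE// k_homo ?(ltW l0)// (itvP xil). Qed.

Lemma Wbar_density u z xi : sqint mu u -> xi \in `[l, delta]%R ->
  Wbar I V k m (prim u (z + xi) - prim u z) xi = density u (z, xi).
Proof.
move=> su xil; rewrite /elastic_density /elastic_strain (D_prim l0 _ (sqint_locint su) xil).
by rewrite kappaE// omegaE.
Qed.

Lemma fbarE eta xi : xi \in `[l, delta]%R ->
  fbar I V k m eta xi = dw (eta * omega xi) * omega xi * kappa xi.
Proof.
move=> xil; rewrite /fbar kappaE// omegaE//.
have d := is_derive_affine (m xi)^-1 0 eta (pot_derive Hw).
have := is_deriveM d (is_derive_cst (k xi) eta 1).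
rewrite scaler0 add0r /GRing.scale /= addr0 [_ * eta]mulrC [k xi * _]mulrC => -[_ <-].
rewrite derive1E; congr ('D_1 _ eta).
by apply/funext => e; rewrite fctE /Wbar addr0 [_ * e]mulrC.
Qed.

Lemma fbar_ddensity u z xi : sqint mu u -> xi \in `[l, delta]%R ->
  fbar I V k m (prim u (z + xi) - prim u z) xi = ddensity u (z, xi).
Proof. by move=> su xil; rewrite fbarE// (ddensityE dw wt z xi su). Qed.

Lemma U_prim u z : sqint mu u ->
  U I V k m l delta (prim u) z = (\int[mu]_xi (density u (z, xi))%:E)%E.
Proof.
move=> su; rewrite /U integral_mkcond; apply: eq_integral => xi _.
rewrite patchE mem_setE; case: ifPn => xil; first by rewrite Wbar_density.
by rewrite /elastic_density (wt_kappa_out wt)// mulr0.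
Qed.

Lemma energy_prim u : sqint mu u -> energy I V k m l delta (prim u) = (E u)%:E.
Proof.
by move=> su; rewrite (E_fubini Hw wt su); apply: eq_integral => z _; rewrite U_prim.
Qed.

Lemma integrable_U_prim u : sqint mu u -> mu.-integrable [set: R] (U I V k m l delta (prim u)).
Proof.
move=> su; have U0 z : (0 <= U I V k m l delta (prim u) z)%E.
  by rewrite U_prim// integral_ge0// => xi _; rewrite lee_fin (density_ge0 Hw wt).
apply/integrableP; split.
  rewrite (_ : U _ _ _ _ _ _ _ = fun z => (\int[mu]_xi (density u (z, xi))%:E)%E); last first.
    by apply/funext => z; rewrite U_prim.
  apply: (@measurable_fun_fubini_tonelli_F _ _ _ _ _ mu (fun z => (density u z)%:E)).
    by apply/measurable_EFinP; exact: (measurable_density Hw wt su.1).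
  by move=> p; rewrite lee_fin (density_ge0 Hw wt).
under eq_integral do rewrite gee0_abs//.
by rewrite -/(energy I V k m l delta (prim u)) energy_prim// ltry.
Qed.

(** The double integral of the multiplier identity is the pairing of [ddensity u] with [D v] over
    the plane; Fubini and [D_adjoint] turn it into a pairing on the line. *)
Lemma pairing_prim u v : sqint mu u -> sqint mu v ->
  (\int[mu]_z \int[mu]_(xi in `[l, delta])
     (fbar I V k m (prim u (z + xi) - prim u z) xi * (prim v (z + xi) - prim v z))%:E =
   (\int[mu]_y (v y * dE u y))%:E)%E.
Proof.
move=> su sv; have sG := sqint_ddensity Hw wt su.
have i := sqintM sG (D_sqint l0 ld sv).
rewrite /elastic_gradient -(D_adjoint l0 ld sG sv) -(integral_EFin i).
rewrite -(integral12_prod_meas1 i); apply: eq_integral => z _.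
rewrite integral_mkcond; apply: eq_integral => xi _.
rewrite patchE mem_setE; case: ifPn => xil.
  by rewrite /= fbar_ddensity// (D_prim l0 _ (sqint_locint sv) xil).
by rewrite /= (ddensity_out dw wt)// mul0r.
Qed.

Lemma ddE_prim u (x : R) : sqint mu u ->
  (\int[mu]_(xi in `[l, delta])
    (fbar I V k m (prim u (x + xi) - prim u x) xi -
     fbar I V k m (prim u x - prim u (x - xi)) xi)%:E =
   (ddE dw l delta kappa omega u x)%:E)%E.
Proof.
move=> su; have [C C0 HC] := ddensity_le Hw wt (normsq u).
have mdd := measurable_ddensity Hw wt su.1.
have i : Rintegrable mu (fun xi => ddensity u (x, xi) - ddensity u (x - xi, xi)).
  apply: (@Rintegrable_bounded_support _ _ _ ld _ (C + C)).
  - apply: measurable_funB; first by apply: (measurableT_comp mdd); exact: pair1_measurable.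
    apply: (measurableT_comp mdd); apply/measurable_fun_pairP; split.
      exact: measurable_funB.
    exact: measurable_id.
  - have le p : `|ddensity u p| <= C.
      by rewrite (le_trans (HC u p su (lexx _)))// ler_piMr// indicE lern1 leq_b1.
    by move=> xi; rewrite (le_trans (ler_normB _ _))// lerD.
  - by move=> xi xil; rewrite !(ddensity_out dw wt)// subrr.
rewrite /ddE -(integral_EFin i) [LHS]integral_mkcond; apply: eq_integral => xi _.
rewrite patchE mem_setE; case: ifPn => xil; last by rewrite !(ddensity_out dw wt)// subrr.
(* Reading [x] as [(x - xi) + xi] makes the second term a density at [x - xi]. *)
by rewrite fbar_ddensity// -{1}[x in prim u x - _](subrK xi) fbar_ddensity.
Qed.

End interaction.

#[local] Opaque elastic_energy elastic_gradient quadratic_coeff normsq ddE.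

Theorem theorem3 (R : realType) (delta : R) (I : set R) (V k m : R -> R)
    (c1 c2 gamma1 gamma2 l : R)
    (delta_gt0 : 0 < delta)
    (V_C2 : C2 V)
    (V_H1 : H1 I V c1 c2 gamma1 gamma2)
    (km_H2 : H2 k m delta gamma2)
    (l_in : 0 < l < delta) :
  exists K0 : R, forall K : R, K0 < K ->
    exists q : R -> R,
      [/\ C2 q,
          A I V k m l delta K q,
          forall p, A I V k m l delta K p -> (T q <= T p)%E
        & exists lambda c : R,
            [/\ is_multiplier I V k m l delta q lambda,
                forall lambda', is_multiplier I V k m l delta q lambda' ->
                  lambda' = lambda,
                0 < c ^+ 2,
                c ^+ 2 = lambda^-1
              & euler_lagrange I V k m l delta q (c ^+ 2)]].
Proof.
have /andP[l0 ld] := l_in.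
have Hw := potential_Vbar V_C2 V_H1.
have wt := weights_interaction km_H2 l0 ld.
have [K0 K00 HK0] := admissible_small_large Hw wt (k_gt0 km_H2 l0) (kappa_ge km_H2 l0).
exists K0 => K /[dup] /(le_lt_trans K00) Kgt0 /HK0 small.
have [u0 Au0 nu0] := minimizer_exists Hw wt Kgt0 small.
have [u [a [su cu nu EK [a0 ua]]]] := minimizer_critical Hw wt Kgt0 Au0 nu0.
set dE := elastic_gradient _ _ _ _ _ in ua.
pose ddE' := ddE (derive1 (Vbar I V)) l delta (kappa k delta l) (omega m delta l) u.
have dq : (prim u)^`() = u by apply: is_derive_derive1 => x; exact: is_derive_prim.
(* Through this fixed-point equation [u] inherits the differentiability of the gradient. *)
have uE : cst a * dE u = u by apply/funext => y; rewrite ua.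
have du (x : R) : is_derive x 1 u (a * ddE' x).
  have := is_deriveM (is_derive_cst a x 1) (is_derive_dE Hw wt x su : is_derive x 1 (dE u) (ddE' x)).
  by rewrite scaler0 addr0 uE.
have ddq : u^`() = fun x => a * ddE' x by exact: is_derive_derive1.
have Hq := H_prim cu su.
have mult zeta : H zeta ->
    (\int[lebesgue_measure]_z (weak_deriv (prim u) z * weak_deriv zeta z)%:E =
      (a * \int[lebesgue_measure]_y (weak_deriv zeta y * dE u y))%:E)%E.
  move=> /H_sqint sz; rewrite (integral_weak_derivM cu sz.1) (integral_EFin (sqintM su sz)).
  congr EFin; rewrite -RintegralZl//; last exact: sqintM sz (sqint_dE Hw wt su).
  by apply: eq_Rintegral => y _; rewrite {1}ua; ring.
exists (prim u); split.
- split.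
  + by move=> x; case: (is_derive_prim x cu).
  + by move=> x; rewrite dq; case: (du x).
  + rewrite dq ddq => x; apply: cvgM; first exact: cvg_cst.
    exact: (ddE_continuous Hw wt su).
- by split => //; [exact: (integrable_U_prim Hw km_H2 l0 ld su)|rewrite (energy_prim Hw km_H2 l0 ld su) EK].
(* A competitor is the primitive of its weak derivative, which has energy [K] and is therefore
   admissible. *)
- move=> p [Hp _ Ep]; rewrite (T_prim cu su) (H_T Hp) lee_fin ler_pM2l// nu.
  apply: nstar_le; split; first exact: H_sqint.
  move: Ep; rewrite {1}(H_prim_weak_deriv Hp) (energy_prim Hw km_H2 l0 ld); last exact: H_sqint.
  by move=> -[->].
(* The multiplier is the factor in [u = a dE u]. Differentiating this equation and dividing by [a]
   gives the Euler-Lagrange equation with [c^2 = 1 / a]. *)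
exists a, (Num.sqrt a^-1).
have csq : Num.sqrt a^-1 ^+ 2 = a^-1 by rewrite sqr_sqrtr// invr_ge0 ltW.
split => //.
- move=> zeta Hz; rewrite mult// {2 3}(H_prim_weak_deriv Hz).
  by rewrite (pairing_prim Hw km_H2 l0 ld su (H_sqint Hz)) EFinM.
- move=> lambda' Hl; have := Hl _ Hq; rewrite mult// (pairing_prim Hw km_H2 l0 ld su su) -EFinM => -[].
  have -> : \int[lebesgue_measure]_y (weak_deriv (prim u) y * dE u y) = \int[lebesgue_measure]_y (u y * dE u y).
    by rewrite /Rintegral (integral_weak_derivM cu (sqint_dE Hw wt su).1).
  (* In the identity tested with [prim u] itself, the pairing is at least [E u = K > 0] and can be
     cancelled. *)
  have := E_le_pairing Hw wt su; rewrite EK => /(lt_le_trans Kgt0) P0.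
  by move=> /esym/mulIf; apply; rewrite gt_eqF.
- by rewrite csq invr_gt0.
- by rewrite csq => x; rewrite dq ddq (ddE_prim Hw km_H2 l0 ld _ su) mulKf// gt_eqF.
Qed.
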